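(* Let $i\in\{1,2\}$ be the chosen treatment of the wall boundary condition (flux $H_W^1$ or $H_W^2$), let the Vijayasundaram numerical flux be used on inner edges, and let $J_h(w_h)=\int_{\Gamma_W}H_W^i(w_h^{(+)},n)\cdot\tilde\vartheta\,dS$ be the modified target functional, with linearization $J_h^{L}$ as defined in the context. Then the discontinuous Galerkin discretization is adjoint consistent: if $w$ is the exact (smooth) solution of the Euler equations $\sum_{s=1}^2\frac{\partial f_s(w)}{\partial x_s}=0$ in $\Omega$ with boundary conditions $w_2n_1+w_3n_2=0$ on $\Gamma_W$ and $\mathbb P^-(w,n)(w-w_{BC})=0$ on $\Gamma_{IO}$, and $z\in[H^1(\Omega)]^4$ solves the continuous adjoint problem $$\int_{\Gamma}z^T\mathbb P(w,n)\varphi\,dS-\int_\Omega\sum_{s=1}^2\frac{\partial z^T}{\partial x_s}\mathbb A_s(w)\varphi\,dx=J'[w](\varphi)\qquad\forall\varphi\in\tilde V,$$ then $$r_h^*(w,z)(\varphi):=J_h^{L}(w,\varphi)-a_h^{L}(w,\varphi,z)=0\qquad\forall\varphi\in\tilde V .$$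
   Context: Fix $\gamma>1$. State vectors are $w=(w_1,w_2,w_3,w_4)^T=(\rho,\rho v_1,\rho v_2,E)^T\in\mathbb R^4$, with velocity $\mathbf v=(v_1,v_2)=(w_2/w_1,w_3/w_1)$ and pressure $\mathrm p(w)=(\gamma-1)\big(E-\tfrac12\rho|\mathbf v|^2\big)$. The admissible set is $\mathcal D=\{w\in\mathbb R^4: w_1>0,\ \mathrm p(w)>0\}$. The inviscid Euler fluxes are $f_1(w)=(\rho v_1,\rho v_1^2+\mathrm p,\rho v_1v_2,(E+\mathrm p)v_1)^T$ and $f_2(w)=(\rho v_2,\rho v_1v_2,\rho v_2^2+\mathrm p,(E+\mathrm p)v_2)^T$, with Jacobi matrices $\mathbb A_s(w)=\frac{Df_s(w)}{Dw}$. For a unit vector $n=(n_1,n_2)$, $\mathbf P(w,n)=f_1(w)n_1+f_2(w)n_2$ and $\mathbb P(w,n)=\frac{D\mathbf P(w,n)}{Dw}=\mathbb A_1(w)n_1+\mathbb A_2(w)n_2$. For $w\in\mathcal D$ this matrix is diagonalizable over $\mathbb R$, $\mathbb P=\mathbb T^{-1}\mathrm{diag}(\lambda_i)\mathbb T$, and $\mathbb P^{\pm}=\mathbb T^{-1}\mathrm{diag}(\lambda_i^\pm)\mathbb T$ with $\lambda^+=\max(\lambda,0)$, $\lambda^-=\min(\lambda,0)$. Further $\mathrm p_n(w)=\mathrm p(w)(0,n_1,n_2,0)^T$ and $P_W(w,n)=\frac{D\mathrm p_n(w)}{Dw}$ is its $4\times4$ Jacobi matrix with respect to $w$. $\Omega\subset\mathbb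 R^2$ is a bounded domain with boundary $\Gamma$ decomposed into two disjoint parts, the impermeable walls $\Gamma_W$ and the inlet/outlet $\Gamma_{IO}$, $\overline\Gamma=\overline{\Gamma_W}\cup\overline{\Gamma_{IO}}$; $w_{BC}$ is a prescribed boundary state on $\Gamma_{IO}$. ''Smooth solution'' means $w\in[C^1(\overline\Omega)]^4$ with values in $\mathcal D$ on $\overline\Omega$. Let $V=\{\varphi\in[H^1(\Omega)]^4:\varphi(x)\in\mathcal D\text{ a.e.}\}$ and $$\tilde V=\{\varphi\in V:\ \varphi_2n_1+\varphi_3n_2=0\text{ on }\Gamma_W,\ \mathbb P^-(w,n)\varphi=0\text{ on }\Gamma_{IO}\}.$$ Target functional. $\vartheta=(\vartheta_1,\vartheta_2)^T$ on $\Gamma_W$ is one of: $\vartheta_D=\frac1{C_\infty}(\cos\alpha,\sin\alpha)^T$ (drag), $\vartheta_L=\frac1{C_\infty}(-\sin\alpha,\cos\alpha)^T$ (lift), $\vartheta_M(x)=\frac1{C_\infty L}\big((x-x_{ref})^T\mathbb G\,\mathbb Q(\alpha)\big)^T$ (moment). Here $\alpha$ is the angle of attack, $C_\infty=\frac12\rho_\infty|\mathbf v_\infty|^2L>0$ with far-field density $\rho_\infty$ and velocity $\mathbf v_\infty$, $L>0$ is a reference length, $x_{ref}\in\Omega$, $\mathbb Q(\alpha)$ is the counterclockwise rotation by $\alpha$, and $\mathbb G=\begin{pmatrix}0&1\\-1&0\end{pmatrix}$. Put $\tilde\vartheta=(0,\vartheta_1,\vartheta_2,0)^T$. Then $J(w)=\int_{\Gamma_W}\mathrm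 p(w)\,n\cdot\vartheta\,dS$, and $J'[w](\varphi)=\int_{\Gamma_W}\tilde\vartheta^TP_W(w,n)\varphi\,dS$ is its derivative at $w$ in direction $\varphi$. Mesh. $\mathcal T_h=\{K\}$ is a finite mesh of $\overline\Omega$ by non-overlapping elements (e.g. triangles), $n$ is the unit outer normal to $\partial K$ (or $\Gamma$), $H^1_h=\{\varphi\in[L^2(\Omega)]^4:\varphi|_K\in[H^1(K)]^4\ \forall K\}$ and $V_h=\{w\in H^1_h: w(x)\in\mathcal D\text{ a.e.}\}$. On $\partial K$, $w^{(+)}$, $w^{(-)}$ are the interior and exterior traces with respect to $K$, and on $\partial K\setminus\Gamma$ one sets $\{\!\{w\}\!\}=\frac12(w^{(+)}+w^{(-)})$. Numerical fluxes. Vijayasundaram flux on inner edges: $\mathbb P^+(\{\!\{w\}\!\},n)w^{(+)}+\mathbb P^-(\{\!\{w\}\!\},n)w^{(-)}$. On $\Gamma_W$ let $$\mathbb U_\Gamma=\begin{pmatrix}1&0&0&0\\0&1-n_1^2&-n_1n_2&0\\0&-n_1n_2&1-n_2^2&0\\0&0&0&1\end{pmatrix},\quad \mathbb M_\Gamma=2\,\mathbb U_\Gamma-I,\quad u_\Gamma(w)=\mathbb U_\Gamma w.$$ The two alternatives for the wall flux are $H_W^1(w,n)=\sum_{s=1}^2f_s(u_\Gamma(w))n_s$ (boundary value operator) and $H_W^2(w,n)=\mathbb P^+(u_\Gamma(w),n)w+\mathbb P^-(u_\Gamma(w),n)\mathbb M_\Gamma w$ (mirror operator). Their linearizations are represented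 by the matrices $$\mathbb H_W^{1,L}(\bar w,n)=P_W(u_\Gamma(\bar w),n)\,\mathbb U_\Gamma,\qquad \mathbb H_W^{2,L}(\bar w,n)=\mathbb P^+(u_\Gamma(\bar w),n)+\mathbb P^-(u_\Gamma(\bar w),n)\,\mathbb M_\Gamma .$$ Linearized form (linear in its second and third arguments), for $\bar w\in V_h$ and $\psi,\varphi\in H^1_h$ with the chosen $i$: $$\begin{aligned}a_h^{L}(\bar w,\psi,\varphi)=&-\sum_K\int_K\sum_{s=1}^2\mathbb A_s(\bar w)\psi\cdot\frac{\partial\varphi}{\partial x_s}\,dx\\&+\sum_K\int_{\partial K\setminus\Gamma}\big[\mathbb P^+(\{\!\{\bar w\}\!\},n)\psi^{(+)}+\mathbb P^-(\{\!\{\bar w\}\!\},n)\psi^{(-)}\big]\cdot\varphi^{(+)}\,dS\\&+\sum_K\int_{\partial K\cap\Gamma_W}\varphi^T\,\mathbb H_W^{i,L}(\bar w,n)\,\psi\,dS+\sum_K\int_{\partial K\cap\Gamma_{IO}}\big(\mathbb P^+(\bar w^{(+)},n)\psi^{(+)}\big)\cdot\varphi\,dS .\end{aligned}$$ Linearization of $J_h$ (same $i$): $J_h^{L}(\bar w,\varphi)=\int_{\Gamma_W}\varphi^T\big(\mathbb H_W^{i,L}(\bar w^{(+)},n)\big)^T\tilde\vartheta\,dS$. The discrete adjoint problem is to find $z_h$ in the discontinuous piecewise polynomial space with $a_h^L(w_h,\varphi_h,z_h)=J_h^L(w_h,\varphi_h)$ for all discrete $\varphi_h$, where $w_h$ is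 the discrete primal solution; adjoint consistency refers to the residual $r_h^*$ of this problem evaluated at the exact solutions. *)

(* Defs.v *)
From HB Require Import structures.
From mathcomp Require Import all_boot all_order all_algebra.
From mathcomp Require Import all_classical all_reals all_analysis.
Import Order.TTheory GRing.Theory Num.Theory.
Import numFieldNormedType.Exports.

Set Implicit Arguments.
Unset Strict Implicit.
Unset Printing Implicit Defensive.

Local Open Scope classical_set_scope.
Local Open Scope ring_scope.

Notation plane R := (R * R)%type.

Section Plane.
Context {R : realType}.
Implicit Types (x y : plane R) (s : 'I_2) (D : set (plane R)).

Definition dot n (u v : 'cV[R]_n) : R := (u^T *m v) 0 0.

Definition vec2 x : 'cV[R]_2 := \col_(s < 2) [:: x.1; x.2]`_s.

Definition axis s : plane R := if s == 0 then (1, 0) else (0, 1).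

(* The norm of the library on [R * R] is the maximum norm. *)
Definition edist x y : R := Num.sqrt (dot (vec2 (x - y)) (vec2 (x - y))).

Definition disc x (r : R) : set (plane R) := [set y | edist y x < r].

Definition bdry D : set (plane R) := closure D `\` interior D.

Definition area : {measure set (measurableTypeR R * measurableTypeR R) -> \bar R} :=
  (@lebesgue_measure R \x @lebesgue_measure R)%E.

End Plane.

Section Hausdorff.
Context {R : realType}.
Local Open Scope ereal_scope.
Implicit Types U A : set (plane R).

Definition diam U : \bar R :=
  ereal_sup ([set 0] `|` [set e | exists x y, [/\ U x, U y & e = (edist x y)%:E]]).

Definition diam_upto (delta : R) U : \bar R :=
  if diam U <= delta%:E then diam U else +oo.

(* [mu_ext] takes the infimum over countable Borel covers; nothing changes with
   arbitrary covers because a set and its closure have the same diameter. *)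
Definition hausdorff1 A : \bar R :=
  ereal_sup [set mu_ext (diam_upto delta) A | delta in [set d : R | (0 < d)%R]].

Lemma diam_ge0 U : 0 <= diam U.
Proof. by apply: ereal_sup_ubound; left. Qed.

Lemma diam_set0 : diam set0 = 0.
Proof.
apply/eqP; rewrite eq_le diam_ge0 andbT; apply: ge_ereal_sup => e /= [->//|].
by move=> [x [y []]].
Qed.

Lemma diam_upto_ge0 d U : 0 <= diam_upto d U.
Proof. by rewrite /diam_upto; case: ifP => _ //; exact: diam_ge0. Qed.

Lemma diam_upto_set0 d : (0 < d)%R -> diam_upto d set0 = 0.
Proof. by move=> d0; rewrite /diam_upto diam_set0 lee_fin ltW. Qed.

Lemma hausdorff1_set0 : hausdorff1 set0 = 0.
Proof.
rewrite /hausdorff1; set S := (X in ereal_sup X).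
rewrite (_ : S = [set 0]) ?ereal_sup1//; apply/seteqP; split=> [_ [d d0 <-]|_ ->] /=.
  by apply: mu_ext0 => *; [exact: diam_upto_set0|exact: diam_upto_ge0].
by exists 1%R => /=; [exact: ltr01|];
   apply: mu_ext0 => *; [exact/diam_upto_set0/ltr01|exact: diam_upto_ge0].
Qed.

Lemma hausdorff1_ge0 A : 0 <= hausdorff1 A.
Proof.
apply: (@le_trans _ _ (mu_ext (diam_upto 1) A)).
  by apply: mu_ext_ge0 => *; exact: diam_upto_ge0.
by apply: ereal_sup_ubound; exists 1%R => //=; exact: ltr01.
Qed.

Lemma le_hausdorff1 : {homo hausdorff1 : A B / A `<=` B >-> A <= B}.
Proof.
move=> A B AB; apply: ge_ereal_sup => _ [d d0 <-].
apply: (le_trans (le_mu_ext _ AB)).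
by apply: ereal_sup_ubound; exists d.
Qed.

Lemma hausdorff1_sigma_subadditive : sigma_subadditive hausdorff1.
Proof.
move=> F; apply: ge_ereal_sup => _ [d d0 <-].
apply: (le_trans (mu_ext_sigma_subadditive _ _)).
- by move=> *; exact: diam_upto_ge0.
- apply: lee_nneseries => n *; first by apply: mu_ext_ge0 => *; exact: diam_upto_ge0.
  by apply: ereal_sup_ubound; exists d.
Qed.

HB.instance Definition _ := isOuterMeasure.Build R (plane R) hausdorff1
  hausdorff1_set0 hausdorff1_ge0 le_hausdorff1 hausdorff1_sigma_subadditive.

Definition hausdorff1_outer : {outer_measure set (plane R) -> \bar R} :=
  hausdorff1.

(* Arc length dS, on the sigma-algebra of Caratheodory-measurable sets. *)
Definition arclen : {measure set (caratheodory_type hausdorff1) -> \bar R} :=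
  hausdorff1_outer.

End Hausdorff.

Section Sobolev.
Context {R : realType}.
Implicit Types (x y : plane R) (s : 'I_2) (D : set (plane R)).

Definition L2 d (T : measurableType d) (mu : {measure set T -> \bar R})
    (D : set T) (f : T -> R) : Prop :=
  measurable_fun D f /\ mu.-integrable D (fun t => (f t ^+ 2)%:E).

Definition C1 (f : plane R -> R) : Prop :=
  continuous f /\
  forall s, (forall x, derivable f x (axis s)) /\ continuous ('D_(axis s) f).

(* C^1 up to the boundary: the first derivatives inside [D] extend continuously
   to its closure; the values of [f] outside the closure are irrelevant. *)
Definition C1_closure (V : normedModType R) D (f : plane R -> V) : Prop :=
  {within closure D, continuous f} /\
  forall s, (forall x, D x -> derivable f x (axis s)) /\
    exists2 g : plane R -> V, {within closure D, continuous g} &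
      forall x, D x -> g x = 'D_(axis s) f x.

Definition compactly_supported_in D (f : plane R -> R) : Prop :=
  exists2 C : set (plane R), compact C /\ C `<=` D & forall x, ~ C x -> f x = 0.

Definition is_weak_deriv D s (f g : plane R -> R) : Prop :=
  L2 area D g /\
  forall psi, C1 psi -> compactly_supported_in D psi ->
    \int[area]_(x in D) (f x * 'D_(axis s) psi x) =
    - (\int[area]_(x in D) (g x * psi x)).

Definition sobolev1 D (f : plane R -> R) : Prop :=
  L2 area D f /\ forall s, exists g, is_weak_deriv D s f g.

Definition weak_deriv D s (f : plane R -> R) : plane R -> R :=
  xget (fun=> 0) [set g | is_weak_deriv D s f g].

Definition sobolev1_normsq D (f : plane R -> R) : R :=
  (\int[area]_(x in D) (f x ^+ 2)) +
  \sum_(s < 2) (\int[area]_(x in D) (weak_deriv D s f x ^+ 2)).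

(* Blow-up (measure-theoretic) unit outer normal: near [x], the set [D] fills the
   half-disc opposite to [nu] and is negligible in the other one.  On a piecewise
   C^1 boundary it is the usual unit outer normal, away from corners. *)
Definition is_outer_normal D x (nu : 'cV[R]_2) : Prop :=
  let side y := dot nu (vec2 (y - x)) in
  [/\ dot nu nu = 1,
      (fun r : R => fine (area ((disc x r `&` D) `&` [set y | 0 < side y])) / r ^+ 2)
        @ 0^'+ --> (0 : R) &
      (fun r : R => fine (area ((disc x r `\` D) `&` [set y | side y < 0])) / r ^+ 2)
        @ 0^'+ --> (0 : R)].

(* The trace operator H^1(D) -> L^2(dD), with Green's formula. *)
Record is_trace_operator D (n : plane R -> 'cV[R]_2)
    (tr : (plane R -> R) -> plane R -> R) : Prop := IsTraceOperator {
  trace_L2 : forall f, sobolev1 D f -> L2 arclen (bdry D) (tr f);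
  trace_linear : forall (a : R) f g, sobolev1 D f -> sobolev1 D g ->
    {ae arclen, forall x, bdry D x ->
       tr (fun y => a * f y + g y) x = a * tr f x + tr g x};
  trace_bounded : exists C : R, forall f, sobolev1 D f ->
    \int[arclen]_(x in bdry D) (tr f x ^+ 2) <= C * sobolev1_normsq D f;
  trace_restriction : forall f, sobolev1 D f ->
    {within closure D, continuous f} ->
    {ae arclen, forall x, bdry D x -> tr f x = f x};
  trace_green : forall f psi s, sobolev1 D f -> C1 psi ->
    \int[area]_(x in D) (f x * 'D_(axis s) psi x) =
    - (\int[area]_(x in D) (weak_deriv D s f x * psi x)) +
    (\int[arclen]_(x in bdry D) (tr f x * psi x * n x s 0)) }.

(* Bounded open sets whose boundary is regular enough for surface integrals,
   an outer normal and traces of H^1 functions; bounded Lipschitz open sets are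
   examples.  The conditions determine [normal] and [trace] up to null sets. *)
Record trace_domain : Type := TraceDomain {
  carrier :> set (plane R);
  normal : plane R -> 'cV[R]_2;
  trace : (plane R -> R) -> plane R -> R;
  carrier_open : open carrier;
  carrier_bounded : bounded_set carrier;
  bdry_finite : (arclen (bdry carrier) < +oo)%E;
  normal_measurable : forall s, measurable_fun
    (bdry carrier : set (caratheodory_type (@hausdorff1 R))) (fun x => normal x s 0);
  normal_outer : {ae arclen, forall x, bdry carrier x ->
    is_outer_normal carrier x (normal x)};
  trace_operator : is_trace_operator carrier normal trace }.

Section Vector.
Variable m : nat.
Implicit Types phi : plane R -> 'cV[R]_m.

Definition vsobolev1 D phi : Prop := forall i, sobolev1 D (fun x => phi x i 0).

Definition vL2 D phi : Prop := forall i, L2 area D (fun x => phi x i 0).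

Definition vweak_deriv D s phi x : 'cV[R]_m :=
  \col_i weak_deriv D s (fun y => phi y i 0) x.

Definition vtrace (D : trace_domain) phi x : 'cV[R]_m :=
  \col_i trace D (fun y => phi y i 0) x.

End Vector.
End Sobolev.

Arguments trace_domain R : clear implicits.

Section Euler.
Context {R : realType}.
Variable gamma : R.
Implicit Types (w u : 'cV[R]_4) (nu : 'cV[R]_2) (s : 'I_2).

Definition col4 (a b c d : R) : 'cV[R]_4 := \col_(i < 4) [:: a; b; c; d]`_i.

Definition density w : R := w (@Ordinal 4 0 isT) 0.
Definition momentum1 w : R := w (@Ordinal 4 1 isT) 0.
Definition momentum2 w : R := w (@Ordinal 4 2 isT) 0.
Definition energy w : R := w (@Ordinal 4 3 isT) 0.
Definition velocity1 w : R := momentum1 w / density w.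
Definition velocity2 w : R := momentum2 w / density w.

Definition pressure w : R :=
  (gamma - 1) *
  (energy w - 2^-1 * density w * (velocity1 w ^+ 2 + velocity2 w ^+ 2)).

Definition admissible w : Prop := 0 < density w /\ 0 < pressure w.

Definition flux1 w : 'cV[R]_4 :=
  let: (rho, v1, v2, E, p) :=
    (density w, velocity1 w, velocity2 w, energy w, pressure w) in
  col4 (rho * v1) (rho * v1 ^+ 2 + p) (rho * v1 * v2) ((E + p) * v1).

Definition flux2 w : 'cV[R]_4 :=
  let: (rho, v1, v2, E, p) :=
    (density w, velocity1 w, velocity2 w, energy w, pressure w) in
  col4 (rho * v2) (rho * v1 * v2) (rho * v2 ^+ 2 + p) ((E + p) * v2).

Definition flux s : 'cV[R]_4 -> 'cV[R]_4 := if s == 0 then flux1 else flux2.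

(* Jacobi matrix Df/Dw acting on column vectors; the jacobian of the library
   acts on row vectors and is its transpose. *)
Definition jacobi (f : 'cV[R]_4 -> 'cV[R]_4) w : 'M[R]_4 :=
  \matrix_(i, j) 'D_(delta_mx j 0) (fun u => f u i 0) w.

Definition flux_jacobi s w : 'M[R]_4 := jacobi (flux s) w.

Definition normal_flux w nu : 'cV[R]_4 := \sum_(s < 2) nu s 0 *: flux s w.

Definition normal_flux_jacobi w nu : 'M[R]_4 := jacobi (normal_flux ^~ nu) w.

(* [invmx T *m diag_mx (g d) *m T] for any diagonalization
   [A = invmx T *m diag_mx d *m T]; it does not depend on the choice of (T, d). *)
Definition spectral_map (g : R -> R) n (A : 'M[R]_n) : 'M[R]_n :=
  xget 0 [set B | exists T : 'M[R]_n, exists d : 'rV[R]_n,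
    [/\ T \in unitmx, A = invmx T *m diag_mx d *m T &
        B = invmx T *m diag_mx (map_mx g d) *m T]].

Definition Pplus w nu : 'M[R]_4 :=
  spectral_map (fun l => Num.max l 0) (normal_flux_jacobi w nu).

Definition Pminus w nu : 'M[R]_4 :=
  spectral_map (fun l => Num.min l 0) (normal_flux_jacobi w nu).

Definition normal_pressure w nu : 'cV[R]_4 :=
  pressure w *: col4 0 (nu 0 0) (nu 1 0) 0.

Definition PW w nu : 'M[R]_4 := jacobi (normal_pressure ^~ nu) w.

Definition Ugamma nu : 'M[R]_4 :=
  let: (n1, n2) := (nu 0 0, nu 1 0) in
  \matrix_(i < 4, j < 4)
    (nth [::] [:: [:: 1; 0;             0;             0];
                  [:: 0; 1 - n1 ^+ 2; - (n1 * n2);     0];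
                  [:: 0; - (n1 * n2);   1 - n2 ^+ 2;   0];
                  [:: 0; 0;             0;             1]] i)`_j.

Definition Mgamma nu : 'M[R]_4 := 2 *: Ugamma nu - 1%:M.

Inductive wall_treatment := BoundaryValue | Mirror.

Definition wall_flux (i : wall_treatment) w nu : 'cV[R]_4 :=
  let ug := Ugamma nu *m w in
  match i with
  | BoundaryValue => \sum_(s < 2) nu s 0 *: flux s ug
  | Mirror => Pplus ug nu *m w + Pminus ug nu *m (Mgamma nu *m w)
  end.

Definition wall_flux_lin (i : wall_treatment) w nu : 'M[R]_4 :=
  let ug := Ugamma nu *m w in
  match i with
  | BoundaryValue => PW ug nu *m Ugamma nu
  | Mirror => Pplus ug nu + Pminus ug nu *m Mgamma nu
  end.

End Euler.

Section Target.
Context {R : realType}.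

Inductive target := Drag | Lift | Moment.

Definition rotation (alpha : R) : 'M[R]_2 :=
  \matrix_(i < 2, j < 2)
    (nth [::] [:: [:: cos alpha; - sin alpha]; [:: sin alpha; cos alpha]] i)`_j.

Definition Gmx : 'M[R]_2 :=
  \matrix_(i < 2, j < 2) (nth [::] [:: [:: 0; 1]; [:: -1; 0]] i)`_j.

Definition C_infty (rho_inf : R) (v_inf : 'cV[R]_2) (L : R) : R :=
  2^-1 * rho_inf * dot v_inf v_inf * L.

Definition theta (k : target) (alpha Cinf L : R) (xref x : plane R) : 'cV[R]_2 :=
  match k with
  | Drag => Cinf^-1 *: \col_(s < 2) [:: cos alpha; sin alpha]`_s
  | Lift => Cinf^-1 *: \col_(s < 2) [:: - sin alpha; cos alpha]`_s
  | Moment => (Cinf * L)^-1 *: ((vec2 (x - xref))^T *m Gmx *m rotation alpha)^T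
  end.

Definition lift_theta (th : plane R -> 'cV[R]_2) (x : plane R) : 'cV[R]_4 :=
  col4 0 (th x 0 0) (th x 1 0) 0.

End Target.

Section Continuous.
Context {R : realType}.
Variables (gamma : R) (Omega : trace_domain R) (GammaW GammaIO : set (plane R)).
Variable th : plane R -> 'cV[R]_2.
Implicit Types (w phi z : plane R -> 'cV[R]_4).

Notation Gamma := (bdry (Omega : set (plane R))).
Notation n := (normal Omega).

Record boundary_decomposition : Prop := BoundaryDecomposition {
  GammaW_sub : GammaW `<=` Gamma;
  GammaIO_sub : GammaIO `<=` Gamma;
  Gamma_disjoint : GammaW `&` GammaIO = set0;
  Gamma_closure : closure Gamma = closure GammaW `|` closure GammaIO;
  GammaW_measurable : (@hausdorff1 R).-cara.-measurable GammaW;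
  GammaIO_measurable : (@hausdorff1 R).-cara.-measurable GammaIO;
  Gamma_null : arclen (Gamma `\` (GammaW `|` GammaIO)) = 0%E }.

Definition smooth w : Prop :=
  C1_closure Omega w /\ forall x, closure Omega x -> admissible gamma (w x).

Definition euler_solution (wBC : plane R -> 'cV[R]_4) w : Prop :=
  [/\ forall x, carrier Omega x ->
        \sum_(s < 2) 'D_(axis s) (fun y => flux gamma s (w y)) x = 0,
      {ae arclen, forall x, GammaW x ->
        momentum1 (w x) * n x 0 0 + momentum2 (w x) * n x 1 0 = 0} &
      {ae arclen, forall x, GammaIO x ->
        Pminus gamma (w x) (n x) *m (w x - wBC x) = 0}].

Definition V phi : Prop :=
  vsobolev1 Omega phi /\
  {ae area, forall x, carrier Omega x -> admissible gamma (phi x)}.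

Definition Vtilde w phi : Prop :=
  [/\ V phi,
      {ae arclen, forall x, GammaW x ->
        momentum1 (vtrace Omega phi x) * n x 0 0 +
        momentum2 (vtrace Omega phi x) * n x 1 0 = 0} &
      {ae arclen, forall x, GammaIO x ->
        Pminus gamma (w x) (n x) *m vtrace Omega phi x = 0}].

Definition J w : R :=
  \int[arclen]_(x in GammaW) (pressure gamma (w x) * dot (n x) (th x)).

Definition Jprime w phi : R :=
  \int[arclen]_(x in GammaW)
    dot (lift_theta th x) (PW gamma (w x) (n x) *m vtrace Omega phi x).

Definition continuous_adjoint w z : Prop :=
  forall phi, Vtilde w phi ->
    (\int[arclen]_(x in Gamma)
      dot (vtrace Omega z x) (normal_flux_jacobi gamma (w x) (n x) *m vtrace Omega phi x))
    - (\int[area]_(x in Omega)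
      (\sum_(s < 2) dot (vweak_deriv Omega s z x) (flux_jacobi gamma s (w x) *m phi x)))
    = Jprime w phi.

End Continuous.

Section Discrete.
Context {R : realType}.
Variables (gamma : R) (Omega : trace_domain R) (GammaW GammaIO : set (plane R)).
Variable th : plane R -> 'cV[R]_2.
Variables (I : finType) (K : I -> trace_domain R) (i : wall_treatment).
Implicit Types (w wbar phi psi z : plane R -> 'cV[R]_4) (x : plane R) (k : I).

Notation Gamma := (bdry (Omega : set (plane R))).
Notation bd k := (bdry (K k : set (plane R))).

(* The elements are represented by their interiors [K k]. *)
Definition is_mesh : Prop :=
  [/\ forall k, K k `<=` Omega,
      forall k l, k != l -> K k `&` K l = set0 &
      closure Omega = \bigcup_k closure (K k)].

Definition H1h phi : Prop :=
  vL2 Omega phi /\ forall k, vsobolev1 (K k) phi.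

Definition Vh w : Prop :=
  H1h w /\ {ae area, forall x, carrier Omega x -> admissible gamma (w x)}.

(* Trace of a broken function at [x] from an element allowed by [P] whose
   boundary contains [x]; for the two uses below this element is unique for almost
   every [x]. *)
Definition trace_from (P : pred I) phi x : 'cV[R]_4 :=
  if [pick k | P k && `[< bd k x >]] is Some k then vtrace (K k) phi x else 0.

Definition trace_in k phi := vtrace (K k) phi.
Definition trace_out k phi := trace_from (predC1 k) phi.
Definition trace_bd phi := trace_from predT phi.

Definition mean k phi x : 'cV[R]_4 := 2^-1 *: (trace_in k phi x + trace_out k phi x).

(* Meant for [wbar] in [Vh] and [psi], [phi] in [H1h]. *)
Definition aL wbar psi phi : R :=
  - (\sum_k (\int[area]_(x in K k)
      (\sum_(s < 2) dot (flux_jacobi gamma s (wbar x) *m psi x)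
                        (vweak_deriv (K k) s phi x))))
  + (\sum_k (\int[arclen]_(x in bd k `\` Gamma)
      dot (Pplus gamma (mean k wbar x) (normal (K k) x) *m trace_in k psi x +
           Pminus gamma (mean k wbar x) (normal (K k) x) *m trace_out k psi x)
          (trace_in k phi x)))
  + (\sum_k (\int[arclen]_(x in bd k `&` GammaW)
      dot (trace_in k phi x)
          (wall_flux_lin gamma i (trace_in k wbar x) (normal (K k) x)
             *m trace_in k psi x)))
  + (\sum_k (\int[arclen]_(x in bd k `&` GammaIO)
      dot (Pplus gamma (trace_in k wbar x) (normal (K k) x) *m trace_in k psi x)
          (trace_in k phi x))).

Definition Jh w : R :=
  \int[arclen]_(x in GammaW)
    dot (wall_flux gamma i (trace_bd w x) (normal Omega x)) (lift_theta th x).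

(* Linearization of [Jh]. *)
Definition JhL wbar phi : R :=
  \int[arclen]_(x in GammaW)
    dot (trace_bd phi x)
        ((wall_flux_lin gamma i (trace_bd wbar x) (normal Omega x))^T
           *m lift_theta th x).

Definition adjoint_residual w z phi : R := JhL w phi - aL w phi z.

End Discrete.

(* Main.v *)
(* At the exact solutions all jumps over inner edges vanish, so the discrete
   adjoint form collapses to the continuous one.

   On inner edges P^+ + P^- = P (the Euler equations are hyperbolic), hence the
   edge terms of an element are the integrals of z^T P(w,n) phi; on a wall both
   numerical fluxes linearize to P_W(w,n) phi = P(w,n) phi because w and phi are
   tangential there, and on the inlet/outlet P^- phi = 0.

   That traces from the two sides of an edge agree, with opposite normals, is
   obtained from Green's formula: summing it over the elements and comparing it
   with Green's formula on Omega shows that, as a measure against C^1 test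
   functions, the sum of tr_K(f) n_K over the elements equals tr_Omega(f) n on
   the boundary of Omega, so the densities agree almost everywhere for arc
   length.  A blow-up shows that two disjoint elements with a common boundary
   point have opposite normals there; with f = 1 it follows that almost every
   point of the boundary of Omega lies on exactly one element boundary and almost
   every other interface point on exactly two. *)

Require Import Defs.
From mathcomp Require Import all_boot all_order all_algebra.
From mathcomp Require Import all_classical all_reals all_analysis.
Import Order.TTheory GRing.Theory Num.Theory.
Import numFieldNormedType.Exports.
Local Open Scope classical_set_scope.
Local Open Scope ring_scope.
From mathcomp Require Import measurable_realfun ring lra.

Set Implicit Arguments.
Unset Strict Implicit.
Unset Printing Implicit Defensive.

(** Three obstacles shape the proof. Arc length lives on the Caratheodory sets of an outer measure,
    a sigma-algebra finer than the Borel one, while integrals against C^1 functions see Borel sets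
    only. Hence two facts about Hausdorff measure are needed: Borel sets are Caratheodory
    measurable, and a set of finite length lies in a Borel set of the same length. The second one
    applies because the densities to be compared live on finitely many boundaries of finite length.

    Green's formula controls only the product of trace and normal. A trace value is recovered from
    it because the normals are unit vectors, which holds almost everywhere only.

    P^+ and P^- are defined by [spectral_map], a choice whose default value is 0. An explicit
    eigenbasis shows that the default does not occur, but measurability in the space variable stays
    invisible. Every surface integrand is therefore compared with z^T P(w,n) phi, which is
    integrable because the Jacobi matrices are bounded and the traces square integrable;
    completeness of arc length then makes the original integrand measurable. *)

Local Notation edist := Defs.edist.

(** * Hausdorff measure *)

Section HausdorffMeasure.
Context {R : realType}.
Implicit Types (x y : plane R) (A B : set (plane R)).

Lemma dot2E (u v : 'cV[R]_2) : dot u v = u 0 0 * v 0 0 + u 1 0 * v 1 0.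
Proof.
rewrite /dot mxE !big_ord_recl big_ord0 addr0 !mxE.
by rewrite (_ : lift ord0 ord0 = 1) //; apply/val_inj.
Qed.

Lemma edistE x y :
  edist x y = Num.sqrt ((x.1 - y.1) ^+ 2 + (x.2 - y.2) ^+ 2).
Proof. by rewrite /edist dot2E !mxE /= -!expr2. Qed.

Lemma normr_fst_le_edist x y : `|x.1 - y.1| <= edist x y.
Proof. by rewrite edistE -sqrtr_sqr ler_wsqrtr// lerDl sqr_ge0. Qed.

Lemma normr_snd_le_edist x y : `|x.2 - y.2| <= edist x y.
Proof. by rewrite edistE -sqrtr_sqr ler_wsqrtr// lerDr sqr_ge0. Qed.

Lemma edist_le_diam U x y : U x -> U y -> ((edist x y)%:E <= diam U)%E.
Proof. by move=> Ux Uy; apply: ereal_sup_ubound; right; exists x, y. Qed.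

Lemma le_diam A B : A `<=` B -> (diam A <= diam B)%E.
Proof.
move=> AB; apply: ereal_sup_le => _ [->|[x [y [Ax Ay ->]]]]; first by left.
by right; exists x, y; split => //; exact: AB.
Qed.

Lemma le_diam_upto (d : R) A B : A `<=` B -> (diam_upto d A <= diam_upto d B)%E.
Proof.
move=> AB; rewrite /diam_upto; case: ifPn => Ad; last first.
  by rewrite ifF//; apply/negbTE; apply: contra Ad; exact/le_trans/le_diam.
by case: ifP => _; [exact: le_diam|rewrite leey].
Qed.

Variable c : plane R -> R.
Hypothesis c_lip : forall x y, c x - c y <= edist x y.
Hypothesis c_meas : measurable_fun setT c.

(** As [c] is 1-Lipschitz, a set [U] that meets both regions has diameter at least t - s > d, so the
    right side is infinite; otherwise one of the two pieces is empty. *)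
Lemma diam_upto_split (d s t : R) (U : set (plane R)) : 0 < d -> d < t - s ->
  (diam_upto d (U `&` [set x | (c x <= s)%R]) + diam_upto d (U `&` [set x | (t <= c x)%R])
   <= diam_upto d U)%E.
Proof.
move=> d0 dst; have [/= Es|/set0P[x [Ux xs]]] := eqVneq (U `&` [set x | (c x <= s)%R]) set0.
  by rewrite Es diam_upto_set0// add0e; apply: le_diam_upto => y [].
have [/= Et|/set0P[y [Uy yt]]] := eqVneq (U `&` [set x | (t <= c x)%R]) set0.
  by rewrite Et diam_upto_set0// adde0; apply: le_diam_upto => y [].
rewrite [leRHS]/diam_upto ifF ?leey//; apply/negbTE; rewrite -ltNge.
apply: (lt_le_trans _ (edist_le_diam Uy Ux)); rewrite lte_fin.
by rewrite (lt_le_trans dst)// (le_trans _ (c_lip _ _))// lerB.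
Qed.

(** Every cover of the union is cut along the sublevel and superlevel sets of [c] into a cover of
    [A] and a cover of [B]; measurability of [c] keeps the pieces Borel. *)
Lemma mu_ext_diam_split (d s t : R) A B : 0 < d -> d < t - s ->
  A `<=` [set x | (c x <= s)%R] -> B `<=` [set x | (t <= c x)%R] ->
  (mu_ext (diam_upto d) A + mu_ext (diam_upto d) B
   <= mu_ext (diam_upto d) (A `|` B))%E.
Proof.
move=> d0 dst As Bt; apply: le_ereal_inf_tmp => _ [F [mF ABF] <-].
have ms : measurable [set x | (c x <= s)%R].
  by rewrite -[X in measurable X]setTI -[X in _ `&` X]/(c @^-1` [set` `]-oo, s]]);
    apply: c_meas.
have mt : measurable [set x | (t <= c x)%R].
  rewrite (_ : [set x | _] = setT `&` (c @^-1` [set` `[t, +oo[])); last first.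
    by apply/seteqP; split => x /=; rewrite in_itv/= andbT => // -[].
  exact: c_meas.
apply: (@le_trans _ _ (\sum_(k <oo) (diam_upto d (F k `&` [set x | (c x <= s)%R]) +
    diam_upto d (F k `&` [set x | (t <= c x)%R]))))%E; last first.
  apply: lee_nneseries => *; last exact: diam_upto_split dst.
  by apply: adde_ge0; exact: diam_upto_ge0.
rewrite nneseriesD; [|by move=> *; exact: diam_upto_ge0..].
apply: leeD; apply: ereal_inf_lbound.
- exists (fun k => F k `&` [set x | (c x <= s)%R]) => //; split.
    by move=> k; exact: measurableI.
  by move=> x Ax; have [k _ Fx] := ABF x (or_introl Ax); exists k => //; split => //; exact: As.
- exists (fun k => F k `&` [set x | (t <= c x)%R]) => //; split.
    by move=> k; exact: measurableI.
  by move=> x Ax; have [k _ Fx] := ABF x (or_intror Ax); exists k => //; split => //; exact: Bt.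
Qed.

Lemma le_mu_ext_diam (d e : R) A : d <= e ->
  (mu_ext (diam_upto e) A <= mu_ext (diam_upto d) A)%E.
Proof.
move=> de; apply: le_ereal_inf_tmp => _ [F FA <-].
apply: (@le_trans _ _ (\sum_(k <oo) (diam_upto e (F k))))%E.
  by apply: ereal_inf_lbound; exists F.
apply: lee_nneseries => [*|k _]; first exact: diam_upto_ge0.
rewrite /diam_upto; case: ifPn => [Fd|]; first by case: ifPn => // _; exact: leey.
move=> Fe; rewrite ifF ?leey//; apply/negbTE; apply: contra Fe => /le_trans; apply.
by rewrite lee_fin.
Qed.

Lemma mu_ext_diam_le_hausdorff1 (d : R) A : 0 < d ->
  (mu_ext (diam_upto d) A <= hausdorff1 A)%E.
Proof. by move=> d0; apply: ereal_sup_ubound; exists d. Qed.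

(** This makes Hausdorff measure a metric outer measure. Two scales d1 and d2 are compared at one
    finer scale, taken at most (t - s) / 2 so as to stay below the gap. *)
Lemma hausdorff1_split (s t : R) A B : s < t ->
  A `<=` [set x | (c x <= s)%R] -> B `<=` [set x | (t <= c x)%R] ->
  (hausdorff1 A + hausdorff1 B <= hausdorff1 (A `|` B))%E.
Proof.
move=> st As Bt.
have H d1 d2 : 0 < d1 -> 0 < d2 ->
    (mu_ext (diam_upto d1) A + mu_ext (diam_upto d2) B <= hausdorff1 (A `|` B))%E.
  move=> d10 d20; pose d := Num.min (Num.min d1 d2) ((t - s) / 2).
  have ts2 : 0 < (t - s) / 2 by rewrite divr_gt0// subr_gt0.
  have d0 : 0 < d by rewrite !lt_min d10 d20.
  have dst : d < t - s.
    apply: (@le_lt_trans _ _ ((t - s) / 2)); first by rewrite !ge_min lexx !orbT.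
    by rewrite ltr_pdivrMr// ltr_pMr ?subr_gt0// (ltr_nat R 1 2).
  apply: (le_trans _ (mu_ext_diam_le_hausdorff1 _ d0)).
  apply: (le_trans _ (mu_ext_diam_split d0 dst As Bt)).
  by apply: leeD; apply: le_mu_ext_diam; rewrite !ge_min lexx ?orbT.
have HA0 : (0 <= hausdorff1 A)%E by exact: hausdorff1_ge0.
have HB0 : (0 <= hausdorff1 B)%E by exact: hausdorff1_ge0.
have mge0 (d : R) X : (0 <= mu_ext (diam_upto d) X)%E.
  by apply: mu_ext_ge0 => *; exact: diam_upto_ge0.
have [->|ABoo] := eqVneq (hausdorff1 (A `|` B)) +oo%E; first by rewrite leey.
have ABf : hausdorff1 (A `|` B) \is a fin_num by rewrite ge0_fin_numE ?lt_neqAle ?ABoo ?leey ?hausdorff1_ge0.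
have Af : hausdorff1 A \is a fin_num.
  rewrite ge0_fin_numE//; apply: (@le_lt_trans _ _ (hausdorff1 (A `|` B))).
    by apply: le_hausdorff1 => x; left.
  by rewrite -ge0_fin_numE ?hausdorff1_ge0.
have Bf d2 : 0 < d2 -> mu_ext (diam_upto d2) B \is a fin_num.
  move=> d20; rewrite ge0_fin_numE ?mge0//.
  apply: (le_lt_trans (mu_ext_diam_le_hausdorff1 _ d20)).
  apply: (@le_lt_trans _ _ (hausdorff1 (A `|` B))).
    by apply: le_hausdorff1 => x; right.
  by rewrite -ge0_fin_numE ?hausdorff1_ge0.
(* The suprema over d2 and d1 are taken one after the other; finiteness of the other summand allows
   it to be moved across the inequality. *)
rewrite -leeBrDl//; apply: ge_ereal_sup => _ [d2 d20 <-].
rewrite leeBrDl// -leeBrDr ?Bf//; apply: ge_ereal_sup => _ [d1 d10 <-].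
by rewrite leeBrDr ?Bf//; exact: H.
Qed.

(* The layers [D k.+1 `\` D k] and [D k.-1] are at positive distance, so the
   measures of the layers are bounded by the telescoping
   [mu (D k.+1) - mu (D k.-1)] and have small tails. *)
Lemma hausdorff1_caratheodory_lt (a : R) :
  (@hausdorff1_outer R).-caratheodory [set x | c x < a].
Proof.
apply: le_caratheodory_measurable => A.
have -> : hausdorff1_outer = @hausdorff1 R :> (set (plane R) -> \bar R) by [].
have [->|Aoo] := eqVneq (hausdorff1 A) +oo%E; first by rewrite leey.
have fin B : B `<=` A -> hausdorff1 B \is a fin_num.
  move=> BA; rewrite ge0_fin_numE ?hausdorff1_ge0//.
  by apply: (le_lt_trans (le_hausdorff1 BA)); rewrite lt_neqAle Aoo leey.
pose lev n := a - n.+1%:R^-1.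
have levS n : lev n < lev n.+1 by rewrite ltrD2l ltrN2 ltf_pV2 ?posrE// ltr_nat.
pose D n := A `&` [set x | c x <= lev n].
have DS n : D n `<=` D n.+1 by move=> x [Ax /= xn]; split => //=; exact: le_trans (ltW (levS n)).
pose r n := fine (hausdorff1 (D n)).
have Df n : hausdorff1 (D n) \is a fin_num by apply: fin => x [].
have Dr n : hausdorff1 (D n) = (r n)%:E by rewrite fineK.
have rS : nondecreasing_seq r.
  apply/nondecreasing_seqP => n; rewrite /r fine_le//; exact: le_hausdorff1.
have rA n : r n <= fine (hausdorff1 A).
  by rewrite fine_le// ?fin//; apply: le_hausdorff1 => x [].
have hs : has_sup (range r).
  by split; [exists (r 0), 0|exists (fine (hausdorff1 A)) => _ [n _ <-]].
pose L := sup (range r).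
have rL n : r n <= L by apply: sup_upper_bound => //; exists n.
pose layer k := D k.+1 `\` D k.
have layer_le k : (hausdorff1 (layer k.+1) <= (r k.+2 - r k)%:E)%E.
  rewrite EFinB -!Dr leeBrDl//.
  apply: (@le_trans _ _ (hausdorff1 (D k `|` layer k.+1))); last first.
    by apply: le_hausdorff1 => x [/DS/DS//|[]].
  apply: (hausdorff1_split (levS k)) => x; first by case.
  by move=> [[Ax _] /= /not_andP[//|/negP]]; rewrite -ltNge => /ltW.
have layers_sum n m : (\sum_(n.+1 <= k < n.+1 + m) hausdorff1 (layer k) <=
    (r (n + m).+1 + r (n + m)%N - r n.+1 - r n)%:E)%E.
  elim: m => [|m ih]; first by rewrite addn0 big_geq// addn0 lee_fin; lra.
  rewrite addnS (big_nat_recr _ _ _ (leq_addr m n.+1)).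
  rewrite [(n.+1 + m)%N]addSn.
  apply: (le_trans (leeD ih (layer_le _))).
  by rewrite -EFinD lee_fin !addnS; lra.
have AEL : (hausdorff1 (A `&` [set x | (c x < a)%R]) <= L%:E)%E.
  apply/lee_addgt0Pr => e e0.
  have [_ [n _ <-] rn] : exists2 y, range r y & L - e / 2 < y.
    by apply: sup_adherent => //; rewrite divr_gt0.
  (* The second summand is the telescoped tail with its two leading terms replaced by [L]. The total
     is 2L - r n, which is less than L + e / 2 by the choice of [n]. *)
  apply: (@le_trans _ _ ((r n.+1)%:E + (L + L - r n.+1 - r n)%:E))%E; last first.
    by rewrite -EFinD -EFinD lee_fin; lra.
  apply: (@le_trans _ _ (hausdorff1
      (D n.+1 `|` \bigcup_(k in ~` `I_n.+1) layer k))).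
    apply: le_hausdorff1 => x [Ax xa].
    have [m xm] : exists m, c x <= lev m.
      have e1 : 0 < (a - c x) by rewrite subr_gt0.
      near \oo => m; exists m; rewrite lerBrDl -lerBrDr ltW//.
      by near: m; exact: near_infty_natSinv_lt (PosNum e1).
    have [xn|xn] := boolP (`[< D n.+1 x >]); [left; exact: asboolW|right].
    have exD : exists m, `[< D m x >] by exists m; apply/asboolP; split.
    (* The least level set containing [x] has index k + 1, so [x] lies in layer [k]; index 0 is
       impossible, and n < k because [x] is not in [D n.+1]. *)
    case: (ex_minnP exD) => -[|k] /asboolP Dk kmin.
      exfalso; move/negP : xn; apply; apply/asboolP.
      elim: (n.+1) => // j; exact: DS.
    have nk : (n < k)%N.
      rewrite ltnNge; apply/negP => kn; move/negP : xn; apply; apply/asboolP.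
      rewrite -(subnK kn); elim: (n - k)%N => // j; rewrite addSn => Dj.
      exact: DS.
    exists k; first by move=> /=; apply/negP; rewrite -leqNgt.
    split => // /asboolP/kmin; by rewrite ltnn.
  apply: (le_trans (@outer_measureU2 _ _ hausdorff1_outer _ _)).
  rewrite -Dr; apply: leeD2l.
  apply: (le_trans (@outer_measure_sigma_subadditive_tail _ _ hausdorff1_outer _ _)).
  apply: lime_le; first by apply: is_cvg_nneseries => *; exact: hausdorff1_ge0.
  near=> N; have Nn : (n.+1 <= N)%N by near: N; exists n.+1.
  rewrite -(subnKC Nn); apply: (le_trans (layers_sum _ _)).
  rewrite lee_fin; have := rL (n + (N - n.+1)).+1.
  by have := rL (n + (N - n.+1))%N; lra.
have AC : ~` [set x | c x < a] = [set x | a <= c x].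
  by apply/seteqP; split => x /=; [move/negP; rewrite -leNgt|rewrite leNgt => /negP].
rewrite AC; apply: (le_trans (leeD2r _ AEL)).
rewrite -leeBrDr; last by apply: fin => x [].

(* [D n] and the part of [A] with a <= c are separated too, now by the gap between [lev n] and [a];
   the supremum over [n] concludes. *)
have lim_le : forall n, ((r n)%:E <= hausdorff1 A - hausdorff1 (A `&` [set x | (a <= c x)%R]))%E.
  move=> n; rewrite leeBrDr; last by apply: fin => x [].

  rewrite -Dr; apply: (@le_trans _ _ (hausdorff1 (D n `|` (A `&` [set x | (a <= c x)%R])))).
    apply: (@hausdorff1_split (lev n) a); first by rewrite ltrBlDr ltrDl.
    - by move=> x [].
    - by move=> x [].
  by apply: le_hausdorff1 => x [[]|[]].
have AHf : (hausdorff1 A - hausdorff1 (A `&` [set x | (a <= c x)%R]))%E \is a fin_num.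
  by rewrite fin_numB; apply/andP; split; apply: fin => // x [].
rewrite -(fineK AHf) lee_fin; apply: ge_sup; first by exists (r 0), 0.
by move=> _ [n _ <-]; rewrite -lee_fin (fineK AHf); exact: lim_le.
Unshelve. all: by end_near. Qed.

End HausdorffMeasure.

(** * Borel sets of the plane *)

Section Boxes.
Context {R : realType}.
Implicit Types (p q x : plane R) (U : set (plane R)).

Definition obox p q : set (plane R) :=
  [set x | [/\ p.1 < x.1, x.1 < q.1, p.2 < x.2 & x.2 < q.2]].

Definition cbox p q : set (plane R) :=
  [set x | [/\ p.1 <= x.1, x.1 <= q.1, p.2 <= x.2 & x.2 <= q.2]].

Lemma obox_cbox p q : obox p q `<=` cbox p q.
Proof. by move=> x [*]; split; exact: ltW. Qed.

Lemma oboxE p q : obox p q = `]p.1, q.1[ `*` `]p.2, q.2[.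
Proof.
apply/seteqP; split=> x; rewrite /obox /= !in_itv /=; first by case=> -> -> -> ->.
by move=> [/andP[? ?] /andP[? ?]].
Qed.

Lemma cboxE p q : cbox p q = `[p.1, q.1] `*` `[p.2, q.2].
Proof.
apply/seteqP; split=> x; rewrite /cbox /= !in_itv /=; first by case=> -> -> -> ->.
by move=> [/andP[? ?] /andP[? ?]].
Qed.

Lemma measurable_obox p q : measurable (obox p q).
Proof. by rewrite oboxE; apply: measurableX; exact: measurable_itv. Qed.

Lemma measurable_cbox p q : measurable (cbox p q).
Proof. by rewrite cboxE; apply: measurableX; exact: measurable_itv. Qed.

Lemma compact_cbox p q : compact (cbox p q).
Proof. by rewrite cboxE; apply: compact_setX; exact: segment_compact. Qed.

Lemma open_obox_cover U : open U -> exists p q : nat -> plane R,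
  (forall k, cbox (p k) (q k) `<=` U) /\ U `<=` \bigcup_k obox (p k) (q k).
Proof.
move=> oU; pose I := (rat * rat * (rat * rat))%type.
pose lo (i : I) : plane R := (ratr i.1.1, ratr i.1.2).
pose hi (i : I) : plane R := (ratr i.2.1, ratr i.2.2).
pose ok i := `[< cbox (lo i) (hi i) `<=` U >].
(* Rational boxes are enumerated through [unpickle]. An index that codes no box, or one whose
   closure leaves [U], gets the corners (1,1) and (0,0), whose closed box is empty. *)
pose pq k : plane R * plane R :=
  if (unpickle k : option I) is Some i then
    if ok i then (lo i, hi i) else ((1, 1), (0, 0)) else ((1, 1), (0, 0)).
have e0 : cbox ((1, 1) : plane R) (0, 0) = set0.
  rewrite -subset0 => x [/= h1 h2 _ _].
  by have := le_trans h1 h2; rewrite ler10.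
exists (fun k => (pq k).1), (fun k => (pq k).2); split=> [k|x Ux].
  rewrite /pq; case: unpickle => [i|]; last by rewrite e0.
  by case: ifPn => [/asboolP//|_]; rewrite e0.
have /nbhs_ballP[e /= e_gt0 xeU] : nbhs x U by exact: open_nbhs_nbhs.
have mkrat (t : R) : exists r s : rat,
    [/\ t - e < ratr r, ratr r < t, t < ratr s & ratr s < t + e].
  have /rat_in_itvoo[r] : t - e < t by rewrite ltrBlDr ltrDl.
  have /rat_in_itvoo[s] : t < t + e by rewrite ltrDl.
  by rewrite !in_itv /= => /andP[? ?] /andP[? ?]; exists r, s.
have [r1 [s1 [a1 a2 a3 a4]]] := mkrat x.1.
have [r2 [s2 [b1 b2 b3 b4]]] := mkrat x.2.
exists (pickle (((r1, r2), (s1, s2)) : I)) => //.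
rewrite /pq pickleK ifT; first by split.
apply/asboolP => y [/= c1 c2 c3 c4]; apply: xeU; split => /=.
  by rewrite /ball /= ltr_norml; apply/andP; split; lra.
by rewrite /ball /= ltr_norml; apply/andP; split; lra.
Qed.

Lemma open_measurable_plane U : open U -> measurable U.
Proof.
move=> oU; have [p [q [pqU Upq]]] := open_obox_cover oU.
rewrite (_ : U = \bigcup_k obox (p k) (q k)); last first.
  apply/seteqP; split => // x [k _ /obox_cbox]; exact: pqU.
by apply: bigcupT_measurable => k; exact: measurable_obox.
Qed.

Lemma closed_measurable_plane U : closed U -> measurable U.
Proof.
move=> cU; rewrite -[U]setCK; apply: measurableC; apply: open_measurable_plane; exact: closed_openC.
Qed.

Definition quadrant p : set (plane R) := [set x | p.1 < x.1 /\ p.2 < x.2].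

(** Quadrants serve as generator in Dynkin's theorem below: they are stable under intersection, and
    a quadrant cuts a box down to a box. *)
Lemma measurable_quadrants :
  @measurable _ (R * R)%type = <<s range quadrant >>.
Proof.
apply/seteqP; split => A; last first.
  apply: smallest_sub; first exact: sigma_algebra_measurable.
  move=> _ [p _ <-]; rewrite (_ : quadrant p = `]p.1, +oo[ `*` `]p.2, +oo[).
    by apply: measurableX; exact: measurable_itv.
  by apply/seteqP; split=> x; rewrite /quadrant /= !in_itv/= !andbT.
have : measurable_fun (setT : set (g_sigma_algebraType (range quadrant)))
    (fun x => (x.1, x.2) : R * R).
  apply: measurable_fun_pair; apply: (measurability _ (measurable_realfun.RGenOInfty.measurableE R)).
  - move=> _ [_ [a ->] <-]; rewrite setTI.
    rewrite (_ : _ @^-1` _ = \bigcup_n quadrant (a, - n%:R)); last first.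
      apply/seteqP; split => x /=; rewrite in_itv/= andbT; last by move=> [? _ []].
      move=> ax; have [n xn] : exists n, - x.2 < n%:R.
        by exists (Num.bound `|- x.2|); exact: le_lt_trans (ler_norm _) (archi_boundP (normr_ge0 _)).
      by exists n => //; split => //=; rewrite ltrNl.
    by apply: bigcupT_measurable => n; apply: sub_sigma_algebra; exists (a, - n%:R).
  - move=> _ [_ [a ->] <-]; rewrite setTI.
    rewrite (_ : _ @^-1` _ = \bigcup_n quadrant (- n%:R, a)); last first.
      apply/seteqP; split => x /=; rewrite in_itv/= andbT; last by move=> [? _ []].
      move=> ax; have [n xn] : exists n, - x.1 < n%:R.
        by exists (Num.bound `|- x.1|); exact: le_lt_trans (ler_norm _) (archi_boundP (normr_ge0 _)).
      by exists n => //; split => //=; rewrite ltrNl.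
    by apply: bigcupT_measurable => n; apply: sub_sigma_algebra; exists (- n%:R, a).
move=> /(_ measurableT A) + mA => /(_ mA); rewrite setTI.
by rewrite (_ : _ @^-1` A = A)//; apply/seteqP; split => -[].
Qed.

Lemma setI_closed_quadrants : setI_closed (range quadrant).
Proof.
move=> _ _ [p _ <-] [q _ <-]; exists (Num.max p.1 q.1, Num.max p.2 q.2) => //.
apply/seteqP; split => x; rewrite /quadrant /= !gt_max.
  by move=> [/andP[? ?] /andP[? ?]].
by move=> [[-> ->] [-> ->]].
Qed.

Lemma quadrantI_obox r p q : quadrant r `&` obox p q =
  obox (Num.max r.1 p.1, Num.max r.2 p.2) q.
Proof.
apply/seteqP; split => x; rewrite /quadrant /obox /= !gt_max.
  by move=> [[-> ->] [-> -> -> ->]].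
by move=> [/andP[-> ->] -> /andP[-> ->] ->].
Qed.

End Boxes.

(** * Arc length of Borel sets *)

Section HausdorffBorel.
Context {R : realType}.
Implicit Types (A B : set (plane R)).

(** Caratheodory's criterion applied to the two coordinates, which are 1-Lipschitz and whose
    sublevel sets generate the Borel sets. *)
Lemma measurable_cara_id : measurable_fun
  (setT : set (caratheodory_type (@hausdorff1 R))) (fun x => x : R * R).
Proof.
apply/measurable_fun_pairP; split;
  apply: (measurability _ (measurable_realfun.RGenInftyO.measurableE R)) => _ [_ [a ->] <-];
  rewrite setTI.
- rewrite (_ : _ @^-1` _ = [set x : plane R | x.1 < a]).
    apply: (@hausdorff1_caratheodory_lt R fst) => [x y|].
      exact: le_trans (ler_norm _) (normr_fst_le_edist _ _).
    exact: measurable_fst.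
  by apply/seteqP; split => x /=; rewrite in_itv.
- rewrite (_ : _ @^-1` _ = [set x : plane R | x.2 < a]).
    apply: (@hausdorff1_caratheodory_lt R snd) => [x y|].
      exact: le_trans (ler_norm _) (normr_snd_le_edist _ _).
    exact: measurable_snd.
  by apply/seteqP; split => x /=; rewrite in_itv.
Qed.

Lemma borel_caratheodory A : measurable A ->
  (@hausdorff1 R).-cara.-measurable A.
Proof. by move=> mA; have := measurable_cara_id measurableT mA; rewrite setTI. Qed.

(** At each scale 1 / (n + 1) a nearly optimal Borel cover is chosen; the intersection over [n] of
    the unions of these covers is the hull. *)
Lemma borel_hull A : (hausdorff1 A < +oo)%E -> exists B,
  [/\ measurable B, A `<=` B & hausdorff1 B = hausdorff1 A].
Proof.
move=> Aoo; have mge0 (d : R) X : (0 <= mu_ext (diam_upto d) X)%E.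
  by apply: mu_ext_ge0 => *; exact: diam_upto_ge0.
pose d n : R := n.+1%:R^-1.
have d0 n : 0 < d n by rewrite invr_gt0.
have Af n : mu_ext (diam_upto (d n)) A \is a fin_num.
  by rewrite ge0_fin_numE// (le_lt_trans (mu_ext_diam_le_hausdorff1 _ (d0 n))).
have /choice[F FP] n : exists F, measurable_cover A F /\
    (\sum_(k <oo) diam_upto (d n) (F k) < mu_ext (diam_upto (d n)) A + (d n)%:E)%E.
  by have [_ [F FA <-] lF] := lb_ereal_inf_adherent (d0 n) (Af n); exists F.
pose B := \bigcap_n \bigcup_k F n k.
have AB : A `<=` B by move=> x Ax n _; have [[_ AF] _] := FP n; exact: AF.
exists B; split => //.
  apply: bigcapT_measurable => n; apply: bigcupT_measurable => k.
  by have [[mF _] _] := FP n; exact: mF.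
apply: le_anti; apply/andP; split; last exact: le_hausdorff1.
apply: ge_ereal_sup => _ [e e0 <-]; apply/lee_addgt0Pr => e' e'0.
near \oo => n.
have dn1 : d n <= Num.min e e'.
  apply: ltW; near: n.
  have m0 : 0 < Num.min e e' by rewrite lt_min e0.
  exact: near_infty_natSinv_lt (PosNum m0).
have : d n <= e by rewrite (le_trans dn1)// ge_min lexx.
move=> /le_mu_ext_diam/le_trans; apply.
apply: (@le_trans _ _ (\sum_(k <oo) diam_upto (d n) (F n k)))%E.
  apply: ereal_inf_lbound; exists (F n) => //; split; first by have [[mF _] _] := FP n.
  by move=> x /(_ n I).
have [_ /ltW/le_trans] := FP n; apply.
apply: leeD; first exact: mu_ext_diam_le_hausdorff1.
by rewrite lee_fin (le_trans dn1)// ge_min lexx orbT.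
Unshelve. all: by end_near. Qed.

Lemma area_setX (X Y : set R) : measurable X -> measurable Y ->
  area (X `*` Y) = (lebesgue_measure X * lebesgue_measure Y)%E.
Proof. by move=> mX mY; exact: product_measure1E. Qed.

(** A set of diameter e lies in the square of half-side e about any of its points, and this square
    has area 4 e^2. *)
Lemma area_le_diam A (d : R) : measurable A -> (diam A <= d%:E)%E ->
  (area A <= (4 * d)%:E * diam A)%E.
Proof.
move=> mA Ad; have [->|/set0P[x Ax]] := eqVneq A set0.
  by rewrite measure0 diam_set0 mule0.
have Af : diam A \is a fin_num by rewrite ge0_fin_numE ?diam_ge0// (le_lt_trans Ad)// ltry.
have dA0 : 0 <= fine (diam A) by rewrite fine_ge0// diam_ge0.
have dAd : fine (diam A) <= d by rewrite -lee_fin fineK.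
rewrite -(fineK Af); set e := fine _ in dA0 dAd *.
apply: (@le_trans _ _ (area (cbox (x.1 - e, x.2 - e) (x.1 + e, x.2 + e)))).
  apply: le_measure; rewrite ?inE//; first exact: measurable_cbox.
  move=> y Ay; have : edist x y <= e by rewrite -lee_fin fineK// edist_le_diam.
  move=> xye; have := le_trans (normr_fst_le_edist x y) xye.
  have := le_trans (normr_snd_le_edist x y) xye.
  rewrite !ler_norml => /andP[? ?] /andP[? ?]; split => /=; lra.
rewrite cboxE area_setX; [|exact: measurable_itv..].
rewrite !lebesgue_measure_itv /= !lte_fin.
have s (t : R) : (if (t - e < t + e)%R then ((t + e)%:E - (t - e)%:E) else 0)%E = (2 * e)%:E.
  case: ifPn => [_|]; first by rewrite -EFinB; congr EFin; lra.
  by rewrite -leNgt => ?; congr EFin; lra.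
by rewrite !s -!EFinM lee_fin; nra.
Qed.

(** Covers by sets of diameter at most d have area at most 4 d times the sum of the diameters, and
    that sum stays bounded as d decreases. Hence element boundaries are null for area. *)
Lemma area_finite_hausdorff1 A : measurable A -> (hausdorff1 A < +oo)%E ->
  area A = 0%E.
Proof.
move=> mA Aoo; have mge0 (d : R) X : (0 <= mu_ext (diam_upto d) X)%E.
  by apply: mu_ext_ge0 => *; exact: diam_upto_ge0.
pose M := fine (hausdorff1 A).
have AM : hausdorff1 A = M%:E by rewrite fineK// ge0_fin_numE ?hausdorff1_ge0.
have M0 : 0 <= M by rewrite fine_ge0// hausdorff1_ge0.
apply/eqP; rewrite eq_le measure_ge0 andbT; apply/lee_addgt0Pr => e e0.
(* Chosen such that 4 d (M + 1) = e, where M + 1 bounds the sum of the diameters of the cover taken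
   below. *)
rewrite add0e; pose d := e / (4 * (M + 1)).
have d0 : 0 < d by rewrite divr_gt0// mulr_gt0// ltr_wpDl.
have Af : mu_ext (diam_upto d) A \is a fin_num.
  by rewrite ge0_fin_numE// (le_lt_trans (mu_ext_diam_le_hausdorff1 _ d0)).
have [_ [F [mF AF] <-] lF] := lb_ereal_inf_adherent ltr01 Af.
apply: (@le_trans _ _ (\sum_(k <oo) area (F k))%E).
  by apply: measure_sigma_subadditive.
apply: (@le_trans _ _ (\sum_(k <oo) ((4 * d)%:E * diam_upto d (F k)))%E).
  apply: lee_nneseries => // k _; rewrite /diam_upto; case: ifPn => Fd.
    exact: area_le_diam.
  by rewrite gt0_muley ?leey// lte_fin mulr_gt0.
rewrite nneseriesZl; last by move=> *; exact: diam_upto_ge0.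
apply: (@le_trans _ _ ((4 * d)%:E * (M + 1)%:E)%E).
  apply: lee_wpmul2l; first by rewrite lee_fin mulr_ge0// ltW.
  apply: (le_trans (ltW lF)); rewrite EFinD leeD2r// -AM.
  exact: mu_ext_diam_le_hausdorff1.
rewrite -EFinM lee_fin /d le_eqVlt; apply/orP; left; apply/eqP; field.
by rewrite gt_eqF// ltr_wpDl.
Qed.

End HausdorffBorel.

(** * Test functions *)

Section Bump.
Context {R : realType}.
Implicit Types (t a b : R) (x p q : plane R).

Lemma C1_is_derive (f : plane R -> R) (df : 'I_2 -> plane R -> R) :
  continuous f -> (forall s, continuous (df s)) ->
  (forall s x, is_derive x (axis s) f (df s x)) -> C1 f.
Proof.
move=> cf cdf fdf; split => // s; split => [x|].
  by have [] := fdf s x.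
rewrite (_ : 'D_(axis s) f = df s)//; apply/funext => x.
by have [] := fdf s x.
Qed.

Lemma is_derive_comp_fst (g : R -> R) (dg : R) (s : 'I_2) x :
  is_derive x.1 1 g dg -> is_derive x (axis s) (g \o fst) (if s == 0 then dg else 0).
Proof.
rewrite /axis; case: eqP => _ [h1 h2]; first by split.
have H : (fun h : R => h^-1 *: (((g \o fst) \o shift x) (h *: ((0, 1) : plane R)) - (g \o fst) x))
  = (fun h : R => h^-1 *: ((cst (g x.1) \o shift x) (h *: ((0, 1) : plane R)) - cst (g x.1) x)).
  by apply/funext => h /=; rewrite scaler0 add0r.
have [h3 h4] := @is_derive_cst _ (plane R) R (g x.1) x (0, 1).
by split; [rewrite /derivable H|rewrite /derive H].
Qed.

Lemma is_derive_comp_snd (g : R -> R) (dg : R) (s : 'I_2) x :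
  is_derive x.2 1 g dg -> is_derive x (axis s) (g \o snd) (if s == 0 then 0 else dg).
Proof.
rewrite /axis; case: eqP => _ [h1 h2]; last by split.
have H : (fun h : R => h^-1 *: (((g \o snd) \o shift x) (h *: ((1, 0) : plane R)) - (g \o snd) x))
  = (fun h : R => h^-1 *: ((cst (g x.2) \o shift x) (h *: ((1, 0) : plane R)) - cst (g x.2) x)).
  by apply/funext => h /=; rewrite scaler0 add0r.
have [h3 h4] := @is_derive_cst _ (plane R) R (g x.2) x (1, 0).
by split; [rewrite /derivable H|rewrite /derive H].
Qed.

Lemma continuous_fst_plane : continuous (fst : plane R -> R).
Proof. by move=> x; apply: cvg_fst. Qed.

Lemma continuous_snd_plane : continuous (snd : plane R -> R).
Proof. by move=> x; apply: cvg_snd. Qed.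

Lemma C1_tensor (g1 g2 dg1 dg2 : R -> R) :
  continuous dg1 -> continuous dg2 ->
  (forall t, is_derive t 1 g1 (dg1 t)) -> (forall t, is_derive t 1 g2 (dg2 t)) ->
  C1 (fun x => g1 x.1 * g2 x.2).
Proof.
move=> c1 c2 d1 d2.
have cg (g dg : R -> R) : (forall t, is_derive t 1 g (dg t)) -> continuous g.
  move=> d t; apply: differentiable_continuous; apply/derivable1_diffP.
  by have [] := d t.
have cc1 (g : R -> R) : continuous g -> continuous (g \o (fst : plane R -> R)).
  by move=> c x; apply: continuous_comp; [exact: continuous_fst_plane|exact: c].
have cc2 (g : R -> R) : continuous g -> continuous (g \o (snd : plane R -> R)).
  by move=> c x; apply: continuous_comp; [exact: continuous_snd_plane|exact: c].
have cp (f g : plane R -> R) : continuous f -> continuous g -> continuous (fun x => f x * g x).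
  by move=> c d x; apply: cvgM; [exact: c|exact: d].
pose df (s : 'I_2) x := g1 x.1 * (if s == 0 then 0 else dg2 x.2) +
   g2 x.2 * (if s == 0 then dg1 x.1 else 0).
apply: (C1_is_derive (df := df)).
- by apply: cp; [apply: cc1 (cg _ _ d1)|apply: cc2 (cg _ _ d2)].
- move=> s; rewrite /df; case: eqP => _ x; apply: cvgD; move: x; apply: cp;
  by [apply: cc1 => //; exact: cg|apply: cc2 => //; exact: cg|move=> ?; exact: cvg_cst].
- move=> s x; rewrite /df.
  exact: (is_deriveM (is_derive_comp_fst s (d1 x.1)) (is_derive_comp_snd s (d2 x.2))).
Qed.

(** The squared positive part is C^1, positive exactly for t > 0 and polynomial on each side; test
    functions need no higher smoothness. *)
Definition possq t : R := Num.max t 0 ^+ 2.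

Lemma possq_ge0 t : 0 <= possq t. Proof. exact: sqr_ge0. Qed.

Lemma possq_gt0 t : (0 < possq t) = (0 < t).
Proof.
rewrite /possq; case: (ltP 0 t) => t0; first by rewrite exprn_gt0.
by rewrite expr0n ltxx.
Qed.

Lemma continuous_max0 : continuous (fun t : R => Num.max t 0).
Proof. by move=> t; apply: continuous_max => //; exact: cvg_cst. Qed.

Lemma is_derive_possq t : is_derive t 1 possq (2 * Num.max t 0).
Proof.
(* The derivative of [possq] is 2-Lipschitz, so the Taylor remainder is at most h^2. *)
have key h : `|possq (h + t) - possq t - h * (2 * Num.max t 0)| <= h ^+ 2.
  rewrite /possq ler_norml; apply/andP.
  by case: (leP t 0) => t0; case: (leP (h + t) 0) => h0; split; nra.
have lim : h^-1 *: ((possq \o shift t) (h *: 1) - possq t) @[h --> 0^'] -->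
    (2 * Num.max t 0 : R).
  apply/cvgrPdist_le => e e0; near=> h.
  have h0 : h != 0 by near: h; exact: nbhs_dnbhs_neq.
  have he : `|h| <= e by near: h; apply: dnbhs0_le.
  rewrite distrC /= -[h%:A]/(h * 1) mulr1.
  apply: (le_trans _ he); rewrite -[X in _ - X](mulKf h0) -[h^-1 *: _]/(h^-1 * _) -mulrBr.
  rewrite normrM normfV ler_pdivrMl ?normr_gt0//.
  by rewrite -expr2 real_normK ?num_real//; exact: key.
split; first by apply/cvg_ex; eexists; exact: lim.
exact/cvg_lim.
Unshelve. all: by end_near. Qed.

Lemma continuous_dpossq : continuous (fun t : R => 2 * Num.max t 0).
Proof. by move=> t; apply: cvgM; [exact: cvg_cst|exact: continuous_max0]. Qed.

Lemma continuous_possq : continuous possq.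
Proof.
move=> t; apply: differentiable_continuous; apply/derivable1_diffP.
by have [] := is_derive_possq t.
Qed.

Definition hump a b t : R := possq (t - a) * possq (b - t).

Definition dhump a b t : R :=
  possq (t - a) * - (2 * Num.max (b - t) 0) + possq (b - t) * (2 * Num.max (t - a) 0).

Lemma hump_ge0 a b t : 0 <= hump a b t.
Proof. by rewrite mulr_ge0// possq_ge0. Qed.

Lemma hump_gt0 a b t : (0 < hump a b t) = (a < t < b).
Proof.
have [ta|ta] := ltP a t; last first.
  by rewrite /hump /possq max_r ?subr_le0// expr0n mul0r ltxx.
by rewrite pmulr_rgt0 possq_gt0 subr_gt0.
Qed.

Lemma is_derive_hump a b t : is_derive t 1 (hump a b) (dhump a b t).
Proof.
have d1 : is_derive t 1 (fun t => t - a) (1 : R).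
  by rewrite -[X in is_derive _ _ _ X](subr0 1); apply: is_deriveB.
have d2 : is_derive t 1 (fun t => b - t) (- 1 : R).
  by rewrite -[X in is_derive _ _ _ X](sub0r 1); apply: is_deriveB.
have e1 := @is_derive1_comp _ possq (fun t => t - a) t _ _ (is_derive_possq (t - a)) d1.
have e2 := @is_derive1_comp _ possq (fun t => b - t) t _ _ (is_derive_possq (b - t)) d2.
have := is_deriveM e1 e2.
by rewrite /dhump mulr1 mulrN1.
Qed.

Lemma continuous_dhump a b : continuous (dhump a b).
Proof.
have c1 : continuous (fun t : R => t - a) by move=> t; apply: cvgB => //; exact: cvg_cst.
have c2 : continuous (fun t : R => b - t) by move=> t; apply: cvgB => //; exact: cvg_cst.
have cc (f g : R -> R) : continuous f -> continuous g -> continuous (fun y => g (f y)).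
  by move=> c d y; apply: continuous_comp; [exact: c|exact: d].
move=> t; apply: cvgD; apply: cvgM.
- exact: cc c1 continuous_possq _.
- by apply: cvgN; exact: (cc _ _ c2 continuous_dpossq).
- exact: cc c2 continuous_possq _.
- exact: cc c1 continuous_dpossq _.
Qed.

(** Equal to hump / (1 / (n + 1) + hump): a C^1 function with values in [0, 1] that vanishes off ]a,
    b[ and tends pointwise to the indicator function of ]a, b[. *)
Definition bump1 n a b t : R := 1 - n.+1%:R^-1 * (n.+1%:R^-1 + hump a b t)^-1.

Lemma bump1_den n a b t : 0 < n.+1%:R^-1 + hump a b t.
Proof. by rewrite ltr_pwDl ?invr_gt0// hump_ge0. Qed.

Lemma bump1_range n a b t : 0 <= bump1 n a b t <= 1.
Proof.
have d := bump1_den n a b t; have h := hump_ge0 a b t.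
rewrite subr_ge0 ler_pdivrMr// mul1r lerDl h /= lerBlDr lerDl.
by rewrite divr_ge0// ?invr_ge0// ltW.
Qed.

Lemma bump1_out n a b t : ~~ (a < t < b) -> bump1 n a b t = 0.
Proof.
rewrite -hump_gt0 -leNgt => h0.
have h1 : hump a b t = 0 by apply/eqP; rewrite eq_le h0 hump_ge0.
by rewrite /bump1 h1 addr0 mulfV ?subrr// invr_neq0.
Qed.

Lemma cvg_bump1 a b t : bump1 n a b t @[n --> \oo] --> ((a < t < b)%R%:R : R).
Proof.
have [tab|tab] := boolP (a < t < b); last first.
  rewrite [X in X @ \oo --> _](_ : _ = cst 0); first exact: cvg_cst.
  by apply/funext => n; rewrite bump1_out.
rewrite -[X in _ --> X](subr0 1); apply: cvgB; first exact: cvg_cst.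
have h0 : 0 < hump a b t by rewrite hump_gt0.
rewrite -[X in _ --> X](mul0r (0 + hump a b t)^-1).
have hc : n.+1%:R^-1 @[n --> \oo] --> (0 : R) by exact: cvg_harmonic.
apply: cvgM => //; apply: cvgV; first by rewrite add0r gt_eqF.
by apply: cvgD => //; exact: cvg_cst.
Qed.

Definition dbump1 n a b t : R :=
  - (n.+1%:R^-1 * (- (n.+1%:R^-1 + hump a b t) ^- 2 * dhump a b t)).

Lemma is_derive_bump1 n a b t : is_derive t 1 (bump1 n a b) (dbump1 n a b t).
Proof.
have d1 : is_derive t 1 (fun t => n.+1%:R^-1 + hump a b t) (0 + dhump a b t).
  by apply: is_deriveD; exact: is_derive_hump.
have d2 := @is_deriveV _ (fun t => n.+1%:R^-1 + hump a b t) t _ 1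
    (lt0r_neq0 (bump1_den n a b t)) d1.
have d3 := is_deriveB (is_derive_cst (1 : R) t (1 : R)) (is_deriveZ n.+1%:R^-1 d2).
by rewrite !add0r in d3.
Qed.

Lemma continuous_dbump1 n a b : continuous (dbump1 n a b).
Proof.
move=> t; apply: cvgN; apply: cvgM; first exact: cvg_cst.
apply: cvgM; last exact: continuous_dhump.
apply: cvgN; apply: cvgV; first by rewrite expf_neq0// lt0r_neq0// bump1_den.
have c : {for t, continuous (fun t => n.+1%:R^-1 + hump a b t)}.
  apply: cvgD; first exact: cvg_cst.
  apply: differentiable_continuous; apply/derivable1_diffP.
  by have [] := is_derive_hump a b t.
exact: cvgM.
Qed.

Definition bump n p q x : R := bump1 n p.1 q.1 x.1 * bump1 n p.2 q.2 x.2.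

Lemma bump_range n p q x : 0 <= bump n p q x <= 1.
Proof.
have /andP[h1 h2] := bump1_range n p.1 q.1 x.1.
have /andP[h3 h4] := bump1_range n p.2 q.2 x.2.
by rewrite mulr_ge0//= mulr_ile1.
Qed.

Lemma bump_out n p q x : ~ obox p q x -> bump n p q x = 0.
Proof.
move=> npq; rewrite /bump.
have [h1|h1] := boolP (p.1 < x.1 < q.1); last by rewrite bump1_out ?mul0r.
have [h2|h2] := boolP (p.2 < x.2 < q.2); last by rewrite (bump1_out _ h2) mulr0.
by exfalso; apply: npq; move: h1 h2 => /andP[? ?] /andP[? ?].
Qed.

Lemma cvg_bump p q x : bump n p q x @[n --> \oo] --> (\1_(obox p q) x : R).
Proof.
have -> : \1_(obox p q) x = (p.1 < x.1 < q.1)%R%:R * (p.2 < x.2 < q.2)%R%:R :> R.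
  rewrite indicE -natrM mulnb; congr (nat_of_bool _)%:R.
  apply/idP/idP; first by rewrite inE => -[-> -> -> ->].
  by move=> /andP[/andP[? ?] /andP[? ?]]; rewrite inE.
by apply: cvgM; exact: cvg_bump1.
Qed.

Lemma C1_bump n p q : C1 (bump n p q).
Proof.
apply: (C1_tensor (dg1 := dbump1 n p.1 q.1) (dg2 := dbump1 n p.2 q.2));
  by [exact: continuous_dbump1|move=> t; exact: is_derive_bump1].
Qed.

Lemma compactly_supported_bump n p q U : cbox p q `<=` U ->
  compactly_supported_in U (bump n p q).
Proof.
move=> pqU; exists (cbox p q); first by split => //; exact: compact_cbox.
by move=> x nx; apply: bump_out => /obox_cbox.
Qed.

End Bump.

(** * The fundamental lemma of the calculus of variations *)

Section TestFunctions.
Context {R : realType} d (T : measurableType d) (mu : {measure set T -> \bar R}).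
Variables (p : T -> R * R) (h : T -> R) (U : set (plane R)).
Hypothesis mp : measurable_fun setT p.
Hypothesis ih : mu.-integrable setT (EFin \o h).
Hypothesis h_test : forall psi : plane R -> R, C1 psi -> compactly_supported_in U psi ->
  \int[mu]_t (h t * psi (p t)) = 0.

Let mpre (A : set (plane R)) : measurable A -> measurable (p @^-1` A).
Proof. by move=> mA; rewrite -[X in measurable X]setTI; exact: mp. Qed.

Let mh : measurable_fun setT h.
Proof. by have /measurable_EFinP := measurable_int _ ih. Qed.

(** Dominated convergence: the bumps tend to the indicator function of the box, and their products
    with [h] are dominated by the absolute value of [h]. *)
Lemma integral_obox_test a b : cbox a b `<=` U ->
  (\int[mu]_(t in p @^-1` obox a b) (h t)%:E = 0)%E.
Proof.
move=> abU; rewrite integral_mkcond.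
have mbump n : measurable_fun setT (fun t => bump n a b (p t)).
  apply: measurable_funM.
    apply: (@measurableT_comp _ _ _ _ _ _ (bump1 n a.1 b.1)).
      apply: continuous_measurable_fun => t; apply: differentiable_continuous.
      by apply/derivable1_diffP; have [] := is_derive_bump1 n a.1 b.1 t.
    exact: (measurableT_comp measurable_fst mp).
  apply: (@measurableT_comp _ _ _ _ _ _ (bump1 n a.2 b.2)).
    apply: continuous_measurable_fun => t; apply: differentiable_continuous.
    by apply/derivable1_diffP; have [] := is_derive_bump1 n a.2 b.2 t.
  exact: (measurableT_comp measurable_snd mp).
have mf n : measurable_fun setT (fun t => (h t * bump n a b (p t))%:E).
  by apply/measurable_EFinP; exact: measurable_funM.
have bump1' n t : `|bump n a b (p t)| <= 1.
  by have /andP[? ?] := bump_range n a b (p t); rewrite ger0_norm.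
have le_f n t : setT t -> (`|(h t * bump n a b (p t))%:E| <= `|(h t)%:E|)%E.
  by move=> _; rewrite lee_fin normrM ler_piMr.
have intf n : mu.-integrable setT (fun t => (h t * bump n a b (p t))%:E).
  exact: (le_integrable measurableT (mf n) (le_f n) ih).
have int0 n : (\int[mu]_t (h t * bump n a b (p t))%:E = 0)%E.
  have := h_test (C1_bump n a b) (compactly_supported_bump n abU).
  rewrite /Rintegral => e; rewrite -[LHS]fineK ?e//.
  exact: integrable_fin_num (intf n).
have mlim : measurable_fun setT ((EFin \o h) \_ (p @^-1` obox a b)).
  apply/(measurable_restrictT _ (mpre (measurable_obox a b))).
  by apply: measurable_funTS; exact: measurable_int ih.
have cv : {ae mu, forall t, setT t -> (h t * bump n a b (p t))%:E @[n --> \oo] -->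
    ((EFin \o h) \_ (p @^-1` obox a b)) t}.
  apply: aeW => t _; rewrite (_ : _ t = (h t * \1_(obox a b) (p t))%:E).
    by apply: cvg_EFin; [exact: nearW|exact: cvgM (cvg_cst (h t)) (@cvg_bump R a b (p t))].
  rewrite patchE indicE (_ : (p t \in obox a b) = (t \in p @^-1` obox a b)).
    by case: ifP => _; rewrite ?mulr1 ?mulr0.
  by apply/idP/idP; rewrite !inE.
have dom : {ae mu, forall t n, setT t -> (`|(h t * bump n a b (p t))%:E| <= `|(h t)%:E|)%E}.
  by apply: aeW => t n _; exact: le_f.
have [_ _] := dominated_convergence measurableT mf mlim cv (integrable_abse ih) dom.
under eq_fun do rewrite int0.
by move=> c; apply/esym/(cvg_unique _ (cvg_cst 0%E) c).
Qed.

(** Dynkin's theorem. On a quadrant the intersection is again a box with closure in [U]; complements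
    are taken inside the box, whose own integral is 0. *)
Lemma integral_borel_obox_test a b B : cbox a b `<=` U -> measurable B ->
  (\int[mu]_(t in p @^-1` (B `&` obox a b)) (h t)%:E = 0)%E.
Proof.
move=> abU; have mab := measurable_obox a b.
have mI (S : set (R * R)) : measurable S -> measurable (p @^-1` (S `&` obox a b)).
  by move=> mS; apply: mpre; exact: measurableI.
have ihS (S : set T) : measurable S -> mu.-integrable S (EFin \o h).
  by move=> mS; exact: (integrableS measurableT).
rewrite (measurable_quadrants (R := R)).
apply: (dynkin_induction (measurable_quadrants (R := R))
  (P := fun B => \int[mu]_(t in p @^-1` (B `&` obox a b)) (h t)%:E = 0)%E).
- exact: setI_closed_quadrants.
- by rewrite setTI; exact: integral_obox_test.
- move=> _ [r _ <-]; rewrite quadrantI_obox; apply: integral_obox_test.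
  move=> x [/= h1 h2 h3 h4]; apply: abU.
  by move: h1 h3; rewrite !ge_max => /andP[_ ?] /andP[_ ?].
- move=> S mS S0.
  have := integral_obox_test abU.
  have -> : p @^-1` obox a b = p @^-1` (S `&` obox a b) `|` p @^-1` (~` S `&` obox a b).
    by rewrite -preimage_setU -setIUl setUv setTI.
  rewrite integral_setU ?S0 ?add0e//.
  + exact: mI.
  + by apply: mI; exact: measurableC.
  + by apply: measurable_funTS; exact: measurable_int ih.
  + by apply/disj_setPS => t /= [[St _] [nSt _]].
- move=> F mF tF F0; rewrite setI_bigcupl preimage_bigcup integral_bigcup//.
  + by apply: eseries0 => i _ _; exact: F0.
  + apply/trivIsetP => i j _ _ ij; rewrite -preimage_setI.
    move/trivIsetP : (tF) => /(_ i j I I ij) Fij.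
    by rewrite setIACA Fij set0I preimage_set0.
  + by move=> k; exact: mI.
  + by apply: ihS; apply: bigcupT_measurable => k; exact: mI.
Qed.

Hypothesis oU : open U.
Hypothesis hull : forall A, measurable A -> A `<=` [set t | h t != 0] ->
  exists B, [/\ measurable B, A `<=` p @^-1` B & mu (p @^-1` B `\` A) = 0%E].

(** The set where [h] has a given sign need not be the preimage of a Borel set; [hull] replaces it
    by such a preimage up to a null set. The integral of [h] over its part in the box is then 0,
    although [h] has constant sign there. *)
Lemma negligible_pos_test a b (s : bool) : cbox a b `<=` U ->
  mu.-negligible (p @^-1` obox a b `&` [set t | 0 < (-1) ^+ s * h t]).
Proof.
move=> abU; set A := [set t | 0 < (-1) ^+ s * h t].
have mA : measurable A.
  rewrite (_ : A = setT `&` (fun t => (-1) ^+ s * h t) @^-1` `]0, +oo[).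
    by apply: measurable_funM => //; exact: measurable_itv.
  by rewrite setTI; apply/seteqP; split => t /=; rewrite in_itv/= andbT.
have [B [mB AB BA0]] : exists B, [/\ measurable B, A `<=` p @^-1` B & mu (p @^-1` B `\` A) = 0%E].
  by apply: hull => // t /= ht; apply: contraTneq ht => ->; rewrite mulr0 ltxx.
have mO : measurable (p @^-1` obox a b) by apply: mpre; exact: measurable_obox.
have mAO : measurable (p @^-1` obox a b `&` A) by exact: measurableI.
have ihS (S : set T) : measurable S -> mu.-integrable S (EFin \o h).
  by move=> mS; exact: (integrableS measurableT).
have int0 : (\int[mu]_(t in p @^-1` obox a b `&` A) (h t)%:E = 0)%E.
  have := integral_borel_obox_test abU mB.
  have mN : measurable (p @^-1` B `\` A) by apply: measurableD => //; exact: mpre.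
  rewrite (@negligible_integral _ _ _ mu _ (p @^-1` B `\` A))//; last 2 first.
  - by apply: mpre; apply: measurableI => //; exact: measurable_obox.
  - by apply: ihS; apply: mpre; apply: measurableI => //; exact: measurable_obox.
  rewrite (_ : p @^-1` (B `&` obox a b) `\` _ = p @^-1` obox a b `&` A)//.
  apply/seteqP; split => t /=.
    move=> [[Bt Ot] /not_andP[//|/contrapT At]]; by split.
  by move=> [Ot At]; split; [split => //; exact: AB|move=> []].
have /(ae_eq_integral_abs mu mAO) [+ _] := measurable_funTS (D := p @^-1` obox a b `&` A) (measurable_int _ ih).
have -> : (\int[mu]_(t in p @^-1` obox a b `&` A) `|(EFin \o h) t| = 0)%E.
  rewrite (@eq_integral _ _ _ mu _ (fun t => ((-1) ^+ s)%:E * (h t)%:E)%E); last first.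
    move=> t; rewrite inE => -[_ /= At]; rewrite -EFinM; congr EFin.
    by rewrite -[RHS]gtr0_norm// normrM normr_sign mul1r.
  by rewrite integralZl ?ihS// ?ihS// int0 mule0.
move=> /(_ erefl); rewrite /ae_eq => H.
apply: negligibleS H => t [Ot At] /=; apply/not_implyP; split => //=.
by move=> [h0]; move: At; rewrite /A /= h0 mulr0 ltxx.
Qed.

(** The map [p] lets one statement serve two measures: area with the identity, and arc length with
    the identity map from the Caratheodory to the Borel sigma-algebra. *)
Lemma ae_eq0_test : {ae mu, forall t, U (p t) -> h t = 0}.
Proof.
have [a [b [abU Uab]]] := open_obox_cover oU.
have : mu.-negligible (\bigcup_k
    ((p @^-1` obox (a k) (b k) `&` [set t | 0 < (-1) ^+ false * h t]) `|`
     (p @^-1` obox (a k) (b k) `&` [set t | 0 < (-1) ^+ true * h t]))).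
  by apply: negligible_bigcup => k; apply: negligibleU; exact: negligible_pos_test.
apply: negligibleS => t /= /not_implyP[/Uab[k _ Ot] /eqP h0].
exists k => //; move: h0; rewrite neq_lt => /orP[h0|h0].
  by right; split => //=; rewrite expr1 mulN1r oppr_gt0.
by left; split => //=; rewrite expr0 mul1r.
Qed.

End TestFunctions.

(** * Integrability *)

Section SquareIntegrable.
Context {R : realType} d (T : measurableType d) (mu : {measure set T -> \bar R}).
Implicit Types (D : set T) (f g : T -> R).

Lemma L2_mul D f g : measurable D -> L2 mu D f -> L2 mu D g ->
  mu.-integrable D (EFin \o (fun x => f x * g x)).
Proof.
move=> mD [mf f2] [mg g2].
apply: (@le_integrable _ _ _ mu _ mD _ (fun x => (f x ^+ 2)%:E + (g x ^+ 2)%:E)%E).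
- by apply/measurable_EFinP; exact: measurable_funM.
- move=> x _ /=; rewrite lee_fin normrM [leRHS]ger0_norm ?addr_ge0 ?sqr_ge0//.
  rewrite -(real_normK (num_real (f x))) -(real_normK (num_real (g x))).
  have := sqr_ge0 (`|f x| - `|g x|); have := sqr_ge0 (`|f x|); have := sqr_ge0 (`|g x|).
  by nra.
- exact: integrableD.
Qed.

Lemma integrable_bounded D f (M : R) : measurable D -> (mu D < +oo)%E ->
  measurable_fun D f -> (forall x, D x -> `|f x| <= M) ->
  mu.-integrable D (EFin \o f).
Proof.
move=> mD Doo mf fM; apply: measurable_bounded_integrable => //.
exists M; split; first exact: num_real.
by move=> N MN x Dx; apply: le_trans (ltW MN); exact: fM.
Qed.

Lemma L2_bounded D f (M : R) : measurable D -> (mu D < +oo)%E ->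
  measurable_fun D f -> (forall x, D x -> `|f x| <= M) -> L2 mu D f.
Proof.
move=> mD Doo mf fM; split => //.
apply: (@integrable_bounded _ _ (M ^+ 2)) => //; first exact: measurable_funX.
move=> x Dx; rewrite normrX lerXn2r ?nnegrE ?fM//.
exact: le_trans (fM _ Dx).
Qed.

Lemma L2_integrable D f : measurable D -> (mu D < +oo)%E -> L2 mu D f ->
  mu.-integrable D (EFin \o f).
Proof.
move=> mD Doo f2; have c1 : L2 mu D (cst 1).
  by apply: (@L2_bounded _ _ 1) => // x _; rewrite normr1.
have := L2_mul mD f2 c1; apply: eq_integrable => // x _ /=.
by rewrite mulr1.
Qed.

Lemma L2_subset D (D' : set T) f : measurable D -> measurable D' -> D' `<=` D ->
  L2 mu D f -> L2 mu D' f.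
Proof.
by move=> mD mD' DD [mf f2]; split; [exact: measurable_funS mf|exact: integrableS f2].
Qed.

Lemma integrable_mul_bounded D f g (M : R) : measurable D ->
  measurable_fun D g -> (forall x, D x -> `|g x| <= M) ->
  mu.-integrable D (EFin \o f) -> mu.-integrable D (EFin \o (fun x => g x * f x)).
Proof.
move=> mD mg gM fi; have /measurable_EFinP mf := measurable_int _ fi.
apply: (@le_integrable _ _ _ mu _ mD _ (fun x => (M * f x)%:E)).
- by apply/measurable_EFinP; exact: measurable_funM.
- move=> x Dx /=; rewrite lee_fin !normrM ler_wpM2r//.
  exact: le_trans (gM _ Dx) (ler_norm _).
- rewrite (_ : (fun x => _) = (fun x => M%:E * (EFin \o f) x)%E)//.
  exact: integrableZl.
Qed.

Lemma ae_Rintegral D f g : measurable D -> measurable_fun D f -> measurable_fun D g ->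
  {ae mu, forall x, D x -> f x = g x} ->
  \int[mu]_(x in D) f x = \int[mu]_(x in D) g x.
Proof.
move=> mD mf mg fg; congr fine; apply: ae_eq_integral => //.
- exact/measurable_EFinP.
- exact/measurable_EFinP.
- by apply: filterS fg => x + Dx => /(_ Dx) ->.
Qed.

End SquareIntegrable.

(** * Almost-everywhere statements and sums of integrals *)

Section AlmostEverywhere.
Context {R : realType} d (T : measurableType d) (mu : {measure set T -> \bar R}).
Implicit Types P Q : T -> Prop.

Lemma ae_impl P Q : (forall x, P x -> Q x) ->
  {ae mu, forall x, P x} -> {ae mu, forall x, Q x}.
Proof. by move=> PQ; apply: filterS. Qed.

Lemma ae_impl2 P1 P2 Q : (forall x, P1 x -> P2 x -> Q x) ->
  {ae mu, forall x, P1 x} -> {ae mu, forall x, P2 x} -> {ae mu, forall x, Q x}.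
Proof. by move=> PQ; apply: filterS2. Qed.

Lemma ae_and P1 P2 : {ae mu, forall x, P1 x} -> {ae mu, forall x, P2 x} ->
  {ae mu, forall x, P1 x /\ P2 x}.
Proof. exact: filterI. Qed.

Lemma ae_forall_fin (I : finType) (P : I -> T -> Prop) :
  (forall i, {ae mu, forall x, P i x}) -> {ae mu, forall x, forall i, P i x}.
Proof. by move=> aeP; apply: filter_forall. Qed.

End AlmostEverywhere.

Section IntegralFacts.
Context {R : realType} d (T : measurableType d) (mu : {measure set T -> \bar R}).
Implicit Types (D : set T) (f g : T -> R).

Lemma integrable_ae_bounded D f (M : R) : measurable D -> (mu D < +oo)%E ->
  measurable_fun D f -> {ae mu, forall x, D x -> `|f x| <= M} ->
  mu.-integrable D (EFin \o f).
Proof.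
move=> mD Doo mf fM; apply/integrableP; split; first exact/measurable_EFinP.
have mn : measurable_fun D (fun x => `|f x|) by exact: measurableT_comp.
(* Truncation gives a function bounded everywhere and almost everywhere equal to the absolute value
   of [f]. The absolute value of [M] is used because the sign of [M] is unknown. *)
have mg : measurable_fun D (fun x => Num.min `|f x| `|M|) by exact: measurable_minr.
have gM x : D x -> `|Num.min `|f x| `|M| | <= `|M|.
  by move=> _; rewrite ger0_norm ?le_min ?normr_ge0// ge_min lexx orbT.
have /integrableP[_] := integrable_bounded mD Doo mg gM.
apply: le_lt_trans; rewrite le_eqVlt; apply/orP; left; apply/eqP.
apply: ge0_ae_eq_integral => //.
- by apply/measurable_EFinP.
- by apply/measurable_EFinP; exact: measurableT_comp.
apply: ae_impl fM => x H Dx /=; have fxM := H Dx.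
rewrite min_l ?normr_id//; exact: le_trans (ler_norm _).
Qed.

Lemma L2_ae_bounded D f (M : R) : measurable D -> (mu D < +oo)%E ->
  measurable_fun D f -> {ae mu, forall x, D x -> `|f x| <= M} -> L2 mu D f.
Proof.
move=> mD Doo mf fM; split => //.
apply: (@integrable_ae_bounded _ _ (M ^+ 2)) => //; first exact: measurable_funX.
apply: ae_impl fM => x H Dx; have fxM := H Dx.
by rewrite normrX lerXn2r ?nnegrE// (le_trans _ fxM).
Qed.

Lemma integrable_patch D f : measurable D -> mu.-integrable D (EFin \o f) ->
  mu.-integrable setT (EFin \o (f \_ D)).
Proof.
move=> mD fi; rewrite (_ : _ \o _ = (EFin \o f) \_ D).
  exact: (integrable_mkcond _ mD).1 fi.
by apply/funext => x; rewrite /= !patchE; case: ifP.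
Qed.

Variables (I : finType) (D : I -> set T) (g : I -> T -> R).
Hypotheses (mD : forall k, measurable (D k))
  (ig : forall k, mu.-integrable (D k) (EFin \o g k)).

Let patch_int k : mu.-integrable setT (EFin \o (g k \_ (D k))).
Proof. by apply: integrable_patch; [exact: mD|exact: ig]. Qed.

Lemma integrable_sum_patch :
  mu.-integrable setT (EFin \o (fun x => \sum_k (g k \_ (D k)) x)).
Proof.
rewrite (_ : _ \o _ = (fun x => \sum_k (EFin \o (g k \_ (D k))) x)%E).
  by apply: integrable_sum => // k _; exact: patch_int.
by apply/funext => x /=; rewrite sumEFin.
Qed.

(** Extension by zero turns integrals over different, possibly overlapping sets into one integral,
    so that sums over elements can be compared pointwise. *)
Lemma Rintegral_sum_patch : \sum_k \int[mu]_(x in D k) g k x =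
  \int[mu]_x (\sum_k (g k \_ (D k)) x).
Proof.
apply: EFin_inj; rewrite -sumEFin /Rintegral fineK; last first.
  by apply: integrable_fin_num => //; exact: integrable_sum_patch.
under [RHS]eq_integral do rewrite -sumEFin.
rewrite integral_sum//.
apply: eq_bigr => k _; rewrite fineK; last by apply: integrable_fin_num; [exact: mD|exact: ig].
rewrite integral_mkcond; apply: eq_integral => x _.
by rewrite !patchE; case: ifP.
Qed.

End IntegralFacts.

(** * Bounded, compact and measurable sets of the plane *)

Section PlaneSets.
Context {R : realType}.
Implicit Types (D : set (plane R)) (f : plane R -> R).

Lemma bounded_cbox D : bounded_set D ->
  exists2 M : R, 0 < M & D `<=` obox (- M, - M) (M, M).
Proof.
(* [bounded_set] bounds the norm by every number above M0, here by |M0| + 1; one more unit makes the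
   box inequalities strict. *)
move=> [M0 [_ MD]]; exists (`|M0| + 2); first by rewrite ltr_wpDl.
move=> x Dx; have /= : `|x| <= `|M0| + 1.
  by apply: (MD _ _ x Dx); rewrite (le_lt_trans (ler_norm _))// ltrDl.
rewrite prod_normE ge_max => /andP[]; rewrite !ler_norml => /andP[? ?] /andP[? ?].
by split => /=; lra.
Qed.

Lemma compact_closure_bounded D : bounded_set D -> compact (closure D).
Proof.
move=> /bounded_cbox[M _ DM].
have cb : closed (cbox (- M, - M) (M, M)).
  by apply: compact_closed; [exact: norm_hausdorff|exact: compact_cbox].
apply: (subclosed_compact _ (@compact_cbox R (- M, - M) (M, M))).
  exact: closed_closure.
rewrite closureE; apply: smallest_sub => //.
exact: subset_trans (@obox_cbox _ _ _).
Qed.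

Lemma area_bounded D : measurable D -> bounded_set D -> (area D < +oo)%E.
Proof.
move=> mD /bounded_cbox[M M0 DM].
apply: (@le_lt_trans _ _ (area (obox (- M, - M) (M, M)))).
  by apply: le_measure; rewrite ?inE//; exact: measurable_obox.
rewrite oboxE area_setX; [|exact: measurable_itv..].
rewrite !lebesgue_measure_itv /= lte_fin gtrN//.
by rewrite -!EFinB -EFinM ltry.
Qed.

Lemma compact_continuous_bounded A f : compact A -> {within A, continuous f} ->
  exists M, forall x, A x -> `|f x| <= M.
Proof.
move=> cA cf; have /compact_bounded[M [_ MA]] := continuous_compact cf cA.
exists (M + 1) => x Ax; apply: (MA (M + 1)); first by rewrite ltrDl.
by exists x.
Qed.

Lemma bounded_continuous_bounded D f : bounded_set D -> continuous f ->
  exists M, forall x, D x -> `|f x| <= M.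
Proof.
move=> /compact_closure_bounded cD cf.
have [|M MD] := compact_continuous_bounded cD (f := f).
  exact: continuous_subspaceT.
by exists M => x /subset_closure; exact: MD.
Qed.

Lemma within_continuous_measurable D f : measurable D -> {within D, continuous f} ->
  measurable_fun D f.
Proof.
move=> mD cf; apply: (measurability _ (measurable_realfun.RGenOpens.measurableE R)).
move=> _ [_ [a [b ->] <-]]; move/continuousP : (cf) => /(_ `]a, b[%classic).
move=> /(_ (@interval_open R (BRight a) (BLeft b) isT isT)).
move=> /open_subspaceP[U oU UD]; rewrite setIC -UD; apply: measurableI => //.
exact: open_measurable_plane.
Qed.

Lemma continuous_measurable_plane D f : measurable D -> continuous f ->
  measurable_fun D f.
Proof.
by move=> mD cf; apply: within_continuous_measurable => //; exact: continuous_subspaceT.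
Qed.

Lemma measurable_fun_cara D f : measurable_fun D f -> measurable D ->
  measurable_fun (D : set (caratheodory_type (@hausdorff1 R))) f.
Proof. by move=> mf mD _ Y mY; apply: borel_caratheodory; exact: mf. Qed.

Lemma closed_bdry D : closed (bdry D).
Proof.
by rewrite /bdry setDE; apply: closedI; [exact: closed_closure|apply/open_closedC/open_interior].
Qed.

Lemma measurable_bdry D : (@hausdorff1 R).-cara.-measurable (bdry D).
Proof.
by apply: borel_caratheodory; apply: closed_measurable_plane; exact: closed_bdry.
Qed.

End PlaneSets.

(** * Weak derivatives *)

Section WeakDerivatives.
Context {R : realType}.
Implicit Types (D : set (plane R)) (f g psi : plane R -> R) (s : 'I_2).

Lemma C1_continuous psi : C1 psi -> continuous psi. Proof. by case. Qed.

Lemma C1_continuous_derive psi s : C1 psi -> continuous ('D_(axis s) psi).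
Proof. by move=> [_ /(_ s)[]]. Qed.

Lemma continuous_L2 D f : measurable D -> bounded_set D -> continuous f ->
  L2 area D f.
Proof.
move=> mD bD cf; have [M fM] := bounded_continuous_bounded bD cf.
apply: (@L2_bounded _ _ _ area _ _ M) => //; first exact: area_bounded.
exact: continuous_measurable_plane.
Qed.

Lemma compact_closed_plane (C : set (plane R)) : compact C -> closed C.
Proof. by apply: compact_closed; exact: norm_hausdorff. Qed.

Lemma compact_notin_near (C : set (plane R)) x : compact C -> ~ C x ->
  \forall y \near x, ~ C y.
Proof.
move=> /compact_closed_plane/closed_openC oC nCx.
exact: (open_nbhs_nbhs (conj oC nCx)).
Qed.

Lemma derive_out_support (C : set (plane R)) f x v : compact C ->
  (forall y, ~ C y -> f y = 0) -> ~ C x -> 'D_v f x = 0.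
Proof.
move=> cC f0 nCx; rewrite (@near_eq_derive _ _ _ f (cst 0)) ?derive_cst//.
by apply: filterS (compact_notin_near cC nCx) => y /f0.
Qed.

Lemma weak_derivP D s f : sobolev1 D f -> is_weak_deriv D s f (weak_deriv D s f).
Proof. by move=> [_ /(_ s)]; exact: xgetPex. Qed.

Lemma weak_deriv_L2 D s f : sobolev1 D f -> L2 area D (weak_deriv D s f).
Proof. by move=> /(weak_derivP s)[]. Qed.

(** The fundamental lemma for area, applied to g1 - g2 extended by zero; the Borel hull of a set is
    here the set itself. *)
Lemma is_weak_deriv_unique D s f g1 g2 : open D -> bounded_set D ->
  is_weak_deriv D s f g1 -> is_weak_deriv D s f g2 ->
  {ae area, forall x, D x -> g1 x = g2 x}.
Proof.
move=> oD bD [g1L w1] [g2L w2]; have mD := open_measurable_plane oD.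
have Doo := area_bounded mD bD.
have ig1 := L2_integrable (mu := area) mD Doo g1L.
have ig2 := L2_integrable (mu := area) mD Doo g2L.
pose h := (fun x => g1 x - g2 x) \_ D.
have ih : area.-integrable setT (EFin \o h).
  rewrite (_ : EFin \o h = (fun x => (g1 x)%:E - (g2 x)%:E)%E \_ D).
    exact: (integrable_mkcond (mu := area) _ mD).1 (integrableB (mu := area) mD ig1 ig2).
  by apply/funext => x; rewrite /h /= !patchE; case: ifP.
have : {ae area, forall x, D x -> h x = 0}.
  apply: (@ae_eq0_test _ _ _ area idfun h D) => //.
  - by move=> _ Y mY; rewrite setTI.
  - move=> psi Cpsi cpsi; have L2psi := continuous_L2 mD bD (C1_continuous Cpsi).
    have : \int[area]_(x in D) (g1 x * psi x) = \int[area]_(x in D) (g2 x * psi x).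
      by apply: oppr_inj; rewrite -w1// w2.
    rewrite (_ : (fun t => h t * psi (idfun t)) =
        (fun t => g1 t * psi t - g2 t * psi t) \_ D); last first.
      apply/funext => x; rewrite /h !patchE; case: ifP => _; last by rewrite mul0r.
      by rewrite mulrBl.
    rewrite -Rintegral_mkcond RintegralB//; [|exact: L2_mul..].
    by move=> ->; rewrite subrr.
  - by move=> A mA _; exists A; split => //; rewrite /= setDv measure0.
apply: ae_impl => x H Dx; have := H Dx; rewrite /h patchE mem_set//.
exact: subr0_eq.
Qed.

(** A test function with compact support in the smaller set is one for the larger set, and its
    integrals over both agree. *)
Lemma is_weak_deriv_sub D D' s f g : measurable D -> measurable D' -> D' `<=` D ->
  is_weak_deriv D s f g -> is_weak_deriv D' s f g.
Proof.
move=> mD mD' DD [gL w]; split; first exact: L2_subset gL.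
move=> psi Cpsi [C [cC CD'] psi0].
have e (u v : plane R -> R) : (forall x, ~ C x -> v x = 0) ->
    \int[area]_(x in D') (u x * v x) = \int[area]_(x in D) (u x * v x).
  move=> v0; rewrite Rintegral_mkcond [RHS]Rintegral_mkcond.
  congr (Rintegral _ _ _); apply/funext => x; rewrite !patchE.
  case: ifPn => xD'; case: ifPn => xD //.
    by move: xD; rewrite notin_setE; case; apply: DD; move: xD'; rewrite inE.
  by rewrite v0 ?mulr0// => /CD'; move: xD'; rewrite notin_setE.
rewrite !e//; last by move=> x nCx; exact: (derive_out_support _ cC).
by apply: w => //; exists C => //; split => //; exact: subset_trans DD.
Qed.

Lemma sobolev1_sub D D' f : measurable D -> measurable D' -> D' `<=` D ->
  sobolev1 D f -> sobolev1 D' f.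
Proof.
move=> mD mD' DD [fL w]; split; first exact: L2_subset fL.
by move=> s; have [g wg] := w s; exists g; exact: is_weak_deriv_sub wg.
Qed.

(** [weak_deriv] is a separate choice on every open set; this makes the choices on an element and on
    the whole domain comparable. *)
Lemma weak_deriv_sub D D' s f : open D -> open D' -> bounded_set D -> D' `<=` D ->
  sobolev1 D f -> {ae area, forall x, D' x -> weak_deriv D' s f x = weak_deriv D s f x}.
Proof.
move=> oD oD' bD DD fD; have mD := open_measurable_plane oD.
have mD' := open_measurable_plane oD'.
apply: (@is_weak_deriv_unique _ s f) => //.
- by case: bD => M [Mr MD]; exists M; split => // N MN x /DD; exact: MD.
- exact/weak_derivP/(sobolev1_sub mD).
- exact/(is_weak_deriv_sub mD mD')/weak_derivP.
Qed.

(** Fubini reduces the integral to lines parallel to the axis. On each line the fundamental theorem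
    of calculus is applied on [-M, M], at whose ends [F] vanishes. *)
Lemma integral_derive_compact s (F G : plane R -> R) C : compact C ->
  (forall x, ~ C x -> F x = 0) -> (forall x, ~ C x -> G x = 0) ->
  continuous G -> (forall x, is_derive x (axis s) F (G x)) ->
  \int[area]_x G x = 0.
Proof.
move=> cC F0 G0 cG FG.
have [M M0 CM] := bounded_cbox (compact_bounded cC).
have bC : bounded_set C by exact: compact_bounded.
have mC := closed_measurable_plane (compact_closed_plane cC).
have iG : area.-integrable setT (EFin \o G).
  rewrite (_ : EFin \o G = (EFin \o G) \_ C).
    apply: (integrable_mkcond (mu := area) _ mC).1; apply: (L2_integrable (mu := area)) => //.
      exact: area_bounded.
    exact: continuous_L2.
  apply/funext => x; rewrite patchE; case: ifPn => //; rewrite notin_setE => nCx.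
  by rewrite /= G0.
have MM : - M < M by rewrite gtrN.
have out (x : plane R) : ~ (- M < x.1 < M) \/ ~ (- M < x.2 < M) -> ~ C x.
  by move=> H /CM[/= h1 h2 h3 h4]; case: H => -[]; apply/andP; split.
(* Stated for a parametrization [u] so as to serve horizontal and vertical lines alike. *)
have line (u : R -> plane R) (P Q : R -> R) : P = F \o u -> Q = G \o u ->
    continuous u -> (forall t : R, ~ (- M < t < M) -> ~ C (u t)) ->
    (forall t : R, is_derive t (1 : R) P (Q t)) -> (\int[lebesgue_measure]_t (Q t)%:E = 0)%E.
  move=> PE QE cu uC PQ.
  have cP : continuous P.
    move=> t; apply: differentiable_continuous; apply/derivable1_diffP.
    by have [] := PQ t.
  have cQ : continuous Q.
    by rewrite QE => t; apply: continuous_comp; [exact: cu|exact: cG].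
  rewrite (_ : (fun t => (Q t)%:E) = (fun t => (Q t)%:E) \_ `[- M, M]).
    rewrite -integral_mkcond (@continuous_FTC2 _ _ P)//.
    - by rewrite PE /= !F0 ?subee//; apply: uC; rewrite ltxx ?andbF.
    - exact: continuous_subspaceT.
    - split; [by move=> t _; have [] := PQ t| | ].
        by apply: cvg_at_right_filter; exact: cP.
      by apply: cvg_at_left_filter; exact: cP.
    - by move=> t _; rewrite derive1E; have [] := PQ t.
  apply/funext => t; rewrite patchE; case: ifPn => //; rewrite notin_setE => /= nt.
  rewrite QE /= G0//; apply: uC => /andP[t1 t2]; apply: nt.
  by rewrite in_itv/= !ltW.
rewrite /Rintegral.
have -> : (\int[area]_x (G x)%:E = 0)%E; last by [].
have cpair1 (y : R) : continuous (fun t : R => (t, y)).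
  by move=> t; apply: (@cvg_pair _ _ _ _ (nbhs t) (nbhs y)); [exact: cvg_id|exact: cvg_cst].
have cpair2 (y : R) : continuous (fun t : R => (y, t)).
  by move=> t; apply: (@cvg_pair _ _ _ _ (nbhs y) (nbhs t)); [exact: cvg_cst|exact: cvg_id].
have [s0|s1] := eqVneq s 0.
- have inner (y : R) : (\int[lebesgue_measure]_t (G (t, y))%:E = 0)%E.
    apply: (line (fun t => (t, y)) (fun t => F (t, y)) (fun t => G (t, y))) => //.
      by move=> t nt; apply: out; left.
    move=> t; have [h1 h2] := FG (t, y); move: h1 h2; rewrite /axis s0 eqxx => h1 h2.
    have H : (fun h : R => h^-1 *: (F (h *: ((1, 0) : plane R) + (t, y)) - F (t, y)))
      = (fun h : R => h^-1 *: (F (h *: 1 + t, y) - F (t, y))).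
      apply/funext => h; congr (_ *: (F _ - _)).
      by apply/pair_equal_spec; split => //=; rewrite scaler0 add0r.
    by split; [rewrite /derivable -H|rewrite /derive -H].
  rewrite -(@integral21_prod_meas1 _ _ _ _ _ (@lebesgue_measure R) (@lebesgue_measure R) _ iG).
  by apply: integral0_eq => y _; exact: inner.
- have inner (y : R) : (\int[lebesgue_measure]_t (G (y, t))%:E = 0)%E.
    apply: (line (fun t => (y, t)) (fun t => F (y, t)) (fun t => G (y, t))) => //.
      by move=> t nt; apply: out; right.
    move=> t; have [h1 h2] := FG (y, t); move: h1 h2; rewrite /axis (negbTE s1) => h1 h2.
    have H : (fun h : R => h^-1 *: (F (h *: ((0, 1) : plane R) + (y, t)) - F (y, t)))
      = (fun h : R => h^-1 *: (F (y, h *: 1 + t) - F (y, t))).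
      apply/funext => h; congr (_ *: (F _ - _)).
      by apply/pair_equal_spec; split => //=; rewrite scaler0 add0r.
    by split; [rewrite /derivable -H|rewrite /derive -H].
  rewrite -(@integral12_prod_meas1 _ _ _ _ _ (@lebesgue_measure R) (@lebesgue_measure R) _ iG).
  by apply: integral0_eq => y _; exact: inner.
Qed.

(** Integration by parts. Although [f] is arbitrary off the closure, its product with a test
    function vanishes off a compact subset of [D], so it is differentiable along the axis on the
    whole plane, with the continuous derivative [G]. *)
Lemma C1_closure_sobolev1 D f : open D -> bounded_set D -> C1_closure D f -> sobolev1 D f.
Proof.
move=> oD bD [cf dfD]; have mD := open_measurable_plane oD.
have Doo := area_bounded mD bD.
have cL2 g : {within closure D, continuous g} -> L2 area D g.
  move=> cg; have [M gM] := compact_continuous_bounded (compact_closure_bounded bD) cg.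
  apply: (@L2_bounded _ _ _ area _ _ M) => //.
    apply: within_continuous_measurable => //.
    by apply: continuous_subspaceW cg; exact: subset_closure.
  by move=> x /subset_closure; exact: gM.
have cin g x : {within closure D, continuous g} -> D x -> {for x, continuous g}.
  move=> cg Dx; have : {within D, continuous g}.
    by apply: continuous_subspaceW cg; exact: subset_closure.
  by rewrite continuous_open_subspace// => /(_ x); apply; rewrite inE.
split; first exact: cL2.
move=> s; have [df [g cg gE]] := dfD s; exists g; split; first exact: cL2.
move=> psi Cpsi [C [cC CD] psi0]; apply/eqP; rewrite -addr_eq0; apply/eqP.
have L2psi := continuous_L2 mD bD (C1_continuous Cpsi).
have L2dpsi := continuous_L2 mD bD (C1_continuous_derive (s := s) Cpsi).
have dpsi0 x : ~ C x -> 'D_(axis s) psi x = 0 by move=> nCx; exact: (derive_out_support _ cC).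
rewrite -RintegralD//; [|by apply: L2_mul => //; exact: cL2..].
rewrite Rintegral_mkcond.
pose G x := f x * 'D_(axis s) psi x + g x * psi x.
have G0 x : ~ C x -> G x = 0 by move=> nCx; rewrite /G dpsi0// psi0// !mulr0 addr0.
rewrite (_ : _ \_ D = G); last first.
  apply/funext => x; rewrite patchE; case: ifPn => //; rewrite notin_setE => nDx.
  by rewrite G0// => /CD.
apply: (@integral_derive_compact s (fun x => f x * psi x) G C) => //.
- by move=> x nCx; rewrite psi0 ?mulr0.
- move=> x; have [Dx|nDx] := pselect (D x).
    apply: cvgD; apply: cvgM; [exact: cin| |exact: cin|].
      exact: (C1_continuous_derive (s := s) Cpsi).
    exact: (C1_continuous Cpsi).
  have nCx : ~ C x by move=> /CD.
  have n0 : \forall y \near x, cst 0 y = G y.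
    by apply: filterS (compact_notin_near cC nCx) => y nCy; rewrite G0.
  have c0 : cst 0 @ x --> G x by rewrite (G0 x nCx); exact: cvg_cst.
  exact: cvg_trans (near_eq_cvg n0) c0.
- move=> x; have [Dx|nDx] := pselect (D x).
    have dpsi : is_derive x (axis s) psi ('D_(axis s) psi x).
      by apply/derivableP; have [_ /(_ s)[]] := Cpsi.
    have dfx : is_derive x (axis s) f (g x).
      by rewrite gE//; apply/derivableP/df.
    have := is_deriveM dfx dpsi; rewrite /G (mulrC (g x)); exact.
  have nCx : ~ C x by move=> /CD.
  have [d1 d2] := @is_derive_cst _ (plane R) R (0 : R) x (axis s).
  have n0 : \forall y \near x, (fun=> 0) y = f y * psi y.
    by apply: filterS (compact_notin_near cC nCx) => y nCy; rewrite psi0// mulr0.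
  split; first exact: near_eq_derivable n0 d1.
  by rewrite -(near_eq_derive _ n0) d2 G0.
Qed.

End WeakDerivatives.

(** * Traces on a mesh *)

Section BlowUp.
Context {R : realType}.
Implicit Types (D : set (plane R)) (x : plane R) (nu : 'cV[R]_2).

Lemma measurable_disc x (r : R) : 0 < r -> measurable (disc x r).
Proof.
move=> r0; pose q (y : plane R) := (y.1 - x.1) ^+ 2 + (y.2 - x.2) ^+ 2.
have mq : measurable_fun setT q.
  by apply: measurable_funD; apply: measurable_funX; apply: measurable_funB.
rewrite (_ : disc x r = setT `&` q @^-1` `]-oo, r ^+ 2[); first exact: mq.
rewrite setTI; apply/seteqP; split => y /=; rewrite /disc /= in_itv/= edistE => h.
  rewrite -(sqr_sqrtr (a := q y)) ?addr_ge0 ?sqr_ge0// ltr_pXn2r ?nnegrE ?sqrtr_ge0//.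
  exact: ltW.
by rewrite -(ltr_pXn2r (n := 2)) ?nnegrE ?sqrtr_ge0 ?ltW// sqr_sqrtr// addr_ge0 ?sqr_ge0.
Qed.

Lemma bounded_disc x (r : R) : bounded_set (disc x r).
Proof.
exists (`|x| + r); split; first exact: num_real.
move=> M rM y yx; rewrite /= (_ : y = x + (y - x)); last by rewrite addrC subrK.
rewrite (le_trans (ler_normD _ _))//.
apply: (le_trans _ (ltW rM)); rewrite lerD2l prod_normE ge_max.
by rewrite !(le_trans _ (ltW yx))//; [exact: normr_snd_le_edist|exact: normr_fst_le_edist].
Qed.

Lemma measurable_half_plane x nu (b : bool) :
  measurable [set y : plane R | if b then 0 < dot nu (vec2 (y - x)) else dot nu (vec2 (y - x)) < 0].
Proof.
pose f (y : plane R) := nu 0 0 * (y.1 - x.1) + nu 1 0 * (y.2 - x.2).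
have mf : measurable_fun setT f.
  apply: measurable_funD; apply: measurable_funM => //; exact: measurable_funB.
rewrite (_ : [set y | _] = setT `&` f @^-1` (if b then `]0, +oo[ else `]-oo, 0[)%classic).
  by apply: mf => //; case: b; exact: measurable_itv.
rewrite setTI; apply/seteqP; split => y /=; rewrite dot2E !mxE /=;
  by case: b; rewrite /= in_itv/= ?andbT.
Qed.

(** With c = 1 + nu . nu', the square of |nu + nu'| is 2c. If c > 0, the two inner half-planes share
    a sector that both sets must nearly fill near [x]. A square [B r] in that sector has area of
    order r^2, yet each of its points misses [D] or [D'], and the missed parts have area o(r^2). *)
Lemma outer_normal_disjoint D D' x nu nu' : measurable D -> measurable D' ->
  D `&` D' = set0 -> is_outer_normal D x nu -> is_outer_normal D' x nu' -> nu' = - nu.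
Proof.
move=> mD mD' DD' [n1 _ nD] [n1' _ nD'].
apply/eqP; rewrite -subr_eq0 opprK; apply/eqP.
move: n1 n1'; rewrite !dot2E => n1 n1'.
pose c := 1 + (nu 0 0 * nu' 0 0 + nu 1 0 * nu' 1 0).
have cE : (nu' 0 0 + nu 0 0) ^+ 2 + (nu' 1 0 + nu 1 0) ^+ 2 = 2 * c.
  by rewrite /c; nra.
suff c0 : ~ 0 < c.
  have {}c0 : c <= 0 by rewrite leNgt; apply/negP.
  have s0 := sqr_ge0 (nu' 0 0 + nu 0 0); have s1 := sqr_ge0 (nu' 1 0 + nu 1 0).
  apply/colP => i; rewrite !mxE.
  have [->|->] : i = 0 \/ i = 1.
    by case: i => -[|[|//]] ?; [left|right]; exact/val_inj.
    by apply/eqP; rewrite -sqrf_eq0; apply/eqP; nra.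
  by apply/eqP; rewrite -sqrf_eq0; apply/eqP; nra.
move=> c_gt0.
have nb (a b : R) : a * a + b * b = 1 -> `|a| <= 1 /\ `|b| <= 1.
  move=> ab; have := sqr_ge0 a; have := sqr_ge0 b; rewrite !ler_norml => ? ?.
  by split; apply/andP; split; nra.
have [a1 a2] := nb _ _ n1; have [b1 b2] := nb _ _ n1'.
have c2 : c <= 2.
  have := sqr_ge0 (nu 0 0 - nu' 0 0); have := sqr_ge0 (nu 1 0 - nu' 1 0).
  by rewrite /c; nra.
(* Relative half-side of the square, whose centre is [x] moved by r/4 against nu + nu'. The centre
   has scalar product -c r/4 with either normal, and the square changes it by at most 2 eta r = c
   r/16. As c <= 2, coordinates relative to [x] are at most 9r/16, so the square stays in the
   disc. *)
pose eta := c / 32; have eta0 : 0 < eta by rewrite divr_gt0.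
pose y (r : R) : plane R := (x.1 - r / 4 * (nu 0 0 + nu' 0 0), x.2 - r / 4 * (nu 1 0 + nu' 1 0)).
pose B r := obox ((y r).1 - eta * r, (y r).2 - eta * r) ((y r).1 + eta * r, (y r).2 + eta * r).
pose E (D0 : set (plane R)) (v : 'cV[R]_2) r :=
  (disc x r `\` D0) `&` [set z | dot v (vec2 (z - x)) < 0].
have mE D0 v r : measurable D0 -> 0 < r -> measurable (E D0 v r).
  move=> mD0 r0; apply: measurableI; last exact: (measurable_half_plane x v false).
  by apply: measurableD => //; exact: measurable_disc.
have finE D0 v r : measurable D0 -> 0 < r -> area (E D0 v r) \is a fin_num.
  move=> mD0 r0; rewrite ge0_fin_numE// area_bounded//; first exact: mE.
  have [M [Mr MD]] := bounded_disc x r.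
  by exists M; split => // N MN z [[zx _] _]; exact: MD.
have areaB r : 0 < r -> area (B r) = (4 * eta ^+ 2 * r ^+ 2)%:E.
  move=> r0; rewrite /B oboxE area_setX; [|exact: measurable_itv..].
  rewrite !lebesgue_measure_itv /= !lte_fin.
  have er : 0 < eta * r by rewrite mulr_gt0.
  rewrite !ifT; [|lra|lra]; rewrite -!EFinB -EFinM; congr EFin; ring.
have subB r : 0 < r -> B r `<=` E D nu r `|` E D' nu' r.
  move=> r0 z [/= z1 z2 z3 z4].
  have er : 0 < eta * r by rewrite mulr_gt0.
  have etar : eta * r <= r / 16 by rewrite /eta; nra.
  pose d1 := z.1 - (y r).1; pose d2 := z.2 - (y r).2.
  have d1e : `|d1| <= eta * r by rewrite ler_norml /d1 /=; apply/andP; split; lra.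
  have d2e : `|d2| <= eta * r by rewrite ler_norml /d2 /=; apply/andP; split; lra.
  have zx1 : z.1 - x.1 = d1 - r / 4 * (nu 0 0 + nu' 0 0) by rewrite /d1 /=; ring.
  have zx2 : z.2 - x.2 = d2 - r / 4 * (nu 1 0 + nu' 1 0) by rewrite /d2 /=; ring.
  have mulb (a b : R) : `|a| <= 1 -> `|b| <= eta * r -> a * b <= eta * r.
    move=> ha hb; apply: (le_trans (ler_norm _)); rewrite normrM.
    by rewrite -[leRHS]mul1r; apply: ler_pM.
  have zdisc : disc x r z.
    rewrite /disc /= edistE -(ltr_pXn2r (n := 2)) ?nnegrE ?sqrtr_ge0 ?ltW//.
    rewrite sqr_sqrtr ?addr_ge0 ?sqr_ge0// zx1 zx2.
    have sq (a b t : R) : `|a| <= 1 -> `|b| <= 1 -> `|t| <= eta * r ->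
        (t - r / 4 * (a + b)) ^+ 2 <= (9 / 16 * r) ^+ 2.
      move=> ha hb ht; rewrite -[leLHS]real_normK ?num_real// ler_pXn2r ?nnegrE//; last by lra.
      move: ha hb ht; rewrite !ler_norml => /andP[? ?] /andP[? ?] /andP[? ?].
      by apply/andP; split; nra.
    apply: (@le_lt_trans _ _ ((9 / 16 * r) ^+ 2 + (9 / 16 * r) ^+ 2)).
      by apply: lerD; exact: sq.
    by nra.
  have side (a b : R) : a * (nu 0 0 + nu' 0 0) + b * (nu 1 0 + nu' 1 0) = c ->
      `|a| <= 1 -> `|b| <= 1 -> a * (z.1 - x.1) + b * (z.2 - x.2) < 0.
    move=> abc ha hb; rewrite zx1 zx2.
    have := mulb _ _ ha d1e; have := mulb _ _ hb d2e.
    have : eta * r = c * r / 32 by rewrite /eta; ring.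
    have : 0 < c * r by rewrite mulr_gt0.
    have -> : a * (d1 - r / 4 * (nu 0 0 + nu' 0 0)) + b * (d2 - r / 4 * (nu 1 0 + nu' 1 0))
      = a * d1 + b * d2 - r / 4 * (a * (nu 0 0 + nu' 0 0) + b * (nu 1 0 + nu' 1 0)) by ring.
    by rewrite abc; lra.
  have [Dz|nDz] := pselect (D z).
    right; split; first by split => // D'z; have : (D `&` D') z by []; rewrite DD'.
    by rewrite /= dot2E !mxE /=; apply: side => //; rewrite /c; nra.
  left; split => //=.
  by rewrite dot2E !mxE /=; apply: side => //; rewrite /c; nra.
have F0 : ProperFilter (0 : R)^'+ by exact: at_right_proper_filter.
have lim0 := cvgD nD nD'; rewrite addr0 in lim0.
have : 4 * eta ^+ 2 <= (0 : R).
  refine (cvgr_to_ge (lim0 _) _).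
  near=> r; have r0 : 0 < r by near: r; exact: nbhs_right_gt.
  rewrite [leRHS](_ : _ = (fine (area (E D nu r)) + fine (area (E D' nu' r))) / r ^+ 2).
    2: by rewrite mulrDl.
  rewrite ler_pdivlMr ?exprn_gt0// -fineD; [|exact: finE..].
  rewrite -lee_fin -(areaB r r0) fineK; last by rewrite fin_numD; apply/andP; split; exact: finE.
  apply: (@le_trans _ _ (area (E D nu r `|` E D' nu' r))).
    apply: le_measure; rewrite ?inE//; [exact: measurable_obox| |exact: subB].
    by apply: measurableU; exact: mE.
  by apply: measureU2; exact: mE.
by rewrite leNgt mulr_gt0// exprn_gt0.
Unshelve. all: by end_near. Qed.

End BlowUp.

(** * How elements meet at a boundary point *)

Section Interfaces.
Context {R : realType}.

Lemma ord2_cases (s : 'I_2) : s = 0 \/ s = 1.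
Proof. by case: s => -[|[|//]] ?; [left|right]; exact/val_inj. Qed.

(** Pairing with [nu] recovers a trace value from its products with the components of the unit
    normal. *)
Lemma unit_mul_inj (nu : 'cV[R]_2) (a b : R) : dot nu nu = 1 ->
  (forall s, a * nu s 0 = b * nu s 0) -> a = b.
Proof.
rewrite dot2E => n1 ab; rewrite -[a]mulr1 -[b]mulr1 -n1 !mulrDr !mulrA.
by rewrite !ab.
Qed.

(** Three pairwise opposite vectors are zero, so at most two elements meet. Two of them have normals
    with sum 0, a single one has a nonzero sum; hence the value of the sum tells how many there
    are. *)
Lemma interface_cases (I : finType) (B : pred I) (nu : I -> 'cV[R]_2) (g : bool) nu0 :
  (forall k, B k -> dot (nu k) (nu k) = 1) -> (g -> dot nu0 nu0 = 1) ->
  (forall k l, B k -> B l -> k != l -> nu l = - nu k) ->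
  \sum_(k | B k) nu k = (if g then nu0 else 0) ->
  if g then exists k, B k /\ forall l, B l -> l = k
  else forall k, B k -> exists l, [/\ l != k, B l & forall m, B m -> m = k \/ m = l].
Proof.
move=> n1 n01 opp; have dot0 : dot (0 : 'cV[R]_2) 0 <> 1.
  by rewrite dot2E !mxE mulr0 addr0 => /eqP; rewrite eq_sym oner_eq0.
have two k l m : B k -> B l -> B m -> k != l -> m = k \/ m = l.
  move=> Bk Bl Bm kl; have [->|mk] := eqVneq m k; [by left|].
  have [->|ml] := eqVneq m l; [by right|].
  exfalso; have ekl := opp _ _ Bk Bl kl.
  have ekm := opp _ _ Bm Bk mk; have elm := opp _ _ Bm Bl ml.
  have k0 : nu k = 0.
    have : nu k = - nu k by rewrite -ekl elm -ekm.
    by move/eqP; rewrite -addr_eq0 -mulr2n -scaler_nat scaler_eq0 pnatr_eq0 /= => /eqP.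
  by apply: dot0; rewrite -k0; exact: n1.
have pair_sum k l : B k -> B l -> k != l -> \sum_(j | B j) nu j = 0.
  move=> Bk Bl kl; rewrite (bigD1 k)//= (bigD1 l) /=; last by rewrite Bl eq_sym.
  rewrite (opp k l)// big_pred0 ?addr0 ?subrr// => m.
  apply/negP => /andP[/andP[Bm mk] ml].
  by case: (two _ _ _ Bk Bl Bm kl) => e; move: mk ml; rewrite e eqxx.
case: g n01 => /= n01 sumE.
- have d1 : dot nu0 nu0 = 1 by exact: n01.
  have [k Bk] : exists k, B k.
    apply: contrapT => nB; apply: dot0; rewrite -d1 -sumE big_pred0// => k.
    by apply/negP => Bk; apply: nB; exists k.
  exists k; split => // l Bl; apply/eqP; apply: contrapT => /negP lk.
  by apply: dot0; rewrite -d1 -sumE (pair_sum k l)// eq_sym.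
- move=> k Bk; have [l [lk Bl]] : exists l, l != k /\ B l.
    apply: contrapT => nB; apply: dot0; rewrite -(n1 k Bk) -sumE (bigD1 k)//=.
    rewrite big_pred0 ?addr0// => l.
    by apply/negP => /andP[Bl lk]; apply: nB; exists l.
  exists l; split => // m Bm; apply: two => //; by rewrite eq_sym.
Qed.

End Interfaces.

(** * Normals and traces of a single domain *)

Section Domains.
Context {R : realType}.
Implicit Types D : trace_domain R.

Lemma open_carrier D : open (carrier D). Proof. exact: carrier_open. Qed.

Lemma bounded_carrier D : bounded_set (carrier D). Proof. exact: carrier_bounded. Qed.

Lemma measurable_carrier D : measurable (carrier D).
Proof. by apply: open_measurable_plane; exact: carrier_open. Qed.

Lemma bdryE D : bdry (carrier D) = closure (carrier D) `\` carrier D.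
Proof. by rewrite /bdry (interior_id (carrier D)).1//; exact: carrier_open. Qed.

Lemma ae_notin_bdry D : {ae area, forall x, ~ bdry (carrier D) x}.
Proof.
exists (bdry (carrier D)); split.
- by apply: closed_measurable_plane; exact: closed_bdry.
- apply: area_finite_hausdorff1; last exact: bdry_finite.
  by apply: closed_measurable_plane; exact: closed_bdry.
- by move=> x /= /contrapT.
Qed.

Lemma normal_unit D : {ae arclen, forall x, bdry (carrier D) x ->
  dot (normal D x) (normal D x) = 1}.
Proof. by apply: ae_impl (normal_outer D) => x H /H[]. Qed.

Lemma normal_coord_le1 D s : {ae arclen, forall x, bdry (carrier D) x ->
  `|normal D x s 0| <= 1}.
Proof.
apply: ae_impl (normal_unit D) => x H Dx; have := H Dx; rewrite dot2E => n1.
have := sqr_ge0 (normal D x 0 0); have := sqr_ge0 (normal D x 1 0).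
by rewrite ler_norml; case: (ord2_cases s) => -> ? ?; apply/andP; split; nra.
Qed.

Lemma normal_L2 D s : L2 arclen (bdry (carrier D)) (fun x => normal D x s 0).
Proof.
apply: (L2_ae_bounded (mu := arclen) (M := 1)).
- exact: measurable_bdry.
- exact: bdry_finite.
- exact: normal_measurable.
- exact: normal_coord_le1.
Qed.

Lemma trace_normal_integrable D f s : sobolev1 (carrier D) f ->
  arclen.-integrable (bdry (carrier D)) (EFin \o (fun x => trace D f x * normal D x s 0)).
Proof.
move=> fD; apply: (L2_mul (mu := arclen)); first exact: measurable_bdry.
- exact: (trace_L2 (trace_operator D)).
- exact: normal_L2.
Qed.

Lemma vtrace_L2 D m (f : plane R -> 'cV[R]_m) j : vsobolev1 (carrier D) f ->
  L2 arclen (bdry (carrier D)) (fun x => vtrace D f x j 0).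
Proof.
move=> fD; rewrite (_ : (fun x => _) = trace D (fun y => f y j 0)); last first.
  by apply/funext => x; rewrite mxE.
exact: (trace_L2 (trace_operator D)).
Qed.

Lemma green_integrable D f psi s : sobolev1 (carrier D) f -> continuous psi ->
  arclen.-integrable (bdry (carrier D))
    (EFin \o (fun x => trace D f x * psi x * normal D x s 0)).
Proof.
move=> fD cpsi; have cb : compact (bdry (carrier D)).
  apply: (subclosed_compact (@closed_bdry _ _) (compact_closure_bounded (carrier_bounded D))).
  by move=> x [].
have [M psiM] := compact_continuous_bounded cb (continuous_subspaceT cpsi).
have mb : measurable (bdry (carrier D)).
  by apply: closed_measurable_plane; exact: closed_bdry.
have mpsi := measurable_fun_cara (continuous_measurable_plane mb cpsi) mb.
have := integrable_mul_bounded (measurable_bdry _) mpsi psiM (trace_normal_integrable s fD).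
by apply: (eq_integrable (measurable_bdry _)) => x _ /=; congr EFin; ring.
Qed.

Lemma sobolev1_cst1 D : sobolev1 (carrier D) (cst (1 : R)).
Proof.
apply: C1_closure_sobolev1; [exact: carrier_open|exact: carrier_bounded|split].
  by apply: continuous_subspaceT => x; exact: cvg_cst.
move=> s; split => [x _|]; first exact: derivable_cst.
exists (cst 0); first by apply: continuous_subspaceT => x; exact: cvg_cst.
by move=> x _; rewrite derive_cst.
Qed.

Lemma trace_cst1 D : {ae arclen, forall x, bdry (carrier D) x -> trace D (cst 1) x = 1}.
Proof.
apply: (trace_restriction (trace_operator D)); first exact: sobolev1_cst1.
by apply: continuous_subspaceT => x; exact: cvg_cst.
Qed.

End Domains.

(** * Green's formula summed over the mesh *)

Section Mesh.
Context {R : realType} (Omega : trace_domain R) (I : finType) (K : I -> trace_domain R).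
Hypothesis mesh : is_mesh Omega K.

Let KO k : carrier (K k) `<=` carrier Omega. Proof. by case: mesh => + _ _; exact. Qed.

(** The closures of the elements cover, and a point of such a closure outside the element lies on
    its boundary, a set of area zero. *)
Lemma mesh_cover : {ae area, forall x, carrier Omega x -> exists k, carrier (K k) x}.
Proof.
apply: ae_impl (ae_forall_fin (fun k => ae_notin_bdry (K k))) => x nb Ox.
case: mesh => _ _ cl; have : closure (carrier Omega) x by exact: subset_closure.
rewrite cl => -[k _ Kx]; exists k; apply: contrapT => nKx.
by apply: (nb k); rewrite bdryE.
Qed.

Lemma mesh_integral f : area.-integrable (carrier Omega) (EFin \o f) ->
  \int[area]_(x in carrier Omega) f x = \sum_k \int[area]_(x in carrier (K k)) f x.
Proof.
move=> fi; have mO := measurable_carrier Omega.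
have mK k : measurable (carrier (K k)) by exact: measurable_carrier.
have fiK k : area.-integrable (carrier (K k)) (EFin \o f).
  by apply: (integrableS (mu := area) mO (mK k)) fi; exact: KO.
rewrite (Rintegral_sum_patch (mu := area) mK fiK) Rintegral_mkcond.
have m1 := measurable_int _ (integrable_sum_patch (mu := area) mK fiK).
have m2 : area.-integrable setT (EFin \o (f \_ (carrier Omega))).
  exact: (integrable_patch (mu := area) mO fi).
apply: (ae_Rintegral (mu := area)) => //.
- by apply/measurable_EFinP; exact: measurable_int m2.
- exact/measurable_EFinP.
apply: ae_impl mesh_cover => x cov _; rewrite patchE; case: ifPn => [|Ox].
  rewrite inE => /cov[k Kx]; rewrite (bigD1 k)//= patchE mem_set// big1 ?addr0// => l lk.
  rewrite patchE; case: ifPn => //; rewrite inE => Klx.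
  by case: mesh => _ /(_ _ _ lk) /seteqP[/(_ x)] [].
rewrite big1// => k _; rewrite patchE; case: ifPn => //; rewrite inE => /KO.
by move: Ox; rewrite notin_setE.
Qed.

(** Green's formula expresses each boundary integral by volume integrals. These are additive over
    the elements, since the weak derivatives on an element and on [Omega] agree almost
    everywhere. *)
Lemma mesh_green f psi s : sobolev1 (carrier Omega) f -> C1 psi ->
  \sum_k \int[arclen]_(x in bdry (carrier (K k))) (trace (K k) f x * psi x * normal (K k) x s 0) =
  \int[arclen]_(x in bdry (carrier Omega)) (trace Omega f x * psi x * normal Omega x s 0).
Proof.
move=> fO Cpsi; have mO := measurable_carrier Omega.
have mK k := measurable_carrier (K k).
have fK k : sobolev1 (carrier (K k)) f by apply: sobolev1_sub fO => //; exact: KO.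
have green D : sobolev1 (carrier D) f ->
  \int[arclen]_(x in bdry (carrier D)) (trace D f x * psi x * normal D x s 0) =
  \int[area]_(x in carrier D) (f x * 'D_(axis s) psi x) +
  \int[area]_(x in carrier D) (weak_deriv (carrier D) s f x * psi x).
  by move=> fD; rewrite (trace_green (trace_operator D) s fD Cpsi); ring.
rewrite green//; under eq_bigr => k _ do rewrite green//.
rewrite big_split /=.
have L2psi D : L2 area (carrier D) psi.
  apply: continuous_L2; [exact: measurable_carrier|exact: carrier_bounded|].
  exact: C1_continuous.
have L2dpsi D : L2 area (carrier D) ('D_(axis s) psi).
  apply: continuous_L2; [exact: measurable_carrier|exact: carrier_bounded|].
  exact: C1_continuous_derive.
have wO := weak_deriv_L2 s fO.
rewrite -mesh_integral; last by apply: (L2_mul (mu := area) mO) => //; case: fO.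
congr (_ + _).
rewrite mesh_integral; last exact: (L2_mul (mu := area) mO wO (L2psi Omega)).
apply: eq_bigr => k _.
have wK := weak_deriv_L2 s (fK k).
apply: (ae_Rintegral (mu := area) (mK k)).
- by apply: measurable_funM; [case: wK|case: (L2psi (K k))].
- apply: measurable_funM; last by case: (L2psi (K k)).
  by apply: measurable_funS (KO (k:=k)) _ => //; case: wO.
have := weak_deriv_sub s (@open_carrier R Omega) (@open_carrier R (K k))
  (@bounded_carrier R Omega) (KO (k:=k)) fO.
by apply: ae_impl => x H Kx; rewrite H.
Qed.

(** The fundamental lemma for arc length, with the whole plane as open set: [h], the difference of
    the two sides extended by zero, integrates to 0 against C^1 functions by [mesh_green]. *)
Lemma mesh_trace f s : sobolev1 (carrier Omega) f ->
  {ae arclen, forall x,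
    \sum_(k | x \in bdry (carrier (K k))) trace (K k) f x * normal (K k) x s 0 =
    if x \in bdry (carrier Omega) then trace Omega f x * normal Omega x s 0 else 0}.
Proof.
move=> fO; have mK k := measurable_carrier (K k).
have fK k : sobolev1 (carrier (K k)) f.
  exact: (sobolev1_sub (measurable_carrier Omega) (mK k) (KO (k:=k)) fO).
pose g D x := trace D f x * normal D x s 0.
pose h x := \sum_k (g (K k) \_ (bdry (carrier (K k)))) x - (g Omega \_ (bdry (carrier Omega))) x.
have mbK k := measurable_bdry (carrier (K k)).
have mbO := measurable_bdry (carrier Omega).
have igK k := trace_normal_integrable s (fK k).
have igO : arclen.-integrable setT (EFin \o (g Omega \_ (bdry (carrier Omega)))).
  exact: (integrable_patch mbO (trace_normal_integrable s fO)).
have igS := integrable_sum_patch mbK igK.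
have ih : arclen.-integrable setT (EFin \o h).
  pose S x := \sum_k (g (K k) \_ (bdry (carrier (K k)))) x.
  rewrite (_ : _ \o _ = ((EFin \o S) \- (EFin \o (g Omega \_ (bdry (carrier Omega)))))%E)//.
  exact: integrableB.
have : {ae arclen, forall x, setT x -> h x = 0}.
  apply: (@ae_eq0_test _ _ _ arclen (fun x => x) h setT measurable_cara_id ih).
  - move=> psi Cpsi _; have cpsi := C1_continuous Cpsi.
    pose gp D x := trace D f x * psi x * normal D x s 0.
    have igpK k := green_integrable s (fK k) cpsi.
    have igpO := green_integrable s fO cpsi.
    have igpO' : arclen.-integrable setT (EFin \o (gp Omega \_ (bdry (carrier Omega)))).
      exact: (integrable_patch mbO igpO).
    have e := mesh_green s fO Cpsi.
    rewrite (Rintegral_sum_patch mbK igpK) [RHS]Rintegral_mkcond in e.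
    rewrite (_ : (fun t => h t * psi t) = (fun t =>
      \sum_k (gp (K k) \_ (bdry (carrier (K k)))) t - (gp Omega \_ (bdry (carrier Omega))) t)).
      rewrite RintegralB//; last exact: integrable_sum_patch.
      by rewrite e subrr.
    apply/funext => x; rewrite /h mulrBl mulr_suml; congr (_ - _).
      by apply: eq_bigr => k _; rewrite !patchE; case: ifP => _; rewrite ?mul0r// /g /gp; ring.
    by rewrite !patchE; case: ifP => _; rewrite ?mul0r// /g /gp; ring.
  - exact: openT.
  - move=> A mA Ah.
    (* [h] vanishes off this finite union of boundaries, so every [A] to be treated has finite
       length. Its Borel hull then exceeds it by a null set only. *)
    pose S := bdry (carrier Omega) `|` \big[setU/set0]_k bdry (carrier (K k)).
    have Soo : (hausdorff1 S < +oo)%E.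
      apply: (le_lt_trans (@outer_measureU2 _ _ hausdorff1_outer _ _)).
      apply: lte_add_pinfty; first exact: bdry_finite.
      elim/big_ind : _ => [|X Y Xoo Yoo|k _]; last exact: bdry_finite.
        by rewrite outer_measure0 ltry.
      by apply: (le_lt_trans (@outer_measureU2 _ _ hausdorff1_outer _ _)); exact: lte_add_pinfty.
    have AS : A `<=` S.
      move=> x /Ah /= hx; apply: contrapT => /not_orP[nO nK].
      move/eqP : hx; apply; rewrite /h patchE memNset// subr0 big1// => k _.
      rewrite patchE memNset// => Kx; apply: nK.
      by rewrite (bigD1 k)//=; left.
    have Aoo : (hausdorff1 A < +oo)%E by apply: le_lt_trans Soo; exact: le_hausdorff1.
    have [B [mB AB BA]] := borel_hull Aoo.
    exists B; split => //.
    rewrite [LHS]measureD//; [|exact: borel_caratheodory|by rewrite [ltLHS]BA].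
    by rewrite setIidr// [X in (X - _)%E]BA subee// ge0_fin_numE// hausdorff1_ge0.
apply: ae_impl => x /(_ Logic.I)/subr0_eq; rewrite patchE => <-.
rewrite big_mkcond; apply: eq_bigr => k _; rewrite patchE; by case: ifP.
Qed.

End Mesh.

(** * The Euler fluxes *)

Section SpectralMap.
Context {R : realType}.

Lemma spectral_mapE (g : R -> R) n (A T : 'M[R]_n) (d : 'rV[R]_n) :
  T \in unitmx -> A = invmx T *m diag_mx d *m T ->
  spectral_map g A = invmx T *m diag_mx (map_mx g d) *m T.
Proof.
move=> uT AT; rewrite /spectral_map; case: xgetP => [B -> [T' [d' [uT' AT' ->]]]|]; last first.
  by move=> /(_ (invmx T *m diag_mx (map_mx g d) *m T)); case; exists T, d.
(* S intertwines the two diagonal matrices, so S i j = 0 unless d i = d' j. *)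
pose S := T *m invmx T'.
have dS : diag_mx d *m S = S *m diag_mx d'.
  have : T *m A *m invmx T' = T *m A *m invmx T' by [].
  rewrite {1}AT AT' /S !mulmxA mulmxV// mul1mx => ->.
  by rewrite -!mulmxA mulmxV// mulmx1.
have gS : diag_mx (map_mx g d) *m S = S *m diag_mx (map_mx g d').
  move: S dS => S dS; apply/matrixP => i j.
  move/matrixP/(_ i j) : dS; rewrite !mul_diag_mx !mul_mx_diag !mxE.
  have [->|Sij] := eqVneq (S i j) 0; first by rewrite !mulr0 !mul0r.
  by rewrite mulrC => /(mulfI Sij) ->; rewrite mulrC.
have : invmx T *m (diag_mx (map_mx g d) *m S) *m T' = invmx T *m (S *m diag_mx (map_mx g d')) *m T'.
  by rewrite gS.
rewrite /S !mulmxA mulVmx// mul1mx => <-.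
by rewrite -!mulmxA mulVmx// mulmx1.
Qed.

Lemma spectral_map_max_min n (A T : 'M[R]_n) (d : 'rV[R]_n) :
  T \in unitmx -> A = invmx T *m diag_mx d *m T ->
  spectral_map (fun l => Num.max l 0) A + spectral_map (fun l => Num.min l 0) A = A.
Proof.
move=> uT AT; rewrite !(spectral_mapE _ uT AT) [RHS]AT -mulmxDl -mulmxDr.
congr (_ *m _ *m _); apply/matrixP => i j; rewrite !mxE -mulrnDl; congr (_ *+ _).
by case: leP; rewrite ?addr0 ?add0r.
Qed.

End SpectralMap.

(** * Directional derivatives of the fluxes *)

Section EulerDerivatives.
Context {R : realType}.
Variable gamma : R.
Implicit Types (w v : 'cV[R]_4) (nu : 'cV[R]_2) (s : 'I_2).

Let o0 : 'I_4 := @Ordinal 4 0 isT.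
Let o1 : 'I_4 := @Ordinal 4 1 isT.
Let o2 : 'I_4 := @Ordinal 4 2 isT.
Let o3 : 'I_4 := @Ordinal 4 3 isT.

(** Reduces directional derivatives in state space to calculus in one real variable. *)
Lemma is_derive_line (f : 'cV[R]_4 -> R) w v (df : R) :
  is_derive (0 : R) 1 (fun t => f (t *: v + w)) df -> is_derive w v f df.
Proof.
have H : (fun h : R => h^-1 *: (((fun t : R => f (t *: v + w)) \o shift 0) (h *: 1) - f (0 *: v + w)))
    = (fun h : R => h^-1 *: ((f \o shift w) (h *: v) - f w)).
  apply/funext => h /=; congr (_ *: (f (_ *: v + w) - f _)).
    by rewrite addr0 [_ *: _]mulr1.
  by rewrite scale0r add0r.
by move=> [h1 h2]; split; [rewrite /derivable -H|rewrite /derive -H].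
Qed.

Section Lines.
Variables (f g : R -> R) (t df dg : R).
Hypotheses (hf : is_derive t (1 : R) f df) (hg : is_derive t (1 : R) g dg).

Lemma is_derive_add : is_derive t 1 (fun x => f x + g x) (df + dg).
Proof. exact: is_deriveD. Qed.

Lemma is_derive_sub : is_derive t 1 (fun x => f x - g x) (df - dg).
Proof. exact: is_deriveB. Qed.

Lemma is_derive_mul : is_derive t 1 (fun x => f x * g x) (f t * dg + df * g t).
Proof. by rewrite (mulrC df); exact: (is_deriveM hf hg). Qed.

Lemma is_derive_mulc (a : R) : is_derive t 1 (fun x => a * f x) (a * df).
Proof. exact: (is_deriveZ a hf). Qed.

Lemma is_derive_inv : f t != 0 -> is_derive t 1 (fun x => (f x)^-1) (- df / f t ^+ 2).
Proof.
move=> ft0; have := is_deriveV ft0 hf.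
by rewrite [_ *: _]mulrC mulrN mulNr.
Qed.

End Lines.

Section Direction.
Variables w v : 'cV[R]_4.
Hypothesis w0 : density w != 0.

Let W (t : R) := t *: v + w.

Let is_derive_coord (i : 'I_4) : is_derive (0 : R) 1 (fun t => W t i 0) (v i 0).
Proof.
rewrite (_ : (fun t => _) = (fun t => v i 0 * t + w i 0)); last first.
  by apply/funext => t; rewrite !mxE mulrC.
have := is_derive_add (is_derive_mulc (is_derive_id (0 : R) 1) (v i 0)) (is_derive_cst (w i 0) (0 : R) (1 : R)).
by rewrite mulr1 addr0.
Qed.

Let W0 : W 0 = w. Proof. by rewrite /W scale0r add0r. Qed.

Definition dvel1 := (v o1 0 - velocity1 w * v o0 0) / density w.
Definition dvel2 := (v o2 0 - velocity2 w * v o0 0) / density w.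
Definition dpressure := (gamma - 1) * (v o3 0 - velocity1 w * v o1 0
  - velocity2 w * v o2 0 + 2^-1 * (velocity1 w ^+ 2 + velocity2 w ^+ 2) * v o0 0).

Let is_derive_dens : is_derive (0 : R) 1 (fun t => density (W t)) (v o0 0).
Proof. exact: is_derive_coord. Qed.

Let dens0 : density (W 0) != 0. Proof. by rewrite W0. Qed.

Let is_derive_vel1 : is_derive (0 : R) 1 (fun t => velocity1 (W t)) dvel1.
Proof.
have := is_derive_mul (is_derive_coord o1) (is_derive_inv is_derive_dens dens0).
rewrite W0 (_ : _ + _ = dvel1)//.
by rewrite /dvel1 /velocity1 /momentum1 -/o1; field.
Qed.

Let is_derive_vel2 : is_derive (0 : R) 1 (fun t => velocity2 (W t)) dvel2.
Proof.
have := is_derive_mul (is_derive_coord o2) (is_derive_inv is_derive_dens dens0).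
rewrite W0 (_ : _ + _ = dvel2)//.
by rewrite /dvel2 /velocity2 /momentum2 -/o2; field.
Qed.

Let is_derive_press : is_derive (0 : R) 1 (fun t => pressure gamma (W t)) dpressure.
Proof.
have d1 := is_derive_mul is_derive_vel1 is_derive_vel1.
have d2 := is_derive_mul is_derive_vel2 is_derive_vel2.
have d3 := is_derive_mul (is_derive_mulc is_derive_dens 2^-1) (is_derive_add d1 d2).
have := is_derive_mulc (is_derive_sub (is_derive_coord o3) d3) (gamma - 1).
rewrite W0 (_ : (gamma - 1) * (_ - _) = dpressure)//.
by rewrite /dpressure /dvel1 /dvel2; field.
Qed.

Definition dflux1 : 'cV[R]_4 :=
  let: (rho, u1, u2, E, p) :=
    (density w, velocity1 w, velocity2 w, energy w, pressure gamma w) in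
  col4 (v o0 0 * u1 + rho * dvel1)
    (v o0 0 * u1 ^+ 2 + 2 * rho * u1 * dvel1 + dpressure)
    (v o0 0 * u1 * u2 + rho * (dvel1 * u2 + u1 * dvel2))
    ((v o3 0 + dpressure) * u1 + (E + p) * dvel1).

Definition dflux2 : 'cV[R]_4 :=
  let: (rho, u1, u2, E, p) :=
    (density w, velocity1 w, velocity2 w, energy w, pressure gamma w) in
  col4 (v o0 0 * u2 + rho * dvel2)
    (v o0 0 * u1 * u2 + rho * (dvel1 * u2 + u1 * dvel2))
    (v o0 0 * u2 ^+ 2 + 2 * rho * u2 * dvel2 + dpressure)
    ((v o3 0 + dpressure) * u2 + (E + p) * dvel2).

Definition dflux s : 'cV[R]_4 := if s == 0 then dflux1 else dflux2.

Lemma ord4P (P : 'I_4 -> Prop) : P o0 -> P o1 -> P o2 -> P o3 -> forall i, P i.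
Proof.
move=> p0 p1 p2 p3 [[|[|[|[|//]]]] lti].
- by rewrite (_ : Ordinal lti = o0)//; exact/val_inj.
- by rewrite (_ : Ordinal lti = o1)//; exact/val_inj.
- by rewrite (_ : Ordinal lti = o2)//; exact/val_inj.
- by rewrite (_ : Ordinal lti = o3)//; exact/val_inj.
Qed.

Lemma is_derive_flux s i : is_derive w v (fun u => flux gamma s u i 0) (dflux s i 0).
Proof.
apply: is_derive_line.
have e2 (a b : R) (f : R -> R) : f = f -> a = b -> is_derive (0 : R) 1 f a -> is_derive (0 : R) 1 f b.
  by move=> _ ->.
pose dr := is_derive_dens; pose d1 := is_derive_vel1; pose d2 := is_derive_vel2.
pose dp := is_derive_press.
pose dE := is_derive_coord o3.
rewrite /flux /dflux; case: eqP => _; move: i; apply: ord4P;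
  rewrite /flux1 /flux2 /dflux1 /dflux2 /col4 !mxE /=.
- rewrite (_ : (fun t => _) = (fun t => density (W t) * velocity1 (W t))).
    by have := is_derive_mul dr d1; rewrite W0 addrC.
  by apply/funext => t; rewrite mxE.
- rewrite (_ : (fun t => _) = (fun t => density (W t) * (velocity1 (W t) * velocity1 (W t)) + pressure gamma (W t))).
    have := is_derive_add (is_derive_mul dr (is_derive_mul d1 d1)) dp.
    by apply: e2 => //; rewrite W0; ring.
  by apply/funext => t; rewrite mxE.
- rewrite (_ : (fun t => _) = (fun t => density (W t) * velocity1 (W t) * velocity2 (W t))).
    have := is_derive_mul (is_derive_mul dr d1) d2.
    by apply: e2 => //; rewrite W0; ring.
  by apply/funext => t; rewrite mxE.
- rewrite (_ : (fun t => _) = (fun t => (energy (W t) + pressure gamma (W t)) * velocity1 (W t))).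
    have := is_derive_mul (is_derive_add dE dp) d1.
    by apply: e2 => //; rewrite W0 -[w o3 0]/(energy w); ring.
  by apply/funext => t; rewrite mxE.
- rewrite (_ : (fun t => _) = (fun t => density (W t) * velocity2 (W t))).
    by have := is_derive_mul dr d2; rewrite W0 addrC.
  by apply/funext => t; rewrite mxE.
- rewrite (_ : (fun t => _) = (fun t => density (W t) * velocity1 (W t) * velocity2 (W t))).
    have := is_derive_mul (is_derive_mul dr d1) d2.
    by apply: e2 => //; rewrite W0; ring.
  by apply/funext => t; rewrite mxE.
- rewrite (_ : (fun t => _) = (fun t => density (W t) * (velocity2 (W t) * velocity2 (W t)) + pressure gamma (W t))).
    have := is_derive_add (is_derive_mul dr (is_derive_mul d2 d2)) dp.
    by apply: e2 => //; rewrite W0; ring.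
  by apply/funext => t; rewrite mxE.
- rewrite (_ : (fun t => _) = (fun t => (energy (W t) + pressure gamma (W t)) * velocity2 (W t))).
    have := is_derive_mul (is_derive_add dE dp) d2.
    by apply: e2 => //; rewrite W0 -[w o3 0]/(energy w); ring.
  by apply/funext => t; rewrite mxE.
Qed.

Lemma is_derive_normal_flux nu i : is_derive w v (fun u => normal_flux gamma u nu i 0)
  (\sum_(s < 2) nu s 0 * dflux s i 0).
Proof.
rewrite (_ : (fun u => _) = (fun u => nu 0 0 * flux gamma 0 u i 0 + nu 1 0 * flux gamma 1 u i 0)).
  rewrite !big_ord_recl big_ord0 addr0 (_ : lift ord0 ord0 = 1); last exact/val_inj.
  exact: (is_deriveD (is_deriveZ _ (is_derive_flux 0 i)) (is_deriveZ _ (is_derive_flux 1 i))).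
apply/funext => u; rewrite /normal_flux !big_ord_recl big_ord0 addr0 !mxE.
by rewrite (_ : lift ord0 ord0 = 1)//; exact/val_inj.
Qed.

Lemma is_derive_normal_pressure nu i :
  is_derive w v (fun u => normal_pressure gamma u nu i 0)
    (dpressure * col4 0 (nu 0 0) (nu 1 0) 0 i 0).
Proof.
have dp : is_derive w v (pressure gamma) dpressure by apply: is_derive_line; exact: is_derive_press.
rewrite (_ : (fun u => _) = (fun u => col4 0 (nu 0 0) (nu 1 0) 0 i 0 * pressure gamma u)).
  by rewrite mulrC; exact: (is_deriveZ _ dp).
by apply/funext => u; rewrite mxE mulrC.
Qed.

End Direction.
End EulerDerivatives.

(** * Jacobi matrices and the wall condition *)

Section EulerMatrices.
Context {R : realType}.
Variable gamma : R.
Implicit Types (w v : 'cV[R]_4) (nu : 'cV[R]_2) (s : 'I_2).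

Let o0 : 'I_4 := @Ordinal 4 0 isT.
Let o1 : 'I_4 := @Ordinal 4 1 isT.
Let o2 : 'I_4 := @Ordinal 4 2 isT.
Let o3 : 'I_4 := @Ordinal 4 3 isT.

Lemma sum_ord4 (F : 'I_4 -> R) : \sum_j F j = F o0 + F o1 + F o2 + F o3.
Proof.
rewrite !big_ord_recl big_ord0 addr0 !addrA.
by congr (F _ + F _ + F _ + F _); exact/val_inj.
Qed.

Lemma sum_ord2 (F : 'I_2 -> R) : \sum_s F s = F 0 + F 1.
Proof.
by rewrite !big_ord_recl big_ord0 addr0; congr (F _ + F _); exact/val_inj.
Qed.

(** Linearity in the direction, which identifies the Jacobi matrix applied to [v] with the
    derivative along [v]. *)
Lemma dflux_sum w v s i :
  \sum_j dflux gamma w (delta_mx j 0) s i 0 * v j 0 = dflux gamma w v s i 0.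
Proof.
rewrite sum_ord4 /dflux; case: eqP => _; move: i; apply: ord4P;
  by rewrite /dflux1 /dflux2 /dvel1 /dvel2 /dpressure /col4 !mxE /=; ring.
Qed.

Lemma dpressure_sum w v :
  \sum_j dpressure gamma w (delta_mx j 0) * v j 0 = dpressure gamma w v.
Proof. by rewrite sum_ord4 /dpressure !mxE /=; ring. Qed.

Lemma flux_jacobiE w s i j : density w != 0 ->
  flux_jacobi gamma s w i j = dflux gamma w (delta_mx j 0) s i 0.
Proof.
by move=> w0; rewrite mxE; have [_] := is_derive_flux gamma (delta_mx j 0) w0 s i.
Qed.

Lemma normal_flux_jacobiE w nu : density w != 0 ->
  normal_flux_jacobi gamma w nu = \sum_(s < 2) nu s 0 *: flux_jacobi gamma s w.
Proof.
move=> w0; apply/matrixP => i j; rewrite mxE summxE.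
have [_ ->] := is_derive_normal_flux gamma (delta_mx j 0) w0 nu i.
by apply: eq_bigr => s _; rewrite mxE flux_jacobiE.
Qed.

Lemma flux_jacobiM w v s : density w != 0 ->
  flux_jacobi gamma s w *m v = dflux gamma w v s.
Proof.
move=> w0; apply/colP => i; rewrite mxE -dflux_sum.
by apply: eq_bigr => j _; rewrite flux_jacobiE.
Qed.

Lemma normal_flux_jacobiN w nu : density w != 0 ->
  normal_flux_jacobi gamma w (- nu) = - normal_flux_jacobi gamma w nu.
Proof.
move=> w0; rewrite !normal_flux_jacobiE// -sumrN.
by apply: eq_bigr => s _; rewrite mxE scaleNr.
Qed.

(** Derivative of the normal velocity at [w] along [v], by the quotient rule. *)
Definition dvel_n w v nu := (v o1 0 * nu 0 0 + v o2 0 * nu 1 0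
  - (velocity1 w * nu 0 0 + velocity2 w * nu 1 0) * v o0 0) / density w.

(* The derivative of (rho un, rho u un + p n, (E + p) un), un the normal velocity. *)
Definition dnormal_flux w v nu : 'cV[R]_4 :=
  let un := velocity1 w * nu 0 0 + velocity2 w * nu 1 0 in
  let dun := dvel_n w v nu in
  let dp := dpressure gamma w v in
  col4 (v o1 0 * nu 0 0 + v o2 0 * nu 1 0)
    (v o1 0 * un + density w * velocity1 w * dun + dp * nu 0 0)
    (v o2 0 * un + density w * velocity2 w * dun + dp * nu 1 0)
    ((v o3 0 + dp) * un + (energy w + pressure gamma w) * dun).

Lemma normal_flux_jacobiM w v nu : density w != 0 ->
  normal_flux_jacobi gamma w nu *m v = dnormal_flux w v nu.
Proof.
move=> w0; rewrite normal_flux_jacobiE// mulmx_suml.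
apply/colP => i; rewrite summxE sum_ord2 -!scalemxAl !flux_jacobiM// !mxE.
rewrite /dflux /=; move: i; apply: ord4P;
  rewrite /dnormal_flux /dflux1 /dflux2 /dvel_n /dvel1 /dvel2 /col4 ?mxE /=; by field.
Qed.

Lemma PWM w v nu : density w != 0 ->
  PW gamma w nu *m v = dpressure gamma w v *: col4 0 (nu 0 0) (nu 1 0) 0.
Proof.
move=> w0; apply/colP => i; rewrite [LHS]mxE [RHS]mxE -dpressure_sum mulr_suml.
apply: eq_bigr => j _; rewrite mxE.
by have [_ ->] := is_derive_normal_pressure gamma (delta_mx j 0) w0 nu i; ring.
Qed.

(** [Ugamma] subtracts from the momentum its normal component times [nu], and that component is zero
    here. *)
Lemma Ugamma_tangent nu v : momentum1 v * nu 0 0 + momentum2 v * nu 1 0 = 0 ->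
  Ugamma nu *m v = v.
Proof.
rewrite /momentum1 /momentum2 -/o1 -/o2 => t.
have t1 : (v o1 0 * nu 0 0 + v o2 0 * nu 1 0) * nu 0 0 = 0 by rewrite t mul0r.
have t2 : (v o1 0 * nu 0 0 + v o2 0 * nu 1 0) * nu 1 0 = 0 by rewrite t mul0r.
apply/colP => i; rewrite mxE sum_ord4; move: i; apply: ord4P; rewrite !mxE /=.
- by ring.
- by rewrite -[RHS]subr0 -[in RHS]t1; ring.
- by rewrite -[RHS]subr0 -[in RHS]t2; ring.
- by ring.
Qed.

Lemma Mgamma_tangent nu v : momentum1 v * nu 0 0 + momentum2 v * nu 1 0 = 0 ->
  Mgamma nu *m v = v.
Proof.
move=> t; rewrite /Mgamma mulmxBl -scalemxAl Ugamma_tangent// mul1mx.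
by rewrite scaler_nat mulr2n addrK.
Qed.

(** The normal velocity vanishes, and so does its derivative along a tangential [v]. Of
    [dnormal_flux] only the pressure terms dp nu remain. *)
Lemma wall_jacobi w v nu : density w != 0 ->
  momentum1 w * nu 0 0 + momentum2 w * nu 1 0 = 0 ->
  momentum1 v * nu 0 0 + momentum2 v * nu 1 0 = 0 ->
  normal_flux_jacobi gamma w nu *m v = PW gamma w nu *m v.
Proof.
move=> w0 tw; rewrite normal_flux_jacobiM// PWM//.
rewrite /momentum1 /momentum2 -/o1 -/o2 => tv.
have un0 : velocity1 w * nu 0 0 + velocity2 w * nu 1 0 = 0.
  transitivity ((momentum1 w * nu 0 0 + momentum2 w * nu 1 0) / density w).
    by rewrite /velocity1 /velocity2; ring.
  by rewrite tw mul0r.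
apply/colP; apply: ord4P; rewrite /dnormal_flux /dvel_n un0 tv !mxE /=; by ring.
Qed.

(** * Hyperbolicity: an explicit eigenbasis *)

Section Diagonalization.
Variables (w : 'cV[R]_4) (nu : 'cV[R]_2).
Hypotheses (gamma1 : 1 < gamma) (adm : admissible gamma w) (nu1 : dot nu nu = 1).

Let rho := density w.
Let u1 := velocity1 w.
Let u2 := velocity2 w.
Let n1 := nu 0 0.
Let n2 := nu 1 0.
Let un := u1 * n1 + u2 * n2.
Let ut := u2 * n1 - u1 * n2.
Let q := u1 ^+ 2 + u2 ^+ 2.
Let b := gamma - 1.
(** The speed of sound. [H] is the total enthalpy (E + p) / rho, written through c^2 so that
    pressure and energy disappear from the eigenvalue computations. *)
Let c := Num.sqrt (gamma * pressure gamma w / rho).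
Let H := c ^+ 2 / b + q / 2.

Let rho0 : rho != 0. Proof. by rewrite lt0r_neq0//; case: adm. Qed.
Let b0 : b != 0. Proof. by rewrite subr_eq0 gt_eqF. Qed.
Let c0 : c != 0.
Proof.
case: adm => r0 p0; rewrite lt0r_neq0// sqrtr_gt0 divr_gt0// mulr_gt0//.
exact: lt_trans gamma1.
Qed.
Let c2E : c ^+ 2 = gamma * pressure gamma w / rho.
Proof.
case: adm => r0 p0; rewrite sqr_sqrtr// ltW// divr_gt0// mulr_gt0//.
exact: lt_trans gamma1.
Qed.
Let nn : n1 * n1 + n2 * n2 = 1. Proof. by rewrite -nu1 dot2E. Qed.

Let EpE : energy w + pressure gamma w = rho * H.
Proof.
have pE : pressure gamma w = b * (energy w - 2^-1 * rho * q) by [].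
have -> : energy w = pressure gamma w / b + 2^-1 * rho * q by rewrite {1}pE; field.
by rewrite /H c2E /b; field; rewrite rho0 b0.
Qed.

Definition eigenvalues : 'rV[R]_4 := \row_(k < 4) [:: un - c; un; un; un + c]`_k.

(** The columns are the right eigenvectors: the two acoustic waves outside, the entropy wave and the
    shear wave between them. *)
Definition eigenvectors : 'M[R]_4 := \matrix_(i < 4, k < 4)
  (nth [::] [:: [:: 1; 1; 0; 1];
                [:: u1 - c * n1; u1; - n2; u1 + c * n1];
                [:: u2 - c * n2; u2; n1; u2 + c * n2];
                [:: H - c * un; q / 2; ut; H + c * un]] i)`_k.

(** The rows are the dual left eigenvectors, in the same order. *)
Definition coeigenvectors : 'M[R]_4 := \matrix_(k < 4, j < 4)
  (nth [::] [:: [:: (b * q / 2 + c * un) / (2 * c ^+ 2);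
                    - (b * u1 + c * n1) / (2 * c ^+ 2);
                    - (b * u2 + c * n2) / (2 * c ^+ 2); b / (2 * c ^+ 2)];
                [:: 1 - b * q / 2 / c ^+ 2; b * u1 / c ^+ 2; b * u2 / c ^+ 2; - b / c ^+ 2];
                [:: - ut; - n2; n1; 0];
                [:: (b * q / 2 - c * un) / (2 * c ^+ 2);
                    - (b * u1 - c * n1) / (2 * c ^+ 2);
                    - (b * u2 - c * n2) / (2 * c ^+ 2); b / (2 * c ^+ 2)]] k)`_j.

Lemma eigen_normal_flux k : normal_flux_jacobi gamma w nu *m col k eigenvectors =
  eigenvalues 0 k *: col k eigenvectors.
Proof.
rewrite normal_flux_jacobiM//.
have mn : (u1 + c * n1) * n1 + (u2 + c * n2) * n2 = un + c.
  by rewrite -[in RHS](mulr1 c) -nn /un; ring.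
have mn' : (u1 - c * n1) * n1 + (u2 - c * n2) * n2 = un - c.
  by rewrite -[in RHS](mulr1 c) -nn /un; ring.
have dpE v : dpressure gamma w v =
  b * (v o3 0 - u1 * v o1 0 - u2 * v o2 0 + 2^-1 * q * v o0 0) by [].
rewrite /dnormal_flux /dvel_n dpE EpE -/rho -/u1 -/u2 -/n1 -/n2 -/un.
move: k; apply: ord4P; apply/colP; apply: ord4P; rewrite /col4 !mxE /= ?mn ?mn' /H.
all: rewrite ?/un ?/q ?/ut; field.
all: by rewrite ?b0 ?rho0.
Qed.

(** [field] does not know that the normal is a unit vector; an identity that depends on it is stated
    with the multiple [k] of this relation by which its sides differ. *)
Let mod_unit k X Y : X - Y = k * (n1 * n1 + n2 * n2 - 1) -> X = Y.
Proof. by rewrite nn subrr mulr0 => /subr0_eq. Qed.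

Lemma coeigenvectorsM : coeigenvectors *m eigenvectors = 1%:M.
Proof.
apply/matrixP; apply: ord4P; apply: ord4P; rewrite !mxE sum_ord4 !mxE /= /H /un /ut /q.
(* The acoustic rows against the acoustic columns need the multiples 1/2 and -1/2, the shear row
   against the shear column needs 1; all other entries are plain identities. *)
all: first [ field; by rewrite ?b0 ?c0
  | apply: (mod_unit (k := 2^-1)); field; by rewrite ?b0 ?c0
  | apply: (mod_unit (k := - 2^-1)); field; by rewrite ?b0 ?c0
  | apply: (mod_unit (k := 1)); field; by rewrite ?b0 ?c0 ].
Qed.

(** In A = T^-1 diag T the rows of T are left eigenvectors, so T is [coeigenvectors], with inverse
    [eigenvectors]. The split then is max(l, 0) + min(l, 0) = l on the diagonal. *)
Lemma Pplus_Pminus : Pplus gamma w nu + Pminus gamma w nu = normal_flux_jacobi gamma w nu.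
Proof.
have [uT uR] := mulmx1_unit coeigenvectorsM.
have invT : invmx coeigenvectors = eigenvectors.
  by rewrite -[RHS]mul1mx -(mulVmx uT) -mulmxA coeigenvectorsM mulmx1.
apply: (spectral_map_max_min uT (d := eigenvalues)).
have AR : normal_flux_jacobi gamma w nu *m eigenvectors = eigenvectors *m diag_mx eigenvalues.
  apply/matrixP => i k; rewrite mul_mx_diag.
  have -> : (normal_flux_jacobi gamma w nu *m eigenvectors) i k =
      (normal_flux_jacobi gamma w nu *m col k eigenvectors) i 0.
    rewrite [LHS]mxE [RHS]mxE; apply: eq_bigr => j _; congr (_ * _).
    by rewrite [RHS]mxE.
  rewrite eigen_normal_flux [LHS]mxE [RHS]mxE mulrC; congr (_ * _).
  by rewrite [LHS]mxE.
rewrite invT -AR -mulmxA.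
have -> : eigenvectors *m coeigenvectors = 1%:M by rewrite -invT mulVmx.
by rewrite mulmx1.
Qed.

End Diagonalization.
End EulerMatrices.

(** * The interfaces of the mesh *)

Section Interface.
Context {R : realType} (Omega : trace_domain R) (I : finType) (K : I -> trace_domain R).
Hypothesis mesh : is_mesh Omega K.

Lemma mesh_normal : {ae arclen, forall x,
  \sum_(k | x \in bdry (carrier (K k))) normal (K k) x =
  if x \in bdry (carrier Omega) then normal Omega x else 0}.
Proof.
have t1 := ae_forall_fin (fun k => trace_cst1 (K k)).
have t2 := trace_cst1 Omega.
have := ae_forall_fin (fun s => mesh_trace mesh s (sobolev1_cst1 Omega)).
apply: ae_impl2 (ae_and t1 t2) => x [e1 e2] H.
apply/colP => s; have := H s; rewrite summxE.
under eq_bigr => k; first rewrite inE => Bk; first rewrite e1// mul1r.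
  over.
move=> ->; case: ifPn; rewrite ?mxE// inE => Bx.
by rewrite e2// mul1r.
Qed.

Variables (J : finType) (f : J -> plane R -> R).
Hypothesis fO : forall j, sobolev1 (carrier Omega) (f j).

(** A finite family [f] is treated at once, so that one null set and one choice of the neighbouring
    element serve all components. On an inner edge the two products of trace and normal add up to
    zero and the normals are opposite, hence the traces agree. *)
Lemma mesh_interface : {ae arclen, forall x,
  if x \in bdry (carrier Omega) then
    exists k, [/\ x \in bdry (carrier (K k)),
      forall l, x \in bdry (carrier (K l)) -> l = k, normal (K k) x = normal Omega x &
      forall j, trace (K k) (f j) x = trace Omega (f j) x]
  else
    forall k, x \in bdry (carrier (K k)) -> exists l, [/\ l != k /\ x \in bdry (carrier (K l)),
      forall m, x \in bdry (carrier (K m)) -> m = k \/ m = l,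
      normal (K l) x = - normal (K k) x &
      forall j, trace (K l) (f j) x = trace (K k) (f j) x]}.
Proof.
have o1 := ae_forall_fin (fun k => normal_outer (K k)).
have o2 := normal_unit Omega.
have o3 := mesh_normal.
have o4 := ae_forall_fin (fun j => ae_forall_fin (fun s => mesh_trace mesh s (fO j))).
apply: ae_impl2 (ae_and o1 o2) (ae_and o3 o4) => x [outK n1O] [sumn sumt].
have n1K k : x \in bdry (carrier (K k)) -> dot (normal (K k) x) (normal (K k) x) = 1.
  by rewrite inE => /outK[].
have opp k l : x \in bdry (carrier (K k)) -> x \in bdry (carrier (K l)) -> k != l ->
    normal (K l) x = - normal (K k) x.
  rewrite !inE => Bk Bl kl; have [_ dis _] := mesh.
  apply: (outer_normal_disjoint (measurable_carrier (K k)) (measurable_carrier (K l))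
    (dis _ _ kl)); [exact: outK|exact: outK].
have n1O' : x \in bdry (carrier Omega) -> dot (normal Omega x) (normal Omega x) = 1.
  by rewrite inE => /n1O.
have := interface_cases (B := fun k => x \in bdry (carrier (K k))) n1K n1O' opp sumn.
case: ifPn sumn sumt => [xO|xO] sumn sumt.
- move=> [k [Bk uk]].
  have only (V : zmodType) (F : I -> V) : \sum_(l | x \in bdry (carrier (K l))) F l = F k.
    rewrite (bigD1 k)//= big_pred0 ?addr0// => l.
    by apply/negP => /andP[/uk ->]; rewrite eqxx.
  have nk : normal (K k) x = normal Omega x by rewrite -sumn only.
  exists k; split => // j; apply: (unit_mul_inj (n1K _ Bk)) => s.
  by have := sumt j s; rewrite only => ->; rewrite nk.
- move=> cases k Bk; have [l [lk Bl ukl]] := cases k Bk.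
  have nl : normal (K l) x = - normal (K k) x by apply: opp => //; rewrite eq_sym.
  exists l; split => // j; apply: (unit_mul_inj (n1K _ Bk)) => s.
  have := sumt j s; rewrite (bigD1 k)//= (bigD1 l)/=; last by rewrite Bl lk.
  rewrite big_pred0 ?addr0; last first.
    move=> m; apply/negP => /andP[/andP[/ukl[->|->]]]; by rewrite eqxx.
  by rewrite nl mxE mulrN => /subr0_eq ->.
Qed.

End Interface.

(** * Continuity of the Jacobi matrices *)

Section FluxRegularity.
Context {R : realType} (gamma : R).
Variables (A : set (plane R)) (w : plane R -> 'cV[R]_4).
Hypotheses (cw : {within A, continuous w}) (w0 : forall x, A x -> density (w x) != 0).

Lemma cvg_col4 (F : set_system (plane R)) {FF : Filter F} (a b c d : plane R -> R)
    (la lb lc ld : R) i :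
  a @ F --> la -> b @ F --> lb -> c @ F --> lc -> d @ F --> ld ->
  (fun y => col4 (a y) (b y) (c y) (d y) i 0) @ F --> col4 la lb lc ld i 0.
Proof.
move=> ha hb hc hd; move: i; apply: ord4P.
- rewrite (_ : (fun y => _) = a) ?mxE//; by apply/funext => y; rewrite mxE.
- rewrite (_ : (fun y => _) = b) ?mxE//; by apply/funext => y; rewrite mxE.
- rewrite (_ : (fun y => _) = c) ?mxE//; by apply/funext => y; rewrite mxE.
- rewrite (_ : (fun y => _) = d) ?mxE//; by apply/funext => y; rewrite mxE.
Qed.

Lemma within_continuous_coord (i : 'I_4) : {within A, continuous (fun x => w x i 0)}.
Proof.
move=> x; apply: (@continuous_comp (subspace A) _ _ w (fun M : 'cV[R]_4 => M i 0)).
  exact: cw.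
exact: coord_continuous.
Qed.

Lemma within_continuous_dflux s v i :
  {within A, continuous (fun x => dflux gamma (w x) v s i 0)}.
Proof.
apply/subspace_continuousP => x Ax.
have FF : Filter (within A (nbhs x)) by exact: within_filter.
have cc j : (fun y => w y j 0) @ within A (nbhs x) --> w x j 0.
  by have /subspace_continuousP := within_continuous_coord (i := j); exact.
have cV : (fun y => (density (w y))^-1) @ within A (nbhs x) --> (density (w x))^-1.
  by apply: cvgV; [exact: w0|exact: cc].
have cv1 : (fun y => velocity1 (w y)) @ within A (nbhs x) --> velocity1 (w x).
  by apply: cvgM => //; exact: cc.
have cv2 : (fun y => velocity2 (w y)) @ within A (nbhs x) --> velocity2 (w x).
  by apply: cvgM => //; exact: cc.
have cq : (fun y => velocity1 (w y) ^+ 2 + velocity2 (w y) ^+ 2) @ within A (nbhs x) -->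
    velocity1 (w x) ^+ 2 + velocity2 (w x) ^+ 2.
  by apply: cvgD; apply: cvgM.
have cr : (fun y => density (w y)) @ within A (nbhs x) --> density (w x) by exact: cc.
have cE : (fun y => energy (w y)) @ within A (nbhs x) --> energy (w x) by exact: cc.
have ck (a : R) : (fun=> a) @ within A (nbhs x) --> a by exact: cvg_cst.
have cp : (fun y => pressure gamma (w y)) @ within A (nbhs x) --> pressure gamma (w x).
  by apply: cvgM => //; apply: cvgB => //; apply: cvgM => //; exact: cvgM.
have cd1 : (fun y => dvel1 (w y) v) @ within A (nbhs x) --> dvel1 (w x) v.
  by apply: cvgM => //; apply: cvgB => //; exact: cvgM.
have cd2 : (fun y => dvel2 (w y) v) @ within A (nbhs x) --> dvel2 (w x) v.
  by apply: cvgM => //; apply: cvgB => //; exact: cvgM.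
have cdp : (fun y => dpressure gamma (w y) v) @ within A (nbhs x) --> dpressure gamma (w x) v.
  apply: cvgM => //; apply: cvgD; last by apply: cvgM => //; exact: cvgM.
  by apply: cvgB; [apply: cvgB => //; exact: cvgM|exact: cvgM].
rewrite /dflux; case: (s == 0); rewrite ?/dflux1 ?/dflux2; apply: cvg_col4.

- by apply: cvgD; exact: cvgM.
- by apply: cvgD => //; apply: cvgD; apply: cvgM => //; [exact: cvgM|apply: cvgM => //; exact: cvgM].
- by apply: cvgD; apply: cvgM => //; [exact: cvgM|apply: cvgD; exact: cvgM].
- by apply: cvgD; apply: cvgM => //; exact: cvgD.
- by apply: cvgD; exact: cvgM.
- by apply: cvgD; apply: cvgM => //; [exact: cvgM|apply: cvgD; exact: cvgM].
- by apply: cvgD => //; apply: cvgD; apply: cvgM => //; [exact: cvgM|apply: cvgM => //; exact: cvgM].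
- by apply: cvgD; apply: cvgM => //; exact: cvgD.
Qed.

(** On the compact closure of the domain this bounds the Jacobi entries, which makes the volume and
    surface forms integrable. The explicit formula is available where the density is nonzero, hence
    the transfer along equality on [A]. *)
Lemma within_continuous_flux_jacobi s i j :
  {within A, continuous (fun x => flux_jacobi gamma s (w x) i j)}.
Proof.
apply: (@subspace_eq_continuous _ _ _ (fun x => dflux gamma (w x) (delta_mx j 0) s i 0)).
  by move=> x; rewrite inE => /w0 d0; symmetry; exact: flux_jacobiE.
exact: within_continuous_dflux.
Qed.

End FluxRegularity.

(** * Almost-everywhere bounds and completeness of arc length *)

Section MoreIntegralFacts.
Context {R : realType} d (T : measurableType d) (mu : {measure set T -> \bar R}).
Implicit Types (D : set T) (f g : T -> R).

Lemma integrable_fsum (I : finType) D (f : I -> T -> R) : measurable D ->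
  (forall k, mu.-integrable D (EFin \o f k)) ->
  mu.-integrable D (EFin \o (fun x => \sum_k f k x)).
Proof.
move=> mD fi; rewrite (_ : _ \o _ = (fun x => \sum_k (EFin \o f k) x)%E).
  by apply: integrable_sum => // k _; exact: fi.
by apply/funext => x /=; rewrite sumEFin.
Qed.

(** Made for the components of the normal, which are known to be bounded by 1 only almost
    everywhere. *)
Lemma integrable_mul_ae_bounded D f g (M : R) : measurable D -> measurable_fun D g ->
  {ae mu, forall x, D x -> `|g x| <= M} ->
  mu.-integrable D (EFin \o f) -> mu.-integrable D (EFin \o (fun x => g x * f x)).
Proof.
move=> mD mg gM fi; have /measurable_EFinP mf := measurable_int _ fi.
have mgf : measurable_fun D (fun x => g x * f x) by exact: measurable_funM.
apply/integrableP; split; first exact/measurable_EFinP.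
have /integrableP[_] := integrableZl mD `|M| fi.
apply: le_lt_trans; apply: ae_ge0_le_integral => //.
- by apply/measurable_EFinP; exact: measurableT_comp.
- by apply: measurableT_comp => //; apply/measurable_EFinP; exact: measurable_funM.
apply: ae_impl gM => x H Dx /=; rewrite lee_fin !normrM normr_id ler_wpM2r//.
exact: le_trans (H Dx) (ler_norm _).
Qed.

End MoreIntegralFacts.

Section Arclength.
Context {R : realType}.

(** Arc length is complete, so a function almost everywhere equal to a measurable one is measurable.
    This admits integrands [f] containing [Pplus] and [Pminus], which are defined by choice. *)
Lemma ae_Rintegral_arclen (D : set (plane R)) (f g : plane R -> R) :
  (@hausdorff1 R).-cara.-measurable D ->
  measurable_fun (D : set (caratheodory_type (@hausdorff1 R))) g ->
  {ae arclen, forall x, D x -> f x = g x} ->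
  \int[arclen]_(x in D) f x = \int[arclen]_(x in D) g x.
Proof.
move=> mD mg fg; apply: (ae_Rintegral (mu := arclen)) => //.
apply/measurable_EFinP.
apply: (@ae_measurable_fun _ _ _ (@arclen R) _ D (EFin \o g)).
- exact: measure_is_complete_caratheodory.
- by apply: ae_impl fg => x H Dx /=; rewrite H.
- exact/measurable_EFinP.
Qed.

Lemma dotE n (u v : 'cV[R]_n) : dot u v = \sum_i u i 0 * v i 0.
Proof. by rewrite /dot mxE; apply: eq_bigr => i _; rewrite mxE. Qed.

Lemma dotC n (u v : 'cV[R]_n) : dot u v = dot v u.
Proof. by rewrite !dotE; apply: eq_bigr => i _; rewrite mulrC. Qed.

Lemma dot_trmx n (A : 'M[R]_n) (u v : 'cV[R]_n) : dot u (A^T *m v) = dot v (A *m u).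
Proof.
by rewrite [RHS]dotC /dot mulmxA -trmx_mul.
Qed.

End Arclength.

(** * Regularity of the target weight and of the components of the solution *)

Section Target.
Context {R : realType}.

Lemma lift_theta_continuous k (alpha Cinf L : R) xref i :
  continuous (fun x => lift_theta (theta k alpha Cinf L xref) x i 0).
Proof.
have th s : continuous (fun x => theta k alpha Cinf L xref x s 0).
  case: k.
  - by move=> x; exact: cvg_cst.
  - by move=> x; exact: cvg_cst.
  move=> x; rewrite /theta.
  have c1 : (fun y : plane R => (y - xref).1) @ x --> (x - xref).1.
    by apply: cvgB; [exact: cvg_fst|exact: cvg_cst].
  have c2 : (fun y : plane R => (y - xref).2) @ x --> (x - xref).2.
    by apply: cvgB; [exact: cvg_snd|exact: cvg_cst].
  pose a j := (Gmx *m rotation alpha) j s.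
  have e y : ((Cinf * L)^-1 *: ((vec2 (y - xref))^T *m Gmx *m rotation alpha)^T) s 0 =
      (Cinf * L)^-1 * ((y - xref).1 * a 0 + (y - xref).2 * a 1).
    rewrite [LHS]mxE; congr (_ * _); rewrite -mulmxA [LHS]mxE [LHS]mxE sum_ord2.
    by congr (_ * _ + _ * _); rewrite !mxE.
  rewrite (_ : (fun y => _) = (fun y => (Cinf * L)^-1 * ((y - xref).1 * a 0 + (y - xref).2 * a 1))).
    apply: cvgM; first exact: cvg_cst.
    by apply: cvgD; apply: cvgM => //; exact: cvg_cst.
  by apply/funext => y; rewrite e.
by move=> x; apply: cvg_col4; by [exact: th|exact: cvg_cst].
Qed.

End Target.

Section SmoothComponents.
Context {R : realType} (D : set (plane R)) (w : plane R -> 'cV[R]_4).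

Lemma C1_closure_coord i : C1_closure D w -> C1_closure D (fun x => w x i 0).
Proof.
move=> [cw dw]; split; first exact: within_continuous_coord.
move=> s; have [wd [g cg gE]] := dw s; split=> [x Dx|].
  by have /derivable_mxP := wd x Dx; exact.
exists (fun x => g x i 0); first exact: within_continuous_coord.
by move=> x Dx; rewrite gE// derive_mx ?mxE//; exact: wd.
Qed.

End SmoothComponents.

(** * Adjoint consistency *)

Section Forms.
Context {R : realType} (gamma : R) (Omega : trace_domain R).
Variable w : plane R -> 'cV[R]_4.
Hypothesis smooth_w : smooth gamma Omega w.

Let density0 x : closure (carrier Omega) x -> density (w x) != 0.
Proof. by case: smooth_w => _ /[apply] -[? _]; rewrite lt0r_neq0. Qed.

Let cw : {within closure (carrier Omega), continuous w}.
Proof. by case: smooth_w => -[]. Qed.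

Lemma flux_jacobi_bounded s i j : exists M, forall x, closure (carrier Omega) x ->
  `|flux_jacobi gamma s (w x) i j| <= M.
Proof.
apply: compact_continuous_bounded.
  exact: compact_closure_bounded (@bounded_carrier R Omega).
exact: within_continuous_flux_jacobi.
Qed.

Lemma measurable_flux_jacobi (A : set (plane R)) s i j : measurable A ->
  A `<=` closure (carrier Omega) ->
  measurable_fun A (fun x => flux_jacobi gamma s (w x) i j).
Proof.
move=> mA Acl; apply: within_continuous_measurable => //.
by apply: continuous_subspaceW Acl _; exact: within_continuous_flux_jacobi.
Qed.

Lemma volume_form_integrable (D : trace_domain R) (phi z : plane R -> 'cV[R]_4) :
  carrier D `<=` carrier Omega -> vL2 (carrier D) phi -> vsobolev1 (carrier D) z ->
  area.-integrable (carrier D) (EFin \o (fun x =>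
    \sum_(s < 2) dot (vweak_deriv (carrier D) s z x) (flux_jacobi gamma s (w x) *m phi x))).
Proof.
move=> DO phiL zD; have mD := measurable_carrier D.
have Dcl : carrier D `<=` closure (carrier Omega) by move=> x /DO; exact: subset_closure.
have term s i j : area.-integrable (carrier D) (EFin \o (fun x =>
    flux_jacobi gamma s (w x) i j * (weak_deriv (carrier D) s (fun y => z y i 0) x * phi x j 0))).
  have [M JM] := flux_jacobi_bounded s i j.
  apply: (integrable_mul_bounded (mu := area) (M := M) mD).
  - exact: (measurable_flux_jacobi s i j mD Dcl).
  - by move=> x Dx; apply: JM; exact: Dcl.
  - by apply: (L2_mul (mu := area) mD) => //; exact: weak_deriv_L2.
have := integrable_fsum (mu := area) mD (fun s => integrable_fsum (mu := area) mD
  (fun i => integrable_fsum (mu := area) mD (fun j => term s i j))).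
apply: (eq_integrable (mu := area) mD) => x _ /=; congr EFin; apply: eq_bigr => s _.
rewrite dotE; apply: eq_bigr => i _; rewrite !mxE mulr_sumr.
by apply: eq_bigr => j _; ring.
Qed.

(** Each term of the expansion is a normal component, a bounded Jacobi entry and a product of two
    square integrable functions. [r] is left general: it stands for the trace of z and for the
    target weight. *)
Lemma surface_form_integrable (D : trace_domain R) (r v : plane R -> 'cV[R]_4) :
  bdry (carrier D) `<=` closure (carrier Omega) ->
  (forall i, L2 arclen (bdry (carrier D)) (fun x => r x i 0)) ->
  (forall i, L2 arclen (bdry (carrier D)) (fun x => v x i 0)) ->
  arclen.-integrable (bdry (carrier D)) (EFin \o (fun x =>
    dot (r x) (normal_flux_jacobi gamma (w x) (normal D x) *m v x))).
Proof.
move=> Dcl rL vL; have mD := measurable_bdry (carrier D).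
have bD : measurable (bdry (carrier D)).
  by apply: closed_measurable_plane; exact: closed_bdry.
have term s i j : arclen.-integrable (bdry (carrier D)) (EFin \o (fun x =>
    normal D x s 0 * (flux_jacobi gamma s (w x) i j * (r x i 0 * v x j 0)))).
  have [M JM] := flux_jacobi_bounded s i j.
  apply: (integrable_mul_ae_bounded (mu := arclen) (M := 1) mD).
  - exact: normal_measurable.
  - exact: normal_coord_le1.
  apply: (integrable_mul_bounded (mu := arclen) (M := M) mD).
  - exact: (measurable_fun_cara (measurable_flux_jacobi s i j bD Dcl) bD).
  - by move=> x Dx; apply: JM; exact: Dcl.
  - exact: (L2_mul (mu := arclen) mD (rL i) (vL j)).
have := integrable_fsum (mu := arclen) mD (fun s => integrable_fsum (mu := arclen) mD
  (fun i => integrable_fsum (mu := arclen) mD (fun j => term s i j))).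
apply: (eq_integrable (mu := arclen) mD) => x; rewrite inE => /Dcl/density0 w0 /=; congr EFin.
rewrite normal_flux_jacobiE// mulmx_suml dotE exchange_big /=; apply: eq_bigr => i _.
rewrite summxE mulr_sumr; apply: eq_bigr => s _.
rewrite -scalemxAl !mxE mulrA mulr_sumr; apply: eq_bigr => j _; ring.
Qed.

End Forms.

(** * Reduction of the discrete form to the continuous one *)

Section AdjointConsistency.
Context {R : realType} (gamma : R) (Omega : trace_domain R).
Variables (GammaW GammaIO : set (plane R)) (wBC : plane R -> 'cV[R]_4).
Variables (th : plane R -> 'cV[R]_2) (I : finType) (K : I -> trace_domain R).
Variables (i : wall_treatment) (w z phi : plane R -> 'cV[R]_4).
Hypotheses (gamma1 : 1 < gamma)
  (dec : boundary_decomposition Omega GammaW GammaIO) (mesh : is_mesh Omega K)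
  (smooth_w : smooth gamma Omega w)
  (euler_w : euler_solution gamma Omega GammaW GammaIO wBC w)
  (zO : vsobolev1 Omega z) (phiV : Vtilde gamma Omega GammaW GammaIO w phi)
  (cth : forall j, continuous (fun x => lift_theta th x j 0)).

Let Gamma := bdry (carrier Omega).
Let bd k := bdry (carrier (K k)).
Let KO k : carrier (K k) `<=` carrier Omega. Proof. by case: mesh => + _ _; exact. Qed.

Let phiO : vsobolev1 Omega phi. Proof. by case: phiV => -[]. Qed.

Let fK (f : plane R -> R) k : sobolev1 (carrier Omega) f -> sobolev1 (carrier (K k)) f.
Proof. exact: (sobolev1_sub (measurable_carrier Omega) (measurable_carrier (K k)) (KO (k:=k))). Qed.

Let bd_closure k : bd k `<=` closure (carrier Omega).
Proof. by move=> x [+ _]; exact: closureS (KO (k:=k)) x. Qed.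

Let Gamma_closure : Gamma `<=` closure (carrier Omega). Proof. by move=> x []. Qed.

Let adm x : closure (carrier Omega) x -> admissible gamma (w x).
Proof. by case: smooth_w => _; exact. Qed.

Let density0 x : closure (carrier Omega) x -> density (w x) != 0.
Proof. by move=> /adm[? _]; rewrite lt0r_neq0. Qed.

(** The integrand z^T P(w,n) phi seen from [D], to which all surface terms of the discrete form are
    reduced. *)
Let G (D : trace_domain R) x :=
  dot (vtrace D z x) (normal_flux_jacobi gamma (w x) (normal D x) *m vtrace D phi x).

Let wK j k : sobolev1 (carrier (K k)) (fun x => w x j 0).
Proof.
apply: fK; apply: C1_closure_sobolev1; [exact: open_carrier|exact: bounded_carrier|].
by apply: C1_closure_coord; case: smooth_w.
Qed.

Let trace_w : {ae arclen, forall x k, bd k x -> vtrace (K k) w x = w x}.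
Proof.
apply: ae_forall_fin => k.
have H j : {ae arclen, forall x, bd k x -> trace (K k) (fun y => w y j 0) x = w x j 0}.
  apply: (trace_restriction (trace_operator (K k))); first exact: wK.
  apply: continuous_subspaceW (closureS (KO (k:=k))) _.
  by apply: within_continuous_coord; case: smooth_w => -[].
by apply: ae_impl (ae_forall_fin H) => x e Bx; apply/colP => j; rewrite mxE e.
Qed.

(** Gathers every property that holds off a null set, so that the arguments below are pointwise and
    [ae_good_point] is the only exceptional set. *)
Record good_point x : Prop := GoodPoint {
  good_trace_w : forall k, bd k x -> vtrace (K k) w x = w x;
  good_unit : Gamma x -> dot (normal Omega x) (normal Omega x) = 1;
  good_unitK : forall k, bd k x -> dot (normal (K k) x) (normal (K k) x) = 1;
  good_part : Gamma x -> GammaW x \/ GammaIO x;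
  good_w : GammaW x ->
    momentum1 (w x) * normal Omega x 0 0 + momentum2 (w x) * normal Omega x 1 0 = 0;
  good_phi : GammaW x -> momentum1 (vtrace Omega phi x) * normal Omega x 0 0 +
    momentum2 (vtrace Omega phi x) * normal Omega x 1 0 = 0;
  good_IO : GammaIO x ->
    Pminus gamma (w x) (normal Omega x) *m vtrace Omega phi x = 0;
  good_boundary : Gamma x -> exists k, [/\ bd k x, forall l, bd l x -> l = k,
    normal (K k) x = normal Omega x, vtrace (K k) z x = vtrace Omega z x &
    vtrace (K k) phi x = vtrace Omega phi x];
  good_inner : ~ Gamma x -> forall k, bd k x -> exists l, [/\ l != k /\ bd l x,
    forall m, bd m x -> m = k \/ m = l, normal (K l) x = - normal (K k) x,
    vtrace (K l) z x = vtrace (K k) z x & vtrace (K l) phi x = vtrace (K k) phi x] }.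

Lemma ae_good_point : {ae arclen, forall x, good_point x}.
Proof.
(* The eight components of phi and z as one finite family, in order that [mesh_interface] yields the
   same neighbour for all of them. *)
pose F (j : bool * 'I_4) x : R := if j.1 then phi x j.2 0 else z x j.2 0.
have FO j : sobolev1 (carrier Omega) (F j).
  by rewrite /F; case: j => -[] j /=; [exact: phiO|exact: zO].
have [_ wW _] := euler_w; have [_ pW pIO] := phiV.
have part : {ae arclen, forall x, Gamma x -> GammaW x \/ GammaIO x}.
  exists (Gamma `\` (GammaW `|` GammaIO)); split.
  - apply: measurableD; first exact: measurable_bdry.
    by apply: measurableU; [exact: GammaW_measurable dec|exact: GammaIO_measurable dec].
  - exact: Gamma_null dec.
  - by move=> x /= /not_implyP[Gx nGx]; split.
have := ae_and (ae_and (ae_and trace_w (normal_unit Omega))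
  (ae_and (ae_forall_fin (fun k => normal_unit (K k))) part))
  (ae_and (ae_and wW pW) (ae_and pIO (mesh_interface mesh FO))).
apply: ae_impl => x [[[tw u] [uK pt]] [[ww pw] [pio inter]]].
split => //; move: inter; case: ifPn; rewrite ?inE ?notin_setE => Gx //.
- move=> [k [Bk uk nk tk]] _; exists k; split => //.
  + by rewrite inE in Bk.
  + by move=> l Bl; apply: uk; rewrite inE.
  + by apply/colP => j; have := tk (false, j); rewrite !mxE.
  + by apply/colP => j; have := tk (true, j); rewrite !mxE.
- move=> H _ k Bk; have [|l [[lk Bl] ul nl tl]] := H k; first by rewrite inE.
  exists l; split => //.
  + by rewrite inE in Bl.
  + by move=> m Bm; apply: ul; rewrite inE.
  + by apply/colP => j; have := tl (false, j); rewrite !mxE.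
  + by apply/colP => j; have := tl (true, j); rewrite !mxE.
Qed.

Let G_integrable D : bdry (carrier D) `<=` closure (carrier Omega) ->
  vsobolev1 (carrier D) z -> vsobolev1 (carrier D) phi ->
  arclen.-integrable (bdry (carrier D)) (EFin \o G D).
Proof.
move=> Dcl zD phiD; apply: (surface_form_integrable smooth_w Dcl) => j.
  exact: vtrace_L2.
exact: vtrace_L2.
Qed.

Let GK_integrable k : arclen.-integrable (bd k) (EFin \o G (K k)).
Proof.
apply: G_integrable; first exact: bd_closure.
  by move=> j; apply: fK; exact: zO.
by move=> j; apply: fK; exact: phiO.
Qed.

Let GO_integrable : arclen.-integrable Gamma (EFin \o G Omega).
Proof. by apply: G_integrable; [exact: Gamma_closure|exact: zO|exact: phiO]. Qed.

Let mbd k : (@hausdorff1 R).-cara.-measurable (bd k). Proof. exact: measurable_bdry. Qed.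
Let mGamma : (@hausdorff1 R).-cara.-measurable Gamma. Proof. exact: measurable_bdry. Qed.
Let mW := GammaW_measurable dec.
Let mIO := GammaIO_measurable dec.

(** [Ugamma] fixes w and phi, both tangential. The boundary value operator then gives P_W, equal to
    P on tangential vectors; for the mirror operator [Mgamma] fixes phi and P^+ + P^- = P
    remains. *)
Let wall_lin x : GammaW x -> good_point x ->
  wall_flux_lin gamma i (w x) (normal Omega x) *m vtrace Omega phi x =
  normal_flux_jacobi gamma (w x) (normal Omega x) *m vtrace Omega phi x.
Proof.
move=> Wx gx; have Gx : Gamma x by exact: (GammaW_sub dec).
have tw := good_w gx Wx; have tp := good_phi gx Wx.
have w0 := density0 (Gamma_closure Gx).
rewrite /wall_flux_lin Ugamma_tangent//; case: i.
  by rewrite -mulmxA Ugamma_tangent// wall_jacobi.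
rewrite mulmxDl -mulmxA Mgamma_tangent// -mulmxDl Pplus_Pminus//.
  exact: adm (Gamma_closure Gx).
exact: good_unit gx Gx.
Qed.

Let inner_integral k :
  \int[arclen]_(x in bd k `\` Gamma)
      dot (Pplus gamma (mean K k w x) (normal (K k) x) *m trace_in K k phi x +
           Pminus gamma (mean K k w x) (normal (K k) x) *m trace_out K k phi x)
          (trace_in K k z x) = \int[arclen]_(x in bd k `\` Gamma) G (K k) x.
Proof.
have mD : (@hausdorff1 R).-cara.-measurable (bd k `\` Gamma) by exact: measurableD.
apply: (ae_Rintegral_arclen mD).
  by apply/measurable_EFinP; apply: measurable_int (integrableS (mbd k) mD _ (GK_integrable k)); move=> x [].
apply: ae_impl ae_good_point => x gx [Bx nGx].
have [l [[lk Bl] ul nl tz tp]] := good_inner gx nGx Bx.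
(* [l] is the only element other than [k] with [x] on its boundary, so the choice inside
   [trace_from] can only return [l]. *)
have out f : trace_out K k f x = vtrace (K l) f x.
  rewrite /trace_out /trace_from; case: pickP => [m /= /andP[mk /asboolP Bm]|/(_ l)].
    by case: (ul m Bm) => e; rewrite e// in mk *; rewrite eqxx in mk.
  by rewrite /= lk asboolT.
have mE : mean K k w x = w x.
  rewrite /mean out /trace_in (good_trace_w gx Bx) (good_trace_w gx Bl).
  by apply/colP => j; rewrite mxE mxE; field.
rewrite mE out tp /trace_in -mulmxDl Pplus_Pminus//; first by rewrite dotC.
  exact/adm/(bd_closure Bx).
exact: good_unitK gx _ Bx.
Qed.

Let wall_integral k :
  \int[arclen]_(x in bd k `&` GammaW)
      dot (trace_in K k z x)
          (wall_flux_lin gamma i (trace_in K k w x) (normal (K k) x) *m trace_in K k phi x) =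
  \int[arclen]_(x in bd k `&` GammaW) G (K k) x.
Proof.
have mD : (@hausdorff1 R).-cara.-measurable (bd k `&` GammaW) by exact: measurableI.
apply: (ae_Rintegral_arclen mD).
  by apply/measurable_EFinP; apply: measurable_int (integrableS (mbd k) mD _ (GK_integrable k)); move=> x [].
apply: ae_impl ae_good_point => x gx [Bx Wx].
have [l [Bl ul nl tz tp]] := good_boundary gx (GammaW_sub dec Wx).
rewrite -(ul k Bx) in nl tz tp.
by rewrite /trace_in /G (good_trace_w gx Bx) nl tp wall_lin.
Qed.

Let io_integral k :
  \int[arclen]_(x in bd k `&` GammaIO)
      dot (Pplus gamma (trace_in K k w x) (normal (K k) x) *m trace_in K k phi x)
          (trace_in K k z x) =
  \int[arclen]_(x in bd k `&` GammaIO) G (K k) x.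
Proof.
have mD : (@hausdorff1 R).-cara.-measurable (bd k `&` GammaIO) by exact: measurableI.
apply: (ae_Rintegral_arclen mD).
  by apply/measurable_EFinP; apply: measurable_int (integrableS (mbd k) mD _ (GK_integrable k)); move=> x [].
apply: ae_impl ae_good_point => x gx [Bx IOx].
have Gx := GammaIO_sub dec IOx.
have [l [Bl ul nl tz tp]] := good_boundary gx Gx.
rewrite -(ul k Bx) in nl tz tp.
rewrite /trace_in /G (good_trace_w gx Bx) nl tp dotC; congr dot.
rewrite -(Pplus_Pminus gamma1 (adm (Gamma_closure Gx)) (good_unit gx Gx)).
by rewrite mulmxDl (good_IO gx IOx) addr0.
Qed.

(** Off the boundary of [Omega] the two contributions cancel, since P(w,-n) = -P(w,n) and the traces
    agree; on it the single element contributes the integrand of [Omega]. *)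
Let interface_sum x : good_point x ->
  \sum_(k | x \in bd k) G (K k) x = (G Omega \_ Gamma) x.
Proof.
move=> gx; rewrite patchE; case: ifPn => [|]; rewrite ?inE ?notin_setE => Gx.
  have [k [Bk uk nk tz tp]] := good_boundary gx Gx.
  rewrite (bigD1 k) ?inE//= big_pred0 ?addr0; first by rewrite /G nk tz tp.
  by move=> l; apply/negP => /andP[]; rewrite inE => /uk ->; rewrite eqxx.
have [[k Bk]|nB] := pselect (exists k, bd k x); last first.
  by rewrite big_pred0// => k; apply/negP; rewrite inE => Bk; apply: nB; exists k.
have [l [[lk Bl] ul nl tz tp]] := good_inner gx Gx Bk.
rewrite (bigD1 k)/=; last exact: mem_set.
rewrite (bigD1 l)/=; last by rewrite (mem_set Bl) lk.
rewrite big_pred0 ?addr0; last first.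
  move=> m; apply/negP => /andP[/andP[/set_mem/ul[->|->]]]; by rewrite eqxx.
rewrite /G nl tz tp normal_flux_jacobiN ?density0//; last exact: bd_closure Bk.
rewrite mulNmx !dotE -big_split big1// => j _.
by rewrite /= [X in _ + _ * X]mxE mulrN subrr.
Qed.

(** Up to a null set every element boundary splits disjointly into its inner, wall and inlet/outlet
    parts. After extension by zero the three integrands add up to [G (K k)], and [interface_sum]
    adds over the elements. *)
Let surface_terms :
  (\sum_k \int[arclen]_(x in bd k `\` Gamma) G (K k) x) +
  (\sum_k \int[arclen]_(x in bd k `&` GammaW) G (K k) x) +
  (\sum_k \int[arclen]_(x in bd k `&` GammaIO) G (K k) x) =
  \int[arclen]_(x in Gamma) G Omega x.
Proof.
have m1 k : (@hausdorff1 R).-cara.-measurable (bd k `\` Gamma) by exact: measurableD.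
have m2 k : (@hausdorff1 R).-cara.-measurable (bd k `&` GammaW) by exact: measurableI.
have m3 k : (@hausdorff1 R).-cara.-measurable (bd k `&` GammaIO) by exact: measurableI.
have i1 k : arclen.-integrable (bd k `\` Gamma) (EFin \o G (K k)).
  by apply: (integrableS (mbd k) (m1 k)) (GK_integrable k) => x [].
have i2 k : arclen.-integrable (bd k `&` GammaW) (EFin \o G (K k)).
  by apply: (integrableS (mbd k) (m2 k)) (GK_integrable k) => x [].
have i3 k : arclen.-integrable (bd k `&` GammaIO) (EFin \o G (K k)).
  by apply: (integrableS (mbd k) (m3 k)) (GK_integrable k) => x [].
rewrite (Rintegral_sum_patch m1 i1) (Rintegral_sum_patch m2 i2) (Rintegral_sum_patch m3 i3).
have j1 := integrable_sum_patch m1 i1; have j2 := integrable_sum_patch m2 i2.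
have j3 := integrable_sum_patch m3 i3.
rewrite -RintegralD// -RintegralD//; last exact: (integrableD measurableT j1 j2).
have mG := measurable_int _ (integrable_patch mGamma GO_integrable).
rewrite [RHS]Rintegral_mkcond.
apply: (ae_Rintegral_arclen measurableT); first exact/measurable_EFinP.
apply: ae_impl ae_good_point => x gx _; rewrite -interface_sum// [RHS]big_mkcond -!big_split.
apply: eq_bigr => k _ /=; rewrite !patchE.
have dis : GammaW x -> GammaIO x -> False.
  by move=> Wx IOx; have /seteqP[/(_ x)] := Gamma_disjoint dec; case.
have [Bx|nBx] := pselect (bd k x); last first.
  by rewrite !memNset ?addr0// => -[].
have [Gx|nGx] := pselect (Gamma x); last first.
  have nW : ~ GammaW x by move=> /(GammaW_sub dec).
  have nIO : ~ GammaIO x by move=> /(GammaIO_sub dec).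
  rewrite (mem_set Bx) mem_set; last by split.
  by rewrite !memNset ?addr0// => -[].
rewrite (mem_set Bx) (@memNset _ (bd k `\` Gamma)); last by case.
case: (good_part gx Gx) => Hx.
  rewrite mem_set; last by split.
  by rewrite memNset ?addr0 ?add0r// => -[_]; exact: dis Hx.
rewrite memNset; last by move=> [_ Wx]; exact: dis Wx Hx.
by rewrite mem_set ?add0r//; split.
Qed.

Let volume_terms :
  \sum_k \int[area]_(x in K k) (\sum_(s < 2)
     dot (flux_jacobi gamma s (w x) *m phi x) (vweak_deriv (K k) s z x)) =
  \int[area]_(x in Omega) (\sum_(s < 2)
     dot (vweak_deriv Omega s z x) (flux_jacobi gamma s (w x) *m phi x)).
Proof.
have phiL (D : set (plane R)) : measurable D -> D `<=` carrier Omega -> vL2 D phi.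
  move=> mD DO j; have [+ _] := phiO j.
  exact: (L2_subset (mu := area) (measurable_carrier Omega) mD DO).
have mO := measurable_carrier Omega.
have iO := volume_form_integrable smooth_w (D := Omega) (@subset_refl _ _)
  (phiL _ mO (@subset_refl _ _)) zO.
rewrite (mesh_integral mesh iO); apply: eq_bigr => k _.
have mK := measurable_carrier (K k).
have iK := volume_form_integrable smooth_w (D := K k) (KO (k:=k))
  (phiL _ mK (KO (k:=k))) (fun j => fK k (zO j)).
apply: (ae_Rintegral (mu := area) mK).
- have /measurable_EFinP := measurable_int _ iK; apply: eq_measurable_fun => x _.
  by apply: eq_bigr => s _; rewrite dotC.
- have /measurable_EFinP := measurable_int _ (integrableS (mu := area) mO mK (KO (k:=k)) iO).
  exact.
have wd s j := weak_deriv_sub s (@open_carrier R Omega) (@open_carrier R (K k))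
  (@bounded_carrier R Omega) (KO (k:=k)) (zO j).
have := ae_forall_fin (fun s => ae_forall_fin (wd s)).
apply: ae_impl => x H Kx; apply: eq_bigr => s _; rewrite dotC; congr dot.
by apply/colP => j; rewrite !mxE H.
Qed.

Let target_derivative : JhL gamma Omega GammaW th K i w phi = Jprime gamma Omega GammaW th w phi.
Proof.
have mg : measurable_fun (GammaW : set (caratheodory_type (@hausdorff1 R)))
    (fun x => dot (lift_theta th x)
      (normal_flux_jacobi gamma (w x) (normal Omega x) *m vtrace Omega phi x)).
  have cG : compact Gamma.
    apply: (subclosed_compact (@closed_bdry _ _)
      (compact_closure_bounded (@bounded_carrier R Omega))).
    exact: Gamma_closure.
  have thL j : L2 arclen Gamma (fun x => lift_theta th x j 0).
    have [M tM] := compact_continuous_bounded cG (continuous_subspaceT (cth (j := j))).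
    have mG : measurable Gamma by apply: closed_measurable_plane; exact: closed_bdry.
    apply: (L2_bounded (mu := arclen) (M := M) mGamma); first exact: bdry_finite.
      exact: (measurable_fun_cara (continuous_measurable_plane mG (cth (j := j))) mG).
    exact: tM.
  have pL j : L2 arclen Gamma (fun x => vtrace Omega phi x j 0).
    exact: vtrace_L2.
  have mG := measurable_int _ (surface_form_integrable smooth_w Gamma_closure thL pL).
  apply: (measurable_funS mGamma (GammaW_sub dec)).
  exact/measurable_EFinP.
rewrite /JhL /Jprime.
(* Both functionals are compared with the integrand containing P(w,n), whose measurability [mg] was
   obtained above from [surface_form_integrable]. *)
transitivity (\int[arclen]_(x in GammaW) dot (lift_theta th x)
      (normal_flux_jacobi gamma (w x) (normal Omega x) *m vtrace Omega phi x)).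
  apply: (ae_Rintegral_arclen mW mg).
  apply: ae_impl ae_good_point => x gx Wx; have Gx := GammaW_sub dec Wx.
  have [k [Bk uk nk tz tp]] := good_boundary gx Gx.
  have tr f : trace_bd K f x = vtrace (K k) f x.
    rewrite /trace_bd /trace_from; case: pickP => [m /= /asboolP/uk -> //|/(_ k)].
    by rewrite /= asboolT.
  by rewrite !tr (good_trace_w gx)// tp dot_trmx wall_lin.
apply/esym/(ae_Rintegral_arclen mW mg).
apply: ae_impl ae_good_point => x gx Wx; have Gx := GammaW_sub dec Wx.
rewrite wall_jacobi//; first exact/density0/Gamma_closure.
  exact: good_w gx Wx.
exact: good_phi gx Wx.
Qed.

Lemma adjoint_consistency : continuous_adjoint gamma Omega GammaW GammaIO th w z ->
  adjoint_residual gamma Omega GammaW GammaIO th K i w z phi = 0.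
Proof.
move=> adj; have := adj phi phiV.
rewrite -volume_terms -surface_terms -target_derivative /adjoint_residual => <-.
set S1 := (X in X + _ + _ - _ - _); set S2 := (X in _ + X + _ - _ - _).
set S3 := (X in _ + _ + X - _ - _); set V := (X in _ - X - _).
suff -> : aL gamma Omega GammaW GammaIO K i w phi z = - V + S1 + S2 + S3 by ring.
congr (- _ + _ + _ + _); apply: eq_bigr => k _.
- exact: inner_integral.
- exact: wall_integral.
- exact: io_integral.
Qed.

End AdjointConsistency.

Unset Implicit Arguments.

Theorem theorem2 (R : realType) (gamma : R) (Omega : trace_domain R)
    (GammaW GammaIO : set (plane R)) (wBC : plane R -> 'cV[R]_4)
    (k : target) (alpha rho_inf : R) (v_inf : 'cV[R]_2) (L : R) (xref : plane R)
    (I : finType) (K : I -> trace_domain R) (i : wall_treatment)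
    (w z : plane R -> 'cV[R]_4) :
  let th := theta k alpha (C_infty rho_inf v_inf L) L xref in
  1 < gamma ->
  Omega !=set0 -> connected Omega ->
  boundary_decomposition Omega GammaW GammaIO ->
  0 < L -> 0 < C_infty rho_inf v_inf L -> carrier Omega xref ->
  is_mesh Omega K ->
  smooth gamma Omega w ->
  euler_solution gamma Omega GammaW GammaIO wBC w ->
  vsobolev1 Omega z ->
  continuous_adjoint gamma Omega GammaW GammaIO th w z ->
  forall phi, Vtilde gamma Omega GammaW GammaIO w phi ->
    adjoint_residual gamma Omega GammaW GammaIO th K i w z phi = 0.
Proof.
move=> th gamma1 _ _ dec _ _ _ mesh smooth_w euler_w zO adj phi phiV.
apply: (adjoint_consistency i gamma1 dec mesh smooth_w euler_w zO phiV _ adj).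
by move=> j; exact: lift_theta_continuous.
Qed.
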